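(* Let $d,n\ge 1$, $\varepsilon\in(0,1)$ and $$\delta\le \frac{1}{3n\ln(en)}.$$ There is a probability distribution for a random positive definite matrix $\Sigma\in\mathbb{R}^{d\times d}$ such that the following holds for every $(\varepsilon,\delta)$-differentially private mechanism $\mathcal{M}\colon(\mathbb{R}^d)^n\to\mathbb{R}^{d\times d}$: if the error $\alpha$ of $\mathcal{M}$ (defined below) satisfies $\alpha\in[2^{-d},\sqrt{d}/15]$, then $$n=\Omega\Big(\frac{d^2}{\varepsilon\alpha}\Big),$$ where the constant implicit in $\Omega$ is absolute.
   Context: The input of $\mathcal{M}$ is a matrix $X\in\mathbb{R}^{d\times n}$ with columns $x_1,\dots,x_n$; $\mathcal{M}$ may be randomized (with internal randomness independent of everything else). $\mathcal{M}$ is $(\varepsilon,\delta)$-differentially private if for all $X,X'\in\mathbb{R}^{d\times n}$ differing in exactly one column and every measurable set $S$, $\Pr[\mathcal{M}(X)\in S]\le e^{\varepsilon}\Pr[\mathcal{M}(X')\in S]+\delta$. Data model: $\Sigma$ is drawn from the given distribution, and conditionally on $\Sigma$ the columns $x_1,\dots,x_n$ are i.i.d. $\mathcal{N}(0,\Sigma)$. Let $\mathcal{W}=\{A \text{ symmetric}: 0.09 I\preceq A\preceq 10 I\}$. Define $\alpha_\Sigma^2=\mathbb{E}[\|\mathcal{M}(X)-\Sigma\|_F^2\mid\Sigma]$ and the error $\alpha\ge 0$ by $\alpha^2=\mathbb{E}[\alpha_\Sigma^2\mid \Sigma\in\mathcal{W}]$, where $\|\cdot\|_F$ is the Frobenius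 norm. *)

(* Defs.v *)
From HB Require Import structures.
From mathcomp Require Import all_boot all_order all_algebra.
From mathcomp Require Import all_classical all_reals all_analysis.
Set Implicit Arguments. Unset Strict Implicit. Unset Printing Implicit Defensive.
Import Order.TTheory GRing.Theory Num.Theory.
Import numFieldNormedType.Exports.
Local Open Scope classical_set_scope.
Local Open Scope ring_scope.

Definition mx_open (R : realType) (m n : nat) : set (set 'M[R]_(m, n)) :=
  [set U | open U].
Definition MX (R : realType) (m n : nat) := g_sigma_algebraType (@mx_open R m n).

Definition frob2 (R : realType) (m n : nat) (Y S : 'M[R]_(m, n)) : R :=
  \sum_(i < m) \sum_(j < n) (Y i j - S i j) ^+ 2.

Definition loewner_between (R : realType) (d : nat) (a b : R) (A : 'M[R]_d) :
  Prop :=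
  A^T = A /\
  forall v : 'cV[R]_d,
    a * (v^T *m v) ord0 ord0 <= (v^T *m A *m v) ord0 ord0 /\
    (v^T *m A *m v) ord0 ord0 <= b * (v^T *m v) ord0 ord0.

Definition Wset (R : realType) (d : nat) : set 'M[R]_d :=
  [set A | loewner_between (9 / 100) 10 A].

Definition posdef (R : realType) (d : nat) (S : 'M[R]_d) : Prop :=
  S^T = S /\ forall v : 'cV[R]_d, v != 0 -> 0 < (v^T *m S *m v) ord0 ord0.

Definition neighbors (R : realType) (d n : nat) (X X' : 'M[R]_(d, n)) : Prop :=
  exists j : 'I_n, col j X != col j X' /\
    forall k : 'I_n, k != j -> col k X = col k X'.

Definition dp (R : realType) (d n : nat) (eps delta : R)
  (M : R.-pker (MX R d n) ~> (MX R d d)) : Prop :=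
  forall (X X' : 'M[R]_(d, n)), neighbors X X' ->
  forall S : set (MX R d d), measurable S ->
    (M X S <= (expR eps)%:E * M X' S + delta%:E)%E.

(* Data matrix X = A Z, where Z has i.i.d. N(0,1) entries; conditionally on
   A (hence on Sigma = A A^T) the columns of X are i.i.d. N(0, Sigma). *)
Definition datamx (R : realType) (d n : nat) (T : Type)
  (Z : 'I_d -> 'I_n -> T -> R) (w : T) : 'M[R]_(d, n) :=
  \matrix_(i, j) Z i j w.

(* alpha_Sigma^2 for Sigma = A0 A0^T:  E[ ||M(X) - Sigma||_F^2 | Sigma ],
   computed by integrating out Z (independent of Sigma) and the internal
   randomness of M. *)
Definition alpha2_at (R : realType) (d n : nat) (dO : measure_display)
  (O : measurableType dO) (P : probability O R)
  (Z : 'I_d -> 'I_n -> O -> R) (M : R.-pker (MX R d n) ~> (MX R d d))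
  (A0 : 'M[R]_d) : \bar R :=
  (\int[P]_w
     \int[M (A0 *m datamx Z w : 'M[R]_(d, n))]_y
        (frob2 (y : 'M[R]_d) (A0 *m A0^T))%:E)%E.

Definition alpha2 (R : realType) (d n : nat) (dO : measure_display)
  (O : measurableType dO) (P : probability O R)
  (A : O -> 'M[R]_d) (Z : 'I_d -> 'I_n -> O -> R)
  (M : R.-pker (MX R d n) ~> (MX R d d)) : \bar R :=
  (((fine (P [set w | @Wset R d (A w *m (A w)^T)]))^-1)%:E *
   \int[P]_(w in [set w | @Wset R d (A w *m (A w)^T)]) alpha2_at P Z M (A w))%E.

(* Main.v *)
(** In high dimension take Sigma = (1 + N)(1 + N)^T with N supported on the lower left
    block and N = eta G there, G Gaussian; N^2 = 0, so that block of Sigma is N itself.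
    A net argument bounds the operator norm of N, hence Sigma lies in W except with
    probability 2^-d; in the exceptional event Sigma is moved out of W, so that
    conditioning on W is conditioning on [good].
    Let h be a shrunk copy of the output block, with Euclidean norm at most tau.  If the
    error is small then E<N, h> is at least a constant times E|N|^2, about d^2 eta^2.  On
    the other hand Gaussian integration by parts in G, combined with the Cameron-Martin
    density of X = (1 + N) Z, rewrites E<N, h> as
    eta^2 sum_i E sum_(a, j) Z_ji Z_ai h_aj(M(X)), and differential privacy applied to the
    i-th column bounds each summand by its value when that column is erased, where the
    expectation vanishes and the variance is at most tau^2; so the i-th summand is
    O(eps tau + delta tau d).  The choice eta = min(1/sqrt(20 d), d/(50 eps n)) gives the
    bound for d >= 3000.  In lower dimension only n eps >= 1/10 is needed, which follows
    from group privacy and the two-point prior Sigma = I/4 or 9 I. *)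
Require Import Defs.
From HB Require Import structures.
From mathcomp Require Import all_boot all_order all_algebra.
From mathcomp Require Import all_classical all_reals all_analysis.
From mathcomp Require Import measurable_realfun ring lra.
Set Implicit Arguments. Unset Strict Implicit. Unset Printing Implicit Defensive.
Import Order.TTheory GRing.Theory Num.Theory.
Import numFieldNormedType.Exports.
Local Open Scope classical_set_scope.
Local Open Scope ring_scope.

(** * Real integrals and one-dimensional Gaussian moments *)

(** Three obstacles shape the argument. The mechanism is arbitrary, so nothing can be differentiated
    through it: the change of variables to X puts all dependence on G into the density. Since 1 + N
    is unipotent, that density has no determinant and its exponent is quadratic in each entry of G,
    so every entry is treated by a one-dimensional Gaussian computation. Secondly, the delta term of
    privacy is multiplied by the supremum of the test function, so the raw output cannot be used;
    the shrink factor s2 / (s2 + |y|^2), with s2 = E|N|^2, bounds it and also cancels exactly in the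
    correlation estimate when |N|^2 = s2. Thirdly, integration by parts is applied to the full
    Gaussian law of G, whereas the error is controlled only given W; the complementary event
    therefore stays in the expectation and is paid for by a crude pointwise bound times its small
    probability. The threshold 3000 is the size at which the d^2 terms beat the fluctuation of |G|^2
    over the block, whose bound is about 126 d. In the definition of eta, the first term keeps |N|
    at most 2 with high probability, and the second makes the privacy bound on the correlation
    smaller than its lower bound. *)

Section density.
Local Open Scope ereal_scope.
Context d (T : measurableType d) (R : realType).
Import HBNNSimple.

(** Both sides are limits along the same increasing sequence of simple functions, which reduces the
    identity to indicators, where it is the hypothesis relating [mu] to [nu]. *)
Lemma ge0_integral_density (mu nu : {measure set T -> \bar R}) (g : T -> R)
    (f : T -> \bar R) :
  (forall x, 0 <= g x)%R -> measurable_fun setT g ->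
  (forall V, measurable V -> mu V = \int[nu]_(x in V) (g x)%:E) ->
  (forall x, 0 <= f x) -> measurable_fun setT f ->
  \int[mu]_x f x = \int[nu]_x (f x * (g x)%:E).
Proof.
move=> g0 mg muE f0 mf.
pose h := nnsfun_approx measurableT mf.
have mgE : measurable_fun setT (EFin \o g) by exact/measurable_EFinP.
have cvgh x : (EFin \o h n) x @[n --> \oo] --> f x.
  exact: cvg_nnsfun_approx.
have -> : \int[mu]_x f x = lim (\int[mu]_x (EFin \o h n) x @[n --> \oo]).
  have fE x : f x = lim ((EFin \o h n) x @[n --> \oo]).
    by apply/esym/cvg_lim.
  under eq_integral do rewrite fE.
  apply: monotone_convergence => //.
  - by move=> n; apply/measurable_EFinP; exact/measurable_funP.
  - by move=> n x _ //=; rewrite lee_fin.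
  - by move=> x _ a b ab; rewrite lee_fin; exact/lefP/nd_nnsfun_approx.
have -> : \int[nu]_x (f x * (g x)%:E) =
    lim (\int[nu]_x ((EFin \o h n) x * (g x)%:E) @[n --> \oo]).
  have fg x : f x * (g x)%:E = lim (((EFin \o h n) x * (g x)%:E) @[n --> \oo]).
    by apply/esym/cvg_lim => //; apply: cvgeZr.
  under eq_integral do rewrite fg.
  apply: monotone_convergence => [//| | |].
  - move=> n; apply/emeasurable_funM => //.
    exact/measurable_EFinP.
  - by move=> n x _ /=; rewrite mule_ge0 ?lee_fin.
  - move=> x _ a b ab/=; rewrite lee_wpmul2r ?lee_fin//.
    exact/lefP/nd_nnsfun_approx.
suff suf n : \int[nu]_x ((EFin \o h n) x * (g x)%:E) =
    \int[mu]_x (EFin \o h n) x.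
  by under [in RHS]eq_fun do rewrite suf.
transitivity (\int[mu]_x
   (\sum_(y \in range (h n)) (y * \1_(h n @^-1` [set y]) x)%:E)); last first.
  by apply: eq_integral => t tE; rewrite /= fimfunE -fsumEFin.
have indich m r : measurable_fun setT (fun x => (r * \1_(h m @^-1` [set r]) x)%:E).
  by apply: (measurable_comp measurableT) => //; exact: measurable_funM.
rewrite ge0_integral_fsum//; last by move=> m y Ey; exact: nnfun_muleindic_ge0.
transitivity (\int[nu]_x (\sum_(y \in range (h n))
    (y * \1_(h n @^-1` [set y]) x)%:E * (g x)%:E)).
  under [RHS]eq_integral => x xE.
    rewrite -ge0_mule_fsuml => [|y]; last exact: nnfun_muleindic_ge0.
    rewrite fsumEFin // -(fimfunE _ x); over.
  by [].
rewrite ge0_integral_fsum//; last 2 first.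
  - by move=> y; apply: emeasurable_funM.
  - by move=> m y Ey; apply: mule_ge0; [exact: nnfun_muleindic_ge0|rewrite lee_fin].
apply: eq_fsbigr => r rhn.
under [RHS]eq_integral do rewrite EFinM.
rewrite integralZl_indic_nnsfun => //.
under eq_integral do rewrite EFinM -muleA.
rewrite ge0_integralZl//.
- congr (_ * _); rewrite integral_indic// setIT muE//.
  under eq_integral do rewrite muleC.
  rewrite [RHS]integral_mkcond; apply: eq_integral => x _.
  by rewrite epatch_indic.
- apply: emeasurable_funM => //; exact/measurable_EFinP.
- by move=> x _; rewrite mule_ge0 ?lee_fin.
- by rewrite lee_fin; move: rhn; rewrite inE => -[x _ <-].
Qed.
End density.

(** * Real-valued integrals of integrable functions *)

Section rintegrable.
Context d (T : measurableType d) (R : realType) (P : {measure set T -> \bar R}).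
Implicit Types f g : T -> R.

Definition rintegrable f := P.-integrable setT (EFin \o f).

Lemma rintegrable_mfun f : rintegrable f -> measurable_fun setT f.
Proof. by move=> /measurable_int /measurable_EFinP. Qed.

Lemma rintegrableD f g : rintegrable f -> rintegrable g -> rintegrable (fun x => f x + g x).
Proof.
move=> fi gi; rewrite /rintegrable.
rewrite (_ : _ \o _ = (EFin \o f) \+ (EFin \o g))%E; first exact: integrableD.
exact/funext.
Qed.

Lemma rintegrableZ k f : rintegrable f -> rintegrable (fun x => k * f x).
Proof.
move=> fi; rewrite /rintegrable.
rewrite (_ : _ \o _ = (fun x => k%:E * (f x)%:E)%E); first exact: integrableZl.
exact/funext.
Qed.

Lemma rintegrable_ext f g : f =1 g -> rintegrable f -> rintegrable g.
Proof. by move=> fg; rewrite (_ : f = g)//; exact/funext. Qed.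

Lemma rintegrableN f : rintegrable f -> rintegrable (fun x => - f x).
Proof. by move=> /(@rintegrableZ (-1)); apply: rintegrable_ext => x; rewrite mulN1r. Qed.

Lemma rintegrableB f g : rintegrable f -> rintegrable g -> rintegrable (fun x => f x - g x).
Proof. by move=> fi /rintegrableN gi; exact: rintegrableD. Qed.

Lemma rintegrable0 : rintegrable (fun=> 0).
Proof. exact: integrable0. Qed.

Lemma rintegrable_sum (I : Type) (r : seq I) (Q : pred I) (F : I -> T -> R) :
  (forall i, Q i -> rintegrable (F i)) -> rintegrable (fun x => \sum_(i <- r | Q i) F i x).
Proof.
move=> Fi; elim: r => [|i r IH].
  by apply: rintegrable_ext rintegrable0 => x; rewrite big_nil.
case Qi : (Q i).
  by apply: rintegrable_ext (rintegrableD (Fi i Qi) IH) => x; rewrite big_cons Qi.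
by apply: rintegrable_ext IH => x; rewrite big_cons Qi.
Qed.

Lemma le_rintegrable f g : measurable_fun setT f -> (forall x, `|f x| <= g x) ->
  rintegrable g -> rintegrable f.
Proof.
move=> mf fg gi; apply: le_integrable gi => //; first exact/measurable_EFinP.
by move=> x _ /=; rewrite lee_fin (le_trans (fg x))// ler_norm.
Qed.

Lemma rintegrable_abs f : rintegrable f -> rintegrable (fun x => `|f x|).
Proof. by move=> /integrable_abse. Qed.

Lemma ge0_rintegrable f (K : R) : measurable_fun setT f -> (forall x, 0 <= f x) ->
  (\int[P]_x (f x)%:E <= K%:E)%E -> rintegrable f.
Proof.
move=> mf f0 h; apply/integrableP; split; first exact/measurable_EFinP.
under eq_integral => x _ do rewrite /= ger0_norm//.
by rewrite (le_lt_trans h)// ltry.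
Qed.

Lemma Rintegral_EFin f : rintegrable f -> (\int[P]_x (f x)%:E)%E = (\int[P]_x f x)%:E.
Proof. by move=> fi; rewrite /Rintegral fineK//; exact: integrable_fin_num. Qed.

Lemma Rintegral_sum (I : Type) (r : seq I) (Q : pred I) (F : I -> T -> R) :
  (forall i, Q i -> rintegrable (F i)) ->
  \int[P]_x (\sum_(i <- r | Q i) F i x) = \sum_(i <- r | Q i) \int[P]_x F i x.
Proof.
move=> Fi; elim: r => [|i r IH].
  by under eq_Rintegral do rewrite big_nil; rewrite Rintegral_cst// mul0r big_nil.
under eq_Rintegral do rewrite big_cons.
rewrite big_cons; case Qi : (Q i) => //.
by rewrite RintegralD// ?IH//; [exact: Fi|exact: rintegrable_sum].
Qed.

Lemma Rint_D f g : rintegrable f -> rintegrable g ->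
  \int[P]_x (f x + g x) = \int[P]_x f x + \int[P]_x g x.
Proof. by move=> fi gi; rewrite RintegralD. Qed.

Lemma Rint_B f g : rintegrable f -> rintegrable g ->
  \int[P]_x (f x - g x) = \int[P]_x f x - \int[P]_x g x.
Proof. by move=> fi gi; rewrite RintegralB. Qed.

Lemma Rint_Z k f : rintegrable f -> \int[P]_x (k * f x) = k * \int[P]_x f x.
Proof. by move=> fi; rewrite RintegralZl. Qed.

Lemma Rintegral_le f g : rintegrable f -> rintegrable g -> (forall x, f x <= g x) ->
  \int[P]_x f x <= \int[P]_x g x.
Proof. by move=> fi gi fg; apply: le_Rintegral. Qed.

End rintegrable.

Section rintegrable_prob.
Context d (T : measurableType d) (R : realType) (P : probability T R).

Lemma rintegrable_cst (k : R) : rintegrable P (fun=> k).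
Proof. exact: finite_measure_integrable_cst. Qed.

Lemma rintegrable_bounded (f : T -> R) (K : R) : measurable_fun setT f ->
  (forall x, `|f x| <= K) -> rintegrable P f.
Proof. by move=> mf fK; apply: le_rintegrable (rintegrable_cst K). Qed.

Lemma Rintegral_cst1 (k : R) : \int[P]_x k = k.
Proof. by rewrite /Rintegral integral_cst//= probability_setT mule1. Qed.

End rintegrable_prob.

(** * Translation and quadratic tilting of the standard normal law *)

Section normal1d.
Context (R : realType).
Local Notation mu := (@lebesgue_measure R).

Lemma measurable_addrl (s : R) : measurable_fun setT (fun x : measurableTypeR R => (x + s : measurableTypeR R)).
Proof. exact: measurable_funD. Qed.

Lemma lebesgue_measure_shift (s : R) (A : set (measurableTypeR R)) : measurable A ->
  pushforward mu (fun x : measurableTypeR R => (x + s : measurableTypeR R)) A = mu A.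
Proof.
move=> mA; apply/esym.
pose f := [the {mfun _ >-> _} of mfun_Sub (mem_set (measurable_addrl s))].
have -> : (fun x : measurableTypeR R => (x + s : measurableTypeR R)) = f by [].
apply: lebesgue_measure_unique => //= _ [[a b]] _ <-.
rewrite /pushforward /=.
have -> : (fun x : R => x + s) @^-1` `]a, b] = `](a - s), (b - s)]%classic.
  by apply/seteqP; split => x /=; rewrite !in_itv/=; lra.
rewrite !lebesgue_measure_itv/= !lte_fin ltrD2r.
case: ifP => // _; congr EFin; ring.
Qed.

Lemma ge0_integral_shift (s : R) (f : R -> \bar R) :
  measurable_fun [set: R] f -> (forall r, 0 <= f r)%E ->
  (\int[mu]_r f (r + s)%R = \int[mu]_r f r)%E.
Proof.
move=> mf f0.
pose g := [the {mfun _ >-> _} of mfun_Sub (mem_set (measurable_addrl s))].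
rewrite [RHS](_ : _ = \int[pushforward mu g]_r f r)%E; last first.
  by apply: eq_measure_integral => A mA _; exact/esym/(lebesgue_measure_shift s).
by rewrite ge0_integral_pushforward.
Qed.

Lemma ge0_integral_normal_prob (m s : R) (f : R -> \bar R) :
  measurable_fun [set: R] f -> (forall r, 0 <= f r)%E ->
  (\int[normal_prob m s]_r f r = \int[mu]_r (f r * (normal_pdf m s r)%:E))%E.
Proof.
move=> mf f0; apply: ge0_integral_density => //.
- exact: normal_pdf_ge0.
- exact: measurable_normal_pdf.
Qed.

Local Notation gam := (@normal_prob R 0 1).

Lemma normal_pdf01E (t : R) :
  normal_pdf 0 1 t = (Num.sqrt (pi *+ 2))^-1 * expR (- (t ^+ 2) / 2).
Proof.
rewrite normal_pdfE ?oner_eq0// /normal_peak /normal_fun.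
by rewrite subr0 expr1n mul1r.
Qed.

(** One-dimensional Cameron-Martin formula: translation invariance of Lebesgue measure, then
    completing the square in the normal density. *)
Lemma gauss_shift (s : R) (f : R -> \bar R) :
  measurable_fun [set: R] f -> (forall r, 0 <= f r)%E ->
  (\int[gam]_t f (t + s)%R =
   \int[gam]_t (f t * (expR (s * t - s ^+ 2 / 2))%:E))%E.
Proof.
move=> mf f0.
have mfs : measurable_fun [set: R] (fun t => f (t + s)%R).
  by apply: measurableT_comp => //; exact: measurable_funD.
have mexp : measurable_fun [set: R] (fun t => expR (s * t - s ^+ 2 / 2)).
  apply: measurableT_comp => //; exact: measurable_funB.
rewrite !ge0_integral_normal_prob//; last 2 first.
- by apply: emeasurable_funM => //; exact/measurable_EFinP.
- by move=> r; rewrite mule_ge0// lee_fin expR_ge0.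
rewrite -[RHS](ge0_integral_shift s); first last.
- by move=> r; rewrite !mule_ge0// lee_fin ?expR_ge0 ?normal_pdf_ge0.
- apply: emeasurable_funM; last first.
    by apply/measurable_EFinP; exact: measurable_normal_pdf.
  by apply: emeasurable_funM => //; exact/measurable_EFinP.
apply: eq_integral => t _; rewrite -muleA -EFinM; congr (_ * _%:E)%E.
by rewrite !normal_pdf01E mulrCA -expRD; congr (_ * expR _); field.
Qed.

(** Completing the square turns the integrand times the standard density into a constant times the
    normal density of mean b / q and variance 1 / q, whose total mass is 1. *)
Lemma gauss_quad (b q : R) : 0 < q ->
  (\int[gam]_t (expR (b * t - (q - 1) * t ^+ 2 / 2))%:E =
   ((Num.sqrt q)^-1 * expR (b ^+ 2 / (2 * q)))%:E)%E.
Proof.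
move=> q0.
have sq0 : 0 < Num.sqrt q by rewrite sqrtr_gt0.
have mexp : measurable_fun [set: R] (fun t => expR (b * t - (q - 1) * t ^+ 2 / 2)).
  apply: measurableT_comp => //; apply: measurable_funB => //.
  by apply: measurable_funM => //; apply: measurable_funM => //; exact: measurable_funX.
rewrite ge0_integral_normal_prob; first last.
- by move=> r; rewrite lee_fin expR_ge0.
- exact/measurable_EFinP.
pose m := b / q; pose s := (Num.sqrt q)^-1.
have s0 : s != 0 by rewrite invr_neq0// gt_eqF.
have s2 : s ^+ 2 = q^-1 by rewrite exprVn sqr_sqrtr// ltW.
transitivity (\int[mu]_t (((Num.sqrt q)^-1 * expR (b ^+ 2 / (2 * q)))%:E * (normal_pdf m s t)%:E))%E.
  apply: eq_integral => t _; rewrite -!EFinM normal_pdf01E normal_pdfE// /normal_peak /normal_fun.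
  congr EFin; rewrite s2.
  have -> : Num.sqrt (q^-1 * pi *+ 2) = s * Num.sqrt (pi *+ 2).
    by rewrite -mulrnAr sqrtrM ?invr_ge0 ?ltW// -s2 sqrtr_sqr ger0_norm// invr_ge0 ltW.
  rewrite [(s * _)^-1]invfM /s invrK.
  have -> : (Num.sqrt q)^-1 * expR (b ^+ 2 / (2 * q)) *
    (Num.sqrt q / Num.sqrt (pi *+ 2) * expR (- (t - m) ^+ 2 / (q^-1 *+ 2))) =
    (Num.sqrt (pi *+ 2))^-1 * (expR (b ^+ 2 / (2 * q)) * expR (- (t - m) ^+ 2 / (q^-1 *+ 2))).
    have p0 : Num.sqrt (pi *+ 2 : R) != 0 by rewrite gt_eqF// sqrtr_gt0 mulrn_wgt0// pi_gt0.
    by field; rewrite p0 gt_eqF.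
  rewrite mulrCA -!expRD; congr (_ * expR _); rewrite /m; field.
  by rewrite gt_eqF.
have mpdf : measurable_fun [set: measurableTypeR R] (fun x => (normal_pdf m s x)%:E).
  by apply/measurable_EFinP; exact: measurable_normal_pdf.
have pdf0 x : [set: measurableTypeR R] x -> (0 <= (normal_pdf m s x)%:E)%E.
  by move=> _; rewrite lee_fin normal_pdf_ge0.
rewrite (ge0_integralZl _ _ mpdf pdf0)//.
by rewrite integral_normal_pdf mule1.
Qed.

End normal1d.

Section centered.
Context d (T : measurableType d) (R : realType) (P : {measure set T -> \bar R}).

(** A moment generating function even and smooth in x forces a zero mean, and no differentiation
    under the integral is used: 1 + x Y <= exp(x Y) gives x I <= K (exp(c x^2) - 1) = O(x^2) for the
    mean I and every small x of either sign, hence I = 0. Integrability comes from |Y| <= exp(Y) +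
    exp(-Y). *)
Lemma mgf_centered (Y rho : T -> R) (K c : R) :
  measurable_fun setT Y -> measurable_fun setT rho -> (forall t, 0 <= rho t) ->
  0 <= c ->
  (forall x : R, \int[P]_t (expR (x * Y t) * rho t)%:E = (K * expR (c * x ^+ 2))%:E)%E ->
  rintegrable P (fun t => Y t * rho t) /\ \int[P]_t (Y t * rho t) = 0.
Proof.
move=> mY mr r0 c0 mgf.
have mexp x : measurable_fun setT (fun t => expR (x * Y t) * rho t).
  by apply: measurable_funM => //; apply: measurableT_comp => //; exact: measurable_funM.
have iexp x : rintegrable P (fun t => expR (x * Y t) * rho t).
  apply: (@ge0_rintegrable _ _ _ _ _ (K * expR (c * x ^+ 2))) => //.
    by move=> t; rewrite mulr_ge0 ?expR_ge0.
  by rewrite mgf.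
have irho : rintegrable P rho.
  by apply: rintegrable_ext (iexp 0) => t; rewrite mul0r expR0 mul1r.
have iY : rintegrable P (fun t => Y t * rho t).
  apply: (@le_rintegrable _ _ _ _ _ (fun t => expR (1 * Y t) * rho t + expR (-1 * Y t) * rho t)).
  - exact: measurable_funM.
  - move=> t; rewrite normrM (ger0_norm (r0 t)) -mulrDl ler_wpM2r// mul1r mulN1r.
    have := expR_ge1Dx (Y t); have := expR_ge1Dx (- Y t).
    have := expR_ge0 (Y t); have := expR_ge0 (- Y t).
    by move=> ? ? ? ?; rewrite ler_norml; apply/andP; split; lra.
  - exact: rintegrableD.
split=> //.
have K0 : \int[P]_t (rho t) = K.
  transitivity (\int[P]_t (expR (0 * Y t) * rho t)).
    by apply: eq_Rintegral => t _; rewrite mul0r expR0 mul1r.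
  by rewrite /Rintegral mgf expr0n mulr0 expR0 mulr1.
have Kge0 : 0 <= K by rewrite -K0; apply: Rintegral_ge0.
set I := \int[P]_t _.
have key x : K + x * I <= K * expR (c * x ^+ 2).
  have -> : K * expR (c * x ^+ 2) = \int[P]_t (expR (x * Y t) * rho t) by rewrite /Rintegral mgf.
  have iZ := rintegrableZ x iY.
  rewrite -K0 /I -RintegralZl// -RintegralD//.
  apply: Rintegral_le => //; first exact: rintegrableD.
  move=> t; rewrite mulrA -{1}[rho t]mul1r -mulrDl ler_wpM2r//.
  exact: expR_ge1Dx.
have ub (y : R) : 0 <= y <= 1/2 -> expR y <= 1 + 2 * y.
  move=> /andP[y0 y1]; have := expR_ge1Dx (- y); rewrite expRN => h.
  have e0 := expR_gt0 y.
  have : (1 - y) * expR y <= 1.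
    by rewrite -ler_pdivlMr// mul1r; rewrite [1-y]addrC -[_+1]addrC.
  nra.
have small x : c * x ^+ 2 <= 1/2 -> x * I <= 2 * K * c * x ^+ 2.
  move=> h; have h0 : 0 <= c * x ^+ 2 by rewrite mulr_ge0// sqr_ge0.
  have := key x; have := ub (c * x ^+ 2); rewrite h0 h => /(_ isT) u k.
  have := ler_wpM2l Kge0 u; rewrite !mulrA; nra.
have le0 (J : R) : (forall x, 0 < x -> c * x ^+ 2 <= 1/2 -> x * J <= 2 * K * c * x ^+ 2) -> J <= 0.
  move=> hJ; rewrite leNgt; apply/negP => J0.
  pose D := 1 + 2 * c + 2 * K * c.
  have Kc0 := mulr_ge0 Kge0 c0.
  have D1 : 1 <= D by rewrite /D; lra.
  (* This choice gives x D <= 1/2, so that c x^2 <= 1/2 and [hJ] applies, and x D <= J / 2, which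
     contradicts its conclusion J <= 2 K c x. *)
  pose x := J / (2 * (1 + J) * D).
  have x0 : 0 < x by rewrite divr_gt0// !mulr_gt0//; lra.
  have xD : x * D * (1 + J) = J / 2.
    by rewrite /x; field; rewrite !gt_eqF//; lra.
  have xDJ : x * D <= J / 2 by nra.
  have xD1 : x * D <= 1 / 2 by nra.
  have xKc : 0 <= x * (K * c) by rewrite mulr_ge0// ltW.
  have xc0 : 0 <= x * c by rewrite mulr_ge0// ltW.
  have xDE : x * D = x + 2 * (x * c) + 2 * (x * (K * c)) by rewrite /D; ring.
  have := hJ x x0.
  have -> : c * x ^+ 2 <= 1 / 2 by rewrite expr2 mulrA [c * x]mulrC; nra.
  move=> /(_ isT).
  have -> : 2 * K * c * x ^+ 2 = x * (2 * (x * (K * c))) by ring.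
  rewrite ler_pM2l//; lra.
apply/eqP; rewrite eq_le; apply/andP; split.
  by apply: le0 => x x0; exact: small.
rewrite -oppr_le0; apply: le0 => x x0 h.
by have := small (- x); rewrite sqrrN => /(_ h); rewrite mulNr mulrN.
Qed.
End centered.

Section gauss_moments.
Context (R : realType).
Local Notation gam := (@normal_prob R 0 1).

Lemma gauss_mgf (b : R) : (\int[gam]_t (expR (b * t))%:E = (expR (b ^+ 2 / 2))%:E)%E.
Proof.
have := @gauss_quad R b 1 ltr01; rewrite sqrtr1 invr1 mul1r mulr1 => <-.
by apply: eq_integral => t _; rewrite subrr !mul0r subr0.
Qed.

Lemma measurable_gquad (B Q : R) :
  measurable_fun [set: measurableTypeR R] (fun t : R => expR (B * t - Q * t ^+ 2 / 2)).
Proof.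
apply: measurableT_comp => //; apply: measurable_funB => //.
by apply: measurable_funM => //; apply: measurable_funM => //; exact: measurable_funX.
Qed.

(** Up to sign, the factor (1 + Q) t - B is the logarithmic derivative of the tilted density, so
    this is integration by parts for one Gaussian variable. It follows from [mgf_centered], because
    inserting exp(x ((1 + Q) t - B)) only changes the linear coefficient in [gauss_quad]. *)
Lemma gauss_tilt_centered (B Q : R) : 0 <= Q ->
  rintegrable gam (fun t => ((1 + Q) * t - B) * expR (B * t - Q * t ^+ 2 / 2)) /\
  \int[gam]_t (((1 + Q) * t - B) * expR (B * t - Q * t ^+ 2 / 2)) = 0.
Proof.
move=> Q0.
have q0 : 0 < 1 + Q by lra.
apply: (@mgf_centered _ _ R gam _ _ ((Num.sqrt (1 + Q))^-1 * expR (B ^+ 2 / (2 * (1 + Q)))) ((1 + Q) / 2)).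
- by apply: measurable_funB.
- exact: measurable_gquad.
- by move=> t; exact: expR_ge0.
- by rewrite divr_ge0//; lra.
move=> x.
transitivity (\int[gam]_t ((expR (- x * B))%:E * (expR ((B + x * (1 + Q)) * t - (1 + Q - 1) * t ^+ 2 / 2))%:E))%E.
  apply: eq_integral => t _; rewrite -EFinM -!expRD; congr (expR _)%:E; ring.
have me : measurable_fun [set: measurableTypeR R] (fun t => (expR ((B + x * (1 + Q)) * t - (1 + Q - 1) * t ^+ 2 / 2))%:E).
  by apply/measurable_EFinP; exact: measurable_gquad.
have e0 t : [set: measurableTypeR R] t -> (0 <= (expR ((B + x * (1 + Q)) * t - (1 + Q - 1) * t ^+ 2 / 2))%:E)%E.
  by move=> _; rewrite lee_fin expR_ge0.
rewrite (ge0_integralZl _ _ me e0)//.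
rewrite gauss_quad// -EFinM mulrCA -!mulrA -!expRD; congr (_ * expR _)%:E; field.
by rewrite gt_eqF.
Qed.

Lemma gauss_mean : rintegrable gam (fun t => t) /\ \int[gam]_t t = 0.
Proof.
have [] := @gauss_tilt_centered 0 0 (lexx _) => i m; split.
  apply: rintegrable_ext i => t.
  by rewrite addr0 mul1r !mul0r !subr0 expR0 mulr1.
rewrite -[RHS]m; apply: eq_Rintegral => t _.
by rewrite addr0 mul1r !mul0r !subr0 expR0 mulr1.
Qed.

Lemma pow4_le_expR (x : R) : x ^+ 4 <= 256 * (expR x + expR (- x)).
Proof.
wlog x0 : x / 0 <= x => [h|].
  have [|x0] := lerP 0 x; first exact: h.
  by have := h (- x); rewrite exprNn opprK addrC oppr_ge0 -signr_odd mul1r; apply; exact: ltW.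
have h1 : (x / 4) ^+ 4 <= expR x.
  have -> : x = x / 4 * 4%:R by lra.
  rewrite expRM_natr lerXn2r ?nnegrE ?expR_ge0 ?mulfK// ?divr_ge0//.
  by rewrite (le_trans _ (expR_ge1Dx _))// lerDr.
have := expR_ge0 (- x); move: h1; rewrite expr_div_n; lra.
Qed.

Lemma gauss_iexp b : rintegrable gam (fun t => expR (b * t)).
Proof.
apply: (@ge0_rintegrable _ _ _ _ _ (expR (b ^+ 2 / 2))).
- by apply: measurableT_comp => //; exact: measurable_funM.
- by move=> t; exact: expR_ge0.
- by rewrite gauss_mgf.
Qed.

(** A rough constant suffices: the fourth power is dominated by exponentials, which gives 512
    exp(1/2) < 1000. *)
Lemma gauss_int4 : rintegrable gam (fun t => t ^+ 4) /\
  \int[gam]_t (t ^+ 4) <= 1000.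
Proof.
have iD : rintegrable gam (fun t => expR (1 * t) + expR (-1 * t)).
  by apply: rintegrableD; exact: gauss_iexp.
have iD2 := rintegrableZ 256 iD.
have i4 : rintegrable gam (fun t => t ^+ 4).
  apply: le_rintegrable iD2; first exact: measurable_funX.
  by move=> t; rewrite ger0_norm ?exprn_even_ge0// mul1r mulN1r pow4_le_expR.
split=> //.
apply: (@le_trans _ _ (\int[gam]_t (256 * (expR (1 * t) + expR (-1 * t))))).
  by apply: Rintegral_le => //= t; rewrite mul1r mulN1r pow4_le_expR.
rewrite RintegralZl// RintegralD//; try exact: gauss_iexp.
rewrite /Rintegral !gauss_mgf sqrrN expr1n /=.
have h : expR (1 / 2) * expR (1/2) = expR 1 :> R by rewrite -expRD; congr expR; lra.
have e2 : expR (- (1 / 4) : R) ^+ 4 = expR (-1) by rewrite -expRM_natr; congr expR; lra.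
have e1 : expR (-1) * expR 1 = 1 :> R by rewrite -expRD addrC subrr expR0.
have b1 := expR_ge1Dx (- (1/4) : R); have a0 := expR_ge0 (1/2 : R).
have b4 : (3/4) ^+ 4 <= expR (- (1 / 4) : R) ^+ 4 by rewrite lerXn2r ?nnegrE//; lra.
rewrite e2 in b4.
have e3 : expR 1 <= 4 :> R by have := expR_ge0 (1 : R); nra.
nra.
Qed.

(** The second moment is read off from [gauss_quad] with b = 0 and q = 1 / u^2, where the integral
    equals u. Bounding the exponential below by its tangent gives the linear inequality [key] for M;
    u slightly above 1 yields M <= 1 and u slightly below 1 yields M >= 1. *)
Lemma gauss_int2 : rintegrable gam (fun t => t ^+ 2) /\
  \int[gam]_t (t ^+ 2) = 1.
Proof.
have [i4 _] := gauss_int4.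
have i2 : rintegrable gam (fun t => t ^+ 2).
  apply: le_rintegrable (rintegrableD (rintegrable_cst _ 1) i4).
    exact: measurable_funX.
  by move=> t; rewrite ger0_norm ?sqr_ge0//; have := sqr_ge0 (t ^+ 2 - 1); nra.
split=> //; set M := Rintegral _ _ _.
have key u : 0 < u -> 2 * u ^+ 2 - (1 - u ^+ 2) * M <= 2 * u ^+ 3.
  move=> u0; have u20 : 0 < u ^- 2 by rewrite invr_gt0 exprn_gt0.
  have := @gauss_quad R 0 (u ^- 2) u20.
  have -> : Num.sqrt (u ^- 2) = u^-1 by rewrite -exprVn sqrtr_sqr gtr0_norm// invr_gt0.
  rewrite invrK expr0n /= [X in expR X]mul0r expR0 mulr1 => E.
  have iE : rintegrable gam (fun t => expR (0 * t - (u ^- 2 - 1) * t ^+ 2 / 2)).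
    apply: (@ge0_rintegrable _ _ _ _ _ u).
    - exact: measurable_gquad.
    - by move=> t; exact: expR_ge0.
    - by rewrite E.
  have iZ := rintegrableZ (- ((u ^- 2 - 1) / 2)) i2.
  have : \int[gam]_t (1 + - ((u ^- 2 - 1) / 2) * t ^+ 2) <= u.
    rewrite [leRHS](_ : _ = \int[gam]_t (expR (0 * t - (u ^- 2 - 1) * t ^+ 2 / 2))); last by rewrite /Rintegral E.
    apply: Rintegral_le => //.
      by apply: rintegrableD => //; exact: rintegrable_cst.
    move=> t; apply: le_trans (expR_ge1Dx _); rewrite lerD2l; lra.
  rewrite RintegralD//; last exact: rintegrable_cst.
  rewrite Rintegral_cst1 RintegralZl// -/M => h.
  have u2 : 0 < u ^+ 2 by rewrite exprn_gt0.
  have := ler_wpM2l (ltW u2) h.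
  have -> : u ^+ 2 * (1 + - ((u ^- 2 - 1) / 2) * M) = u ^+ 2 - (1 - u ^+ 2) * M / 2.
    by field; rewrite gt_eqF.
  rewrite [u ^+ 3]exprSr; lra.
have M0 : 0 <= M by apply: Rintegral_ge0 => t _; exact: sqr_ge0.
apply/eqP; rewrite eq_le; apply/andP; split; apply/ler_addgt0Pr => e e0.
  have [e1|e1] := lerP e 1.
    have := key (1 + e / 3); have : 0 < 1 + e / 3 by lra.
    move=> -> /(_ isT); set v := e / 3; have v0 : 0 < v by rewrite divr_gt0.
    have -> : e = 3 * v by rewrite /v; lra.
    have v1 : v <= 1/3 by rewrite /v; lra.
    move=> k; have : v * ((2 + v) * M) <= v * (2 * (1 + v) ^+ 2) by nra.
    rewrite ler_pM2l// => k2; nra.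
  by have := key (4 / 3); rewrite divr_gt0// => /(_ isT); nra.
have [e1|e1] := lerP e 1; last by nra.
have := key (1 - e / 2); have : 0 < 1 - e / 2 by lra.
move=> -> /(_ isT); set v := e / 2; have v0 : 0 < v by rewrite divr_gt0.
have -> : e = 2 * v by rewrite /v; lra.
have v1 : v <= 1/2 by rewrite /v; lra.
move=> k; have : v * (2 * (1 - v) ^+ 2) <= v * ((2 - v) * M) by nra.
rewrite ler_pM2l// => k2; nra.
Qed.
End gauss_moments.

(** * Gaussian matrices *)

Section mx_measurable.
Context (R : realType).

Lemma measurable_coord m n (i : 'I_m) (j : 'I_n) :
  measurable_fun [set: MX R m n] (fun X : MX R m n => fun_of_matrix X i j).
Proof.
apply: (@measurability _ _ _ _ _ _ (@RGenOpens.G R)).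
  exact: RGenOpens.measurableE.
move=> _ [_ [a [b ->]] <-]; rewrite setTI.
apply: sub_sigma_algebra; rewrite /mx_open /=.
apply: open_comp; last exact: interval_open.
by move=> X _; exact: coord_continuous.
Qed.

(** The sigma-algebra on matrices is generated by open sets. An open set is the countable union of
    the rational boxes of radius 1 / (N + 1) that it contains, and each box is a finite intersection
    of conditions on single entries. *)
Lemma measurable_mxP d (T : measurableType d) m n (f : T -> MX R m n) :
  (forall i j, measurable_fun setT (fun x => fun_of_matrix (f x) i j)) ->
  measurable_fun setT f.
Proof.
move=> mf.
apply: (@measurability _ _ T (MX R m n) setT f (@mx_open R m n)).
  by [].
move=> _ [U oU <-]; rewrite setTI.
pose box (q : 'M[rat]_(m, n) * nat) : set 'M[R]_(m, n) :=
  [set X | forall i j, `|X i j - ratr (q.1 i j)| < q.2.+1%:R^-1].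
have -> : f @^-1` U = \bigcup_q (if pselect (box q `<=` U) then f @^-1` (box q) else set0).
  apply/seteqP; split=> x /=.
    move=> Ux.
    have := open_nbhs_nbhs (conj oU Ux).
    move=> /nbhs_ballP [e /= e0 eU].
    have [N Ne] : exists N : nat, N.+1%:R^-1 < e / 2 :> R.
      have [N _ hN] := near_infty_natSinv_lt (PosNum (divr_gt0 e0 (@ltr0n R 2))).
      by exists N; exact: (hN N (leqnn N)).
    have N0 : 0 < N.+1%:R^-1 :> R by rewrite invr_gt0.
    have qx i j : exists q : rat, `|fun_of_matrix (f x) i j - ratr q| < N.+1%:R^-1 :> R.
      have /rat_in_itvoo[q] : fun_of_matrix (f x) i j - N.+1%:R^-1 < fun_of_matrix (f x) i j + N.+1%:R^-1.
        by rewrite ltrD2l gtrN.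
      by rewrite in_itv/= => hq; exists q; rewrite ltr_distlC.
    pose q := \matrix_(i, j) projT1 (cid (qx i j)).
    have bq : box (q, N) (f x).
      by move=> i j; rewrite /= mxE; exact: (projT2 (cid (qx i j))).
    exists (q, N) => //=; case: pselect => // -[] X bX; apply: eU.
    split => // i j; rewrite /ball /= distrC.
    have -> : X i j - fun_of_matrix (f x) i j = (X i j - ratr (q i j)) - (fun_of_matrix (f x) i j - ratr (q i j)) by ring.
    apply: le_lt_trans (ler_normB _ _) _.
    have h1 : `|X i j - ratr (q i j)| < N.+1%:R^-1 := bX i j.
    have h2 : `|fun_of_matrix (f x) i j - ratr (q i j)| < N.+1%:R^-1 := bq i j.
    by rewrite [ltRHS](splitr e) (lt_le_trans (ltrD h1 h2))// lerD// ltW.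
  by move=> [q _]; case: pselect => // qU qx; apply: (qU).
apply: countable_bigcupT_measurable; first exact: countableP.
move=> q; case: pselect => qU /=; last exact: measurable0.
have -> : f @^-1` box q = \bigcap_(ij in [set: 'I_m * 'I_n])
    ((fun x => `|fun_of_matrix (f x) ij.1 ij.2 - ratr (q.1 ij.1 ij.2)|) @^-1` `]-oo, q.2.+1%:R^-1[).
  apply/seteqP; split=> x /=.
    by move=> h [i j] _ /=; rewrite in_itv/=; exact: h.
  by move=> h i j; have := h (i, j) Logic.I; rewrite /= in_itv.
apply: fin_bigcap_measurable => //= -[i j] _ /=.
rewrite -[X in measurable X]setTI.
suff mm : measurable_fun setT (fun x => `|fun_of_matrix (f x) i j - ratr (q.1 i j)|).
  exact: mm.
by apply: measurableT_comp => //; apply: measurable_funB.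
Qed.

Lemma measurable_mx_comp d (T : measurableType d) m n (f : T -> MX R m n) i j :
  measurable_fun setT f ->
  measurable_fun setT (fun x => fun_of_matrix (f x) i j).
Proof.
by move=> mf; apply: (measurableT_comp (@measurable_coord m n i j)).
Qed.
End mx_measurable.

Section tonelli.
Local Open Scope ereal_scope.
Context d1 d2 (T1 : measurableType d1) (T2 : measurableType d2) (R : realType).
Context (P1 : probability T1 R) (P2 : probability T2 R).

Lemma integral_prob_cst (C : \bar R) : \int[P1]_x C = C.
Proof. by rewrite integral_cst// [X in _ * X]probability_setT mule1. Qed.

Lemma tonelli12 (f : T1 * T2 -> \bar R) : measurable_fun setT f ->
  (forall p, 0 <= f p) -> \int[P1 \x P2]_p f p = \int[P1]_x \int[P2]_y f (x, y).
Proof. by move=> mf f0; rewrite fubini_tonelli1. Qed.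

Lemma tonelli (f : T1 * T2 -> \bar R) : measurable_fun setT f ->
  (forall p, 0 <= f p) ->
  \int[P1]_x \int[P2]_y f (x, y) = \int[P2]_y \int[P1]_x f (x, y).
Proof. by move=> mf f0; exact: (fubini_tonelli f mf f0). Qed.

Lemma measurable_tonelli1 (f : T1 * T2 -> \bar R) : measurable_fun setT f ->
  (forall p, 0 <= f p) -> measurable_fun setT (fun x => \int[P2]_y f (x, y)).
Proof. by move=> mf f0; exact: (measurable_fun_fubini_tonelli_F f mf f0). Qed.

End tonelli.

Section gauss_row.
Context (R : realType).
Local Notation gam := (@normal_prob R 0 1).

Definition consrow N (p : measurableTypeR R * MX R 1 N) : MX R 1 N.+1 :=
  \row_j (if unlift ord0 j is Some k then fun_of_matrix p.2 ord0 k else p.1).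

Lemma measurable_consrow N : measurable_fun setT (@consrow N).
Proof.
apply: measurable_mxP => i j; rewrite /consrow.
under eq_fun do rewrite mxE.
case: (unlift ord0 j) => [k|]; last exact: measurable_fst.
by apply: measurable_mx_comp; exact: measurable_snd.
Qed.

HB.instance Definition _ N := isMeasurableFun.Build _ _ _ _ (@consrow N) (@measurable_consrow N).

Definition gstep N (Q : probability (MX R 1 N) R) : probability (MX R 1 N.+1) R :=
  [the probability _ _ of distribution [the probability _ _ of (gam \x Q)%E] (@consrow N)].

Lemma ge0_integral_gstep N (Q : probability (MX R 1 N) R) (f : MX R 1 N.+1 -> \bar R) :
  measurable_fun setT f -> (forall w, 0 <= f w)%E ->
  (\int[gstep Q]_w f w = \int[gam]_t \int[Q]_w f (consrow (t, w)))%E.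
Proof.
move=> mf f0; rewrite [LHS](ge0_integral_distribution (@consrow N) mf f0).
have mfc : measurable_fun setT (fun p => f (@consrow N p)) := measurableT_comp mf (@measurable_consrow N).
exact: (tonelli12 gam Q mfc (fun=> f0 _)).
Qed.

(** The standard Gaussian law on rows, built by adjoining one independent coordinate at a time;
    Gaussian matrices are obtained from it by reshaping. *)
Fixpoint grow N : probability (MX R 1 N) R :=
  match N with
  | 0 => [the probability _ _ of @dirac _ (MX R 1 0) (0 : 'M[R]_(1, 0)) R]
  | N'.+1 => gstep (grow N')
  end.

Definition updr N (w : MX R 1 N) (c : 'I_N) (t : R) : MX R 1 N :=
  \row_j (if j == c then t else fun_of_matrix w ord0 j).

Lemma measurable_updr N (c : 'I_N) :
  measurable_fun setT (fun p : MX R 1 N * measurableTypeR R => updr p.1 c p.2).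
Proof.
apply: measurable_mxP => i j; rewrite /updr.
under eq_fun do rewrite mxE.
case: (j == c); first exact: measurable_snd.
by apply: measurable_mx_comp; exact: measurable_fst.
Qed.

Lemma measurable_cons1 N (t : R) : measurable_fun setT (fun w : MX R 1 N => consrow (t, w)).
Proof. exact: (measurableT_comp (@measurable_consrow N) (pair1_measurable t)). Qed.

Lemma updr_cons0 N t (w : MX R 1 N) t' : updr (consrow (t, w)) ord0 t' = consrow (t', w).
Proof.
apply/rowP => j; rewrite !mxE; case: unliftP => [k ->|->]; last by rewrite eqxx.
by rewrite -(inj_eq val_inj)/=.
Qed.

Lemma updr_consS N t (w : MX R 1 N) c t' :
  updr (consrow (t, w)) (lift ord0 c) t' = consrow (t, updr w c t').
Proof.
apply/rowP => j; rewrite !mxE; case: unliftP => [k ->|->].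
  by rewrite (inj_eq lift_inj) mxE.
by rewrite -(inj_eq val_inj)/=.
Qed.

(** Replacing a coordinate by an independent copy preserves the law. Independence is used in this
    form from here on, since it allows one-dimensional identities to be applied to a single entry.
    For the first coordinate it is Tonelli's theorem, for the others the induction hypothesis. *)
Lemma grow_resample N (c : 'I_N) (f : MX R 1 N -> \bar R) :
  measurable_fun setT f -> (forall w, 0 <= f w)%E ->
  (\int[grow N]_w f w = \int[grow N]_w \int[gam]_t f (updr w c t))%E.
Proof.
elim: N c f => [[]//|N IH] c f mf f0.
have mfupd : measurable_fun setT (fun p : MX R 1 N.+1 * measurableTypeR R => f (updr p.1 c p.2)).
  exact: (measurableT_comp mf (@measurable_updr _ c)).
have mI : measurable_fun setT (fun w : MX R 1 N.+1 => \int[gam]_t f (updr w c t))%E.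
  exact: (measurable_fun_fubini_tonelli_F (m2 := gam) _ mfupd).
have I0 w : (0 <= \int[gam]_t f (updr w c t))%E by exact: integral_ge0.
have mfc : measurable_fun setT (fun p => f (@consrow N p)) := measurableT_comp mf (@measurable_consrow N).
have L1 : (\int[grow N.+1]_w f w = \int[gam]_t \int[grow N]_w f (consrow (t, w)))%E.
  exact: (ge0_integral_gstep (grow N) mf f0).
have L2 : (\int[grow N.+1]_w \int[gam]_t f (updr w c t) =
    \int[gam]_t \int[grow N]_w \int[gam]_t' f (updr (consrow (t, w)) c t'))%E.
  exact: (ge0_integral_gstep (grow N) mI I0).
rewrite L1 L2; case: (unliftP ord0 c) => [k ->|->].
  apply: eq_integral => t _.
  rewrite (IH k _ (measurableT_comp mf (measurable_cons1 t)) (fun=> f0 _)).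
  by apply: eq_integral => w _; apply: eq_integral => t' _; rewrite updr_consS.
under [RHS]eq_integral => t _ do under eq_integral => w _ do
  under eq_integral => t' _ do rewrite updr_cons0.
rewrite integral_prob_cst.
exact: (tonelli gam (grow N) mfc (fun=> f0 _)).
Qed.

End gauss_row.

Section gauss_mx.
Context (R : realType) (m n : nat).
Local Notation gam := (@normal_prob R 0 1).
Local Notation I := ('I_m * 'I_n)%type.

Definition vecm (w : MX R 1 (m * n)) : MX R m n := vec_mx (w : 'M[R]_(1, m * n)).

Lemma vecmE w i j : fun_of_matrix (vecm w) i j = fun_of_matrix w ord0 (mxvec_index i j).
Proof. by rewrite -mxvecE /vecm vec_mxK. Qed.

Lemma measurable_vecm : measurable_fun setT vecm.
Proof.
apply: measurable_mxP => i j; under eq_fun do rewrite vecmE.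
exact: measurable_coord.
Qed.

HB.instance Definition _ := isMeasurableFun.Build _ _ _ _ vecm measurable_vecm.

Definition gmx : probability (MX R m n) R :=
  [the probability _ _ of distribution (grow R (m * n)) vecm].

Definition updm (w : MX R m n) (c : I) (t : R) : MX R m n :=
  \matrix_(k, l) (if (k, l) == c then t else fun_of_matrix w k l).

Lemma updm_vecm w c t : vecm (updr w (mxvec_index c.1 c.2) t) = updm (vecm w) c t.
Proof.
apply/matrixP => k l; rewrite vecmE [in RHS]mxE mxE vecmE.
suff -> : (mxvec_index k l == mxvec_index c.1 c.2) = ((k, l) == c) by [].
case: c => i j /=; case: (curry_mxvec_bij m n) => g gK _.
apply/eqP/eqP => [h|[-> ->]//].
by rewrite -[(k, l)](gK _ isT) -[(i, j)](gK _ isT) /= h.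
Qed.

Lemma measurable_updm (c : I) :
  measurable_fun setT (fun p : MX R m n * measurableTypeR R => updm p.1 c p.2).
Proof.
apply: measurable_mxP => i j; rewrite /updm.
under eq_fun do rewrite mxE.
case: (_ == c); first exact: measurable_snd.
by apply: measurable_mx_comp; exact: measurable_fst.
Qed.

Lemma measurable_updm1 (w : MX R m n) c : measurable_fun setT (fun t : measurableTypeR R => updm w c t).
Proof. exact: (measurableT_comp (@measurable_updm c) (pair1_measurable w)). Qed.

Lemma updm_id (w : MX R m n) c t : fun_of_matrix (updm w c t) c.1 c.2 = t.
Proof. by rewrite mxE -surjective_pairing eqxx. Qed.

Lemma updm_neq (w : MX R m n) c t i j : (i, j) != c -> fun_of_matrix (updm w c t) i j = fun_of_matrix w i j.
Proof. by rewrite mxE => /negbTE ->. Qed.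

Lemma gmx_resample (c : I) (f : MX R m n -> \bar R) :
  measurable_fun setT f -> (forall w, 0 <= f w)%E ->
  (\int[gmx]_w f w = \int[gmx]_w \int[gam]_t f (updm w c t))%E.
Proof.
move=> mf f0.
have mfupd : measurable_fun setT (fun p : MX R m n * measurableTypeR R => f (updm p.1 c p.2)).
  exact: (measurableT_comp mf (@measurable_updm c)).
have mI : measurable_fun setT (fun w : MX R m n => \int[gam]_t f (updm w c t))%E.
  exact: (measurable_fun_fubini_tonelli_F (m2 := gam) _ mfupd).
have I0 w : (0 <= \int[gam]_t f (updm w c t))%E by exact: integral_ge0.
have mfv : measurable_fun setT (fun w => f (vecm w)) := measurableT_comp mf measurable_vecm.
rewrite [LHS](ge0_integral_distribution vecm mf f0) [RHS](ge0_integral_distribution vecm mI I0).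
rewrite [LHS](grow_resample (mxvec_index c.1 c.2) mfv (fun=> f0 _)).
by apply: eq_integral => w _; apply: eq_integral => t _; rewrite /= updm_vecm.
Qed.

Lemma gmx_indep_ge0 (c : I) (psi : R -> R) (F : MX R m n -> R) :
  measurable_fun [set: measurableTypeR R] psi -> measurable_fun setT F ->
  (forall t, 0 <= psi t) -> (forall w, 0 <= F w) ->
  (forall w t, F (updm w c t) = F w) ->
  (\int[gmx]_w (psi (fun_of_matrix w c.1 c.2) * F w)%:E =
   \int[gam]_t (psi t)%:E * \int[gmx]_w (F w)%:E)%E.
Proof.
move=> mpsi mF psi0 F0 Fc.
rewrite (gmx_resample c); first last.
- by move=> w; rewrite lee_fin mulr_ge0.
- apply/measurable_EFinP; apply: measurable_funM => //.
  exact: (measurableT_comp mpsi (measurable_coord _ _)).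
rewrite -ge0_integralZl//; first last.
- by apply: integral_ge0 => t _; rewrite lee_fin.
- by move=> w _; rewrite lee_fin.
- exact/measurable_EFinP.
apply: eq_integral => w _.
under eq_integral => t _ do rewrite updm_id Fc mulrC EFinM.
have mp : measurable_fun [set: measurableTypeR R] (fun t => (psi t)%:E) by exact/measurable_EFinP.
have p0 t : [set: measurableTypeR R] t -> (0 <= (psi t)%:E)%E by rewrite lee_fin.
by rewrite (ge0_integralZl _ _ mp p0) ?lee_fin// muleC.
Qed.

Lemma gmx_indep_ge0R (c : I) (psi : R -> R) (F : MX R m n -> R) :
  rintegrable gam psi -> rintegrable gmx F ->
  (forall t, 0 <= psi t) -> (forall w, 0 <= F w) ->
  (forall w t, F (updm w c t) = F w) ->
  rintegrable gmx (fun w => psi (fun_of_matrix w c.1 c.2) * F w) /\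
  \int[gmx]_w (psi (fun_of_matrix w c.1 c.2) * F w) = \int[gam]_t psi t * \int[gmx]_w F w.
Proof.
move=> ipsi iF psi0 F0 Fc.
have mpsi := rintegrable_mfun ipsi; have mF := rintegrable_mfun iF.
have h := gmx_indep_ge0 mpsi mF psi0 F0 Fc.
rewrite (Rintegral_EFin ipsi) (Rintegral_EFin iF) -EFinM in h.
split; last by rewrite /Rintegral h.
apply: ge0_rintegrable; last by rewrite h.
- apply: measurable_funM => //.
  exact: (measurableT_comp mpsi (measurable_coord _ _)).
- by move=> w; rewrite mulr_ge0.
Qed.

Lemma gmx_indep (c : I) (psi : R -> R) (F : MX R m n -> R) :
  rintegrable gam psi -> rintegrable gmx F ->
  (forall w t, F (updm w c t) = F w) ->
  rintegrable gmx (fun w => psi (fun_of_matrix w c.1 c.2) * F w) /\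
  \int[gmx]_w (psi (fun_of_matrix w c.1 c.2) * F w) = \int[gam]_t psi t * \int[gmx]_w F w.
Proof.
move=> ipsi iF Fc.
(* [pos] and [neg] are twice the positive and negative parts, whence the factor 1/4 in [dec]. *)
pose pos (x : R) : R := `|x| + x; pose neg (x : R) : R := `|x| - x.
have posE x : 0 <= pos x by have := ler_norm (- x); rewrite normrN /pos; lra.
have negE x : 0 <= neg x by rewrite /neg subr_ge0 ler_norm.
have i1 : rintegrable gam (fun t => pos (psi t)) by apply: rintegrableD => //; exact: rintegrable_abs.
have i2 : rintegrable gam (fun t => neg (psi t)) by apply: rintegrableB => //; exact: rintegrable_abs.
have j1 : rintegrable gmx (fun t => pos (F t)) by apply: rintegrableD => //; exact: rintegrable_abs.
have j2 : rintegrable gmx (fun t => neg (F t)) by apply: rintegrableB => //; exact: rintegrable_abs.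
have [a11 b11] : _ /\ _ := @gmx_indep_ge0R c _ _ i1 j1 (fun t => posE (psi t)) (fun w => posE (F w)) (fun w t => congr1 pos (Fc w t)).
have [a12 b12] : _ /\ _ := @gmx_indep_ge0R c _ _ i1 j2 (fun t => posE (psi t)) (fun w => negE (F w)) (fun w t => congr1 neg (Fc w t)).
have [a21 b21] : _ /\ _ := @gmx_indep_ge0R c _ _ i2 j1 (fun t => negE (psi t)) (fun w => posE (F w)) (fun w t => congr1 pos (Fc w t)).
have [a22 b22] : _ /\ _ := @gmx_indep_ge0R c _ _ i2 j2 (fun t => negE (psi t)) (fun w => negE (F w)) (fun w t => congr1 neg (Fc w t)).
set x := fun w : MX R m n => psi (fun_of_matrix w c.1 c.2).
have dec : (fun w => x w * F w) =1 (fun w => 4^-1 *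
   ((pos (x w) * pos (F w) - pos (x w) * neg (F w)) -
    (neg (x w) * pos (F w) - neg (x w) * neg (F w)))).
  by move=> w; rewrite /pos /neg; field.
have A1 := rintegrableB a11 a12; have A2 := rintegrableB a21 a22; have A3 := rintegrableB A1 A2.
split; first by apply: rintegrable_ext (rintegrableZ 4^-1 A3) => w; rewrite dec.
transitivity (\int[gmx]_w (4^-1 *
   ((pos (x w) * pos (F w) - pos (x w) * neg (F w)) -
    (neg (x w) * pos (F w) - neg (x w) * neg (F w))))).
  by apply: eq_Rintegral => w _; rewrite dec.
rewrite RintegralZl// !RintegralB// b11 b12 b21 b22 /pos /neg.
have ia := rintegrable_abs ipsi; have ja := rintegrable_abs iF.
rewrite !RintegralB// !RintegralD//.
by field.
Qed.

Lemma gmx_coord (c : I) (psi : R -> R) : rintegrable gam psi ->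
  rintegrable gmx (fun w => psi (fun_of_matrix w c.1 c.2)) /\
  \int[gmx]_w (psi (fun_of_matrix w c.1 c.2)) = \int[gam]_t psi t.
Proof.
move=> ipsi; have [i e] := @gmx_indep c psi (fun=> 1) ipsi (rintegrable_cst gmx 1) (fun _ _ => erefl).
split; first by apply: rintegrable_ext i => w; rewrite mulr1.
rewrite Rintegral_cst1 mulr1 in e; rewrite -e.
by apply: eq_Rintegral => w _; rewrite mulr1.
Qed.

Lemma gmx_prod (L : seq I) (psi : I -> R -> R) : uniq L ->
  (forall c, measurable_fun [set: measurableTypeR R] (psi c)) -> (forall c t, 0 <= psi c t) ->
  (\int[gmx]_w (\prod_(c <- L) psi c (fun_of_matrix w c.1 c.2))%:E =
   \prod_(c <- L) \int[gam]_t (psi c t)%:E)%E.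
Proof.
move=> + mpsi psi0.
have mc c : measurable_fun setT (fun w : MX R m n => psi c (fun_of_matrix w c.1 c.2)).
  exact: (measurableT_comp (mpsi c) (measurable_coord _ _)).
have mp L' : measurable_fun setT (fun w : MX R m n => \prod_(c <- L') psi c (fun_of_matrix w c.1 c.2)).
  by apply: measurable_prod => c _; exact: mc.
elim: L => [|c L IH] /=.
  by move=> _; under eq_integral do rewrite big_nil; rewrite integral_cst//= probability_setT mule1 big_nil.
move=> /andP[cL uL]; rewrite big_cons -IH//.
under eq_integral do rewrite big_cons.
rewrite gmx_indep_ge0//.
- by move=> w; apply: prodr_ge0.
move=> w t; apply: eq_big_seq => c' c'L; congr (psi c' _).
rewrite updm_neq// -surjective_pairing; apply: contraNneq cL => <-; exact: c'L.
Qed.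


(** * Triangular shifts of a Gaussian matrix *)

Section cameron_martin.
Variables (L0 : pred I) (s : I -> MX R m n -> R).
Hypothesis ms : forall c, measurable_fun setT (s c).
Hypothesis s_ext : forall c (w w' : MX R m n),
  (forall i j, (i, j) \notin L0 -> fun_of_matrix w i j = fun_of_matrix w' i j) -> s c w = s c w'.

Definition shiftm (L : seq I) (w : MX R m n) : MX R m n :=
  \matrix_(i, j) (fun_of_matrix w i j + (if (i, j) \in L then s (i, j) w else 0)).

Lemma measurable_shiftm L : measurable_fun setT (shiftm L).
Proof.
apply: measurable_mxP => i j; under eq_fun do rewrite mxE.
apply: measurable_funD; first exact: measurable_coord.
by case: (_ \in L).
Qed.

Lemma s_updm c c' w t : c' \in L0 -> s c (updm w c' t) = s c w.
Proof.
move=> c'L; apply: s_ext => i j; rewrite mxE; case: eqP => // ->.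
by rewrite c'L.
Qed.

Lemma s_shiftm c L w : {subset L <= L0} -> s c (shiftm L w) = s c w.
Proof.
move=> LL; apply: s_ext => i j; rewrite mxE; case: ifPn => [/LL ->//|_ _].
by rewrite addr0.
Qed.

(** Entries in [L0] are moved by amounts that depend only on entries outside [L0], so the shift is
    triangular with unit Jacobian. Entries are removed from [L] one at a time: when entry c is
    resampled the amount [s c w] is a constant, and [gauss_shift] produces its factor of the
    density. *)
Lemma gmx_shift L (F : MX R m n -> \bar R) : uniq L -> {subset L <= L0} ->
  measurable_fun setT F -> (forall w, 0 <= F w)%E ->
  (\int[gmx]_w F (shiftm L w) =
   \int[gmx]_w (F w * (\prod_(c <- L) expR (s c w * fun_of_matrix w c.1 c.2 - s c w ^+ 2 / 2))%:E))%E.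
Proof.
elim: L F => [|c L IH] F.
  move=> _ _ mF F0; apply: eq_integral => w _; rewrite big_nil mule1; congr F.
  by apply/matrixP => i j; rewrite mxE addr0.
move=> /= /andP[cL uL] LL mF F0.
have cL0 : c \in L0 by apply: LL; rewrite mem_head.
have LL' : {subset L <= L0} by move=> x xL; apply: LL; rewrite inE xL orbT.
have me : measurable_fun setT (fun w : MX R m n => expR (s c w * fun_of_matrix w c.1 c.2 - s c w ^+ 2 / 2)).
  apply: measurableT_comp => //; apply: measurable_funB.
    by apply: measurable_funM => //; exact: measurable_coord.
  by apply: measurable_funM => //; exact: measurable_funX.
pose F' w := (F w * (expR (s c w * fun_of_matrix w c.1 c.2 - s c w ^+ 2 / 2))%:E)%E.
have mF' : measurable_fun setT F'.
  by apply: emeasurable_funM => //; exact/measurable_EFinP.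
have F'0 w : (0 <= F' w)%E by rewrite mule_ge0// lee_fin expR_ge0.
transitivity (\int[gmx]_w F' (shiftm L w))%E; last first.
  rewrite (IH F' uL LL' mF' F'0); apply: eq_integral => w _.
  by rewrite big_cons /F' EFinM muleA.
rewrite (gmx_resample c (measurableT_comp mF (measurable_shiftm (c :: L))) (fun=> F0 _)).
rewrite (gmx_resample c (measurableT_comp mF' (measurable_shiftm L)) (fun=> F'0 _)) /=.
apply: eq_integral => w _.
have E1 t : shiftm (c :: L) (updm w c t) = shiftm L (updm w c (t + s c w)).
  apply/matrixP => i j; rewrite [LHS]mxE [RHS]mxE !s_updm// inE.
  rewrite ![updm _ _ _ _ _]mxE; case: eqP => [->|_]//=.
  by rewrite (negbTE cL) addr0.
under eq_integral => t _ do rewrite E1.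
have mFs : measurable_fun [set: R] (fun t => F (shiftm L (updm w c t))).
  apply: measurableT_comp mF _; apply: measurableT_comp (measurable_shiftm _) _.
  exact: measurable_updm1.
rewrite (gauss_shift (s c w) mFs (fun=> F0 _)).
apply: eq_integral => t _; rewrite /F' s_shiftm// s_updm//.
suff -> : fun_of_matrix (shiftm L (updm w c t)) c.1 c.2 = t by [].
by rewrite mxE updm_id -surjective_pairing (negbTE cL) addr0.
Qed.
End cameron_martin.

End gauss_mx.

(** * Differential privacy for expectations *)

Section kernel_expectation.
Context d1 d2 (T1 : measurableType d1) (T2 : measurableType d2) (R : realType).
Variable M : R.-pker T1 ~> T2.

(** A named copy of [M X], introduced to carry the structure of a probability measure. *)
Definition kmeas (X : T1) : set T2 -> \bar R := M X.
HB.instance Definition _ X := Measure.on (kmeas X).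

Lemma kmeas_setT X : kmeas X setT = 1%E.
Proof. exact: prob_kernel. Qed.

HB.instance Definition _ X := Measure_isProbability.Build _ _ _ (kmeas X) (kmeas_setT X).

Definition Kint (h : T2 -> R) (X : T1) : R := \int[kmeas X]_y h y.

(** Adding [K] makes the integrand nonnegative, the case covered by the measurability of kernel
    integrals. *)
Lemma measurable_Kint (h : T2 -> R) (K : R) : measurable_fun setT h ->
  (forall y, `|h y| <= K) -> measurable_fun setT (Kint h).
Proof.
move=> mh hK.
have hK0 y : 0 <= h y + K by have := hK y; rewrite ler_norml; lra.
have mhK : measurable_fun setT (fun y => h y + K) by exact: measurable_funD.
have E X : Kint h X = fine (\int[M X]_y (h y + K)%:E) - K.
  rewrite /Kint; have ih := rintegrable_bounded (kmeas X) mh hK.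
  have -> : (\int[M X]_y (h y + K)%:E)%E = (\int[kmeas X]_y (h y + K)%:E)%E by [].
  rewrite Rintegral_EFin; last by apply: rintegrableD => //; exact: rintegrable_cst.
  by rewrite RintegralD ?Rintegral_cst1 ?addrK//; exact: rintegrable_cst.
rewrite (_ : Kint h = (fun X => fine (\int[M X]_y (h y + K)%:E) - K)); last exact/funext.
apply: measurable_funB => //.
apply: measurableT_comp => //.
apply: (@measurable_fun_integral_kernel _ _ _ _ _ M) => //.
- by move=> U mU; exact: measurable_kernel.
- exact/measurable_EFinP.
Qed.

Lemma Kint_bound (h : T2 -> R) (K : R) X : measurable_fun setT h ->
  (forall y, `|h y| <= K) -> `|Kint h X| <= K.
Proof.
move=> mh hK; have ih := rintegrable_bounded (kmeas X) mh hK.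
apply: (le_trans (le_normr_Rintegral measurableT ih)).
rewrite -[leRHS](Rintegral_cst1 (kmeas X)).
by apply: Rintegral_le => //; [exact: rintegrable_abs|exact: rintegrable_cst].
Qed.

End kernel_expectation.

(** * From events to bounded test functions *)

Section staircase.
Context (R : realType).

(** A layer-cake sum with step h: counting the levels l h below x recovers x from above up to one
    step, as long as x does not exceed the top level N h. *)
Lemma staircase (N : nat) (h x : R) : 0 <= h ->
  Num.min x (N%:R * h) <= \sum_(l < N) h * (l%:R * h < x)%R%:R /\
  (0 <= x -> \sum_(l < N) h * (l%:R * h < x)%R%:R <= x + h).
Proof.
move=> h0.
have ub M : \sum_(l < M) h * (l%:R * h < x)%R%:R <= M%:R * h.
  have -> : M%:R * h = \sum_(l < M) h by rewrite sumr_const card_ord mulr_natl.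
  by apply: ler_sum => i _; case: (_ < _); rewrite ?mulr1 ?mulr0.
elim: N => [|N [IH1 IH2]].
  rewrite big_ord0 mul0r; split; first by rewrite ge_min lexx orbT.
  by move=> x0; rewrite addr_ge0.
rewrite big_ord_recr /=; case: (ltP (N%:R * h) x) => Nx.
  rewrite mulr1; split.
    rewrite ge_min; apply/orP; right; rewrite -natr1 mulrDl mul1r lerD2r.
    by apply: le_trans IH1; rewrite le_min lexx andbT ltW.
  by move=> x0; rewrite lerD2r (le_trans (ub N))// ltW.
rewrite mulr0 addr0; split => //.
by apply: le_trans IH1; rewrite le_min !ge_min lexx/= Nx.
Qed.
End staircase.

Section dp_integral.
Context d1 d2 (T1 : measurableType d1) (T2 : measurableType d2) (R : realType).
Variables (M : R.-pker T1 ~> T2) (eps delta : R) (X X' : T1).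
Hypothesis HM : forall S, measurable S -> (M X S <= (expR eps)%:E * M X' S + delta%:E)%E.

(** Privacy is applied to each level set of the staircase approximation of [f] and summed with
    weight h. The additive terms add up to (N + 1) h delta = T delta independently of N, while the
    discretisation error exp(eps) h is made smaller than e. *)
Lemma dp_bounded (f : T2 -> R) (T : R) : measurable_fun setT f ->
  (forall y, 0 <= f y <= T) -> 0 <= T ->
  \int[kmeas M X]_y f y <= expR eps * \int[kmeas M X']_y f y + delta * T.
Proof.
move=> mf f0T T0.
have fabs y : `|f y| <= T by case/andP: (f0T y) => a b; rewrite ger0_norm.
apply/ler_addgt0Pr => e e0.
have [N Ne] : exists N : nat, expR eps * (T / N.+1%:R) < e.
  have [N _ hN] := near_infty_natSinv_lt (PosNum (divr_gt0 e0 (ltr_pwDl ltr01 (mulr_ge0 (expR_ge0 eps) T0)))).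
  exists N; have := hN N (leqnn N) => /=.
  have P0 := mulr_ge0 (expR_ge0 eps) T0.
  have q0 : 0 < N.+1%:R^-1 :> R by rewrite invr_gt0.
  rewrite ltr_pdivlMr; last by lra.
  rewrite mulrDr mulr1 => hlt.
  have -> : expR eps * (T / N.+1%:R) = N.+1%:R^-1 * (expR eps * T) by ring.
  by rewrite (lt_trans _ hlt)// ltrDr.
pose h := T / N.+1%:R.
have h0 : 0 <= h by rewrite divr_ge0.
pose A l := [set y | l%:R * h < f y].
have mA l : measurable (A l).
  rewrite -[A l]setTI; have := mf measurableT `]l%:R * h, +oo[%classic (measurable_itv _).
  by congr measurable; congr setI; apply/seteqP; split => y /=; rewrite in_itv/= andbT.
pose g y : R := \sum_(l < N.+1) h * \1_(A l) y.
have gE y : g y = \sum_(l < N.+1) h * (l%:R * h < f y)%R%:R.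
  by apply: eq_bigr => l _; rewrite indicE mem_setE.
have Nh : N.+1%:R * h = T by rewrite /h mulrC divfK.
have g1 y : f y <= g y.
  rewrite gE; have [+ _] := staircase N.+1 (f y) h0.
  by rewrite Nh min_l//; case/andP: (f0T y).
have g2 y : g y <= f y + h.
  by rewrite gE; have [_] := staircase N.+1 (f y) h0; apply; case/andP: (f0T y).
have iA (Y : T1) l : rintegrable (kmeas M Y) (\1_(A l)).
  apply: (@rintegrable_bounded _ _ _ _ _ 1) => // y.
  by rewrite indicE; case: (_ \in _); rewrite ?normr1 ?normr0.
have if_ (Y : T1) : rintegrable (kmeas M Y) f := rintegrable_bounded _ mf fabs.
have ig (Y : T1) : rintegrable (kmeas M Y) g by apply: rintegrable_sum => l _; exact: rintegrableZ.
have Eg (Y : T1) : \int[kmeas M Y]_y g y = \sum_(l < N.+1) h * fine (M Y (A l)).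
  rewrite Rintegral_sum; last by move=> l _; exact: rintegrableZ.
  apply: eq_bigr => l _; rewrite (Rint_Z _ (iA Y l)); congr (_ * _).
  by rewrite /Rintegral integral_indic// setIT.
have finM (Y : T1) l : M Y (A l) \is a fin_num by exact: (fin_num_measure (kmeas M Y)).
apply: (@le_trans _ _ (\int[kmeas M X]_y g y)); first exact: Rintegral_le.
apply: (@le_trans _ _ (expR eps * \int[kmeas M X']_y g y + delta * T)).
  rewrite !Eg mulr_sumr.
  have -> : delta * T = \sum_(l < N.+1) h * delta.
    by rewrite sumr_const card_ord -mulr_natl mulrA Nh mulrC.
  rewrite -big_split/=; apply: ler_sum => l _.
  rewrite mulrCA -mulrDr ler_wpM2l// -lee_fin EFinD EFinM !fineK//.
  exact: HM.
have : \int[kmeas M X']_y g y <= \int[kmeas M X']_y f y + h.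
  rewrite -(Rintegral_cst1 (kmeas M X') h) -(Rint_D (if_ X') (rintegrable_cst _ h)).
  by apply: Rintegral_le => //; apply: rintegrableD => //; exact: rintegrable_cst.
move=> /(ler_wpM2l (expR_ge0 eps)); rewrite mulrDr -/h in Ne *; lra.
Qed.
End dp_integral.

Section dp_signed.
Context d1 d2 (T1 : measurableType d1) (T2 : measurableType d2) (R : realType).
Variables (M : R.-pker T1 ~> T2) (eps delta : R) (X X' : T1).
Hypothesis HM : forall S, measurable S -> (M X S <= (expR eps)%:E * M X' S + delta%:E)%E.
Hypothesis HM' : forall S, measurable S -> (M X' S <= (expR eps)%:E * M X S + delta%:E)%E.
Hypothesis eps01 : 0 < eps < 1.
Hypothesis delta0 : 0 <= delta.

(** The positive part is transferred from X to X' and the negative part from X' to X, so both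
    directions of privacy are used. The right-hand side mentions X' alone: later X' is the data with
    one column erased, where moments of [f] can be computed. *)
Lemma dp_signed (f : T2 -> R) (T : R) : measurable_fun setT f ->
  (forall y, `|f y| <= T) ->
  \int[kmeas M X]_y f y <= \int[kmeas M X']_y f y
     + 3 * eps * \int[kmeas M X']_y `|f y| + 2 * delta * T.
Proof.
move=> mf fT; have [e0 e1] := andP eps01.
pose p y : R := (`|f y| + f y) / 2; pose q y : R := (`|f y| - f y) / 2.
have mabs : measurable_fun setT (fun y => `|f y|) by exact: measurableT_comp.
have mp : measurable_fun setT p by apply: measurable_funM => //; exact: measurable_funD.
have mq : measurable_fun setT q by apply: measurable_funM => //; exact: measurable_funB.
have pT y : 0 <= p y <= T.
  by have := fT y; have := ler_norm (f y); have := ler_norm (- f y); rewrite normrN /p; lra.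
have qT y : 0 <= q y <= T.
  by have := fT y; have := ler_norm (f y); have := ler_norm (- f y); rewrite normrN /q; lra.
have T0 : 0 <= T by rewrite (le_trans _ (fT point)).
have ip Y : rintegrable (kmeas M Y) p.
  by apply: (@rintegrable_bounded _ _ _ _ _ T) => // y; case/andP: (pT y) => *; rewrite ger0_norm.
have iq Y : rintegrable (kmeas M Y) q.
  by apply: (@rintegrable_bounded _ _ _ _ _ T) => // y; case/andP: (qT y) => *; rewrite ger0_norm.
have fE Y : \int[kmeas M Y]_y f y = \int[kmeas M Y]_y p y - \int[kmeas M Y]_y q y.
  transitivity (\int[kmeas M Y]_y (p y - q y)); last exact: Rint_B (ip Y) (iq Y).
  by apply: eq_Rintegral => y _; rewrite /p /q; lra.
have aE Y : \int[kmeas M Y]_y `|f y| = \int[kmeas M Y]_y p y + \int[kmeas M Y]_y q y.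
  transitivity (\int[kmeas M Y]_y (p y + q y)); last exact: Rint_D (ip Y) (iq Y).
  by apply: eq_Rintegral => y _; rewrite /p /q; lra.
have h1 := dp_bounded HM mp pT T0.
have h2 := dp_bounded HM' mq qT T0.
rewrite !fE aE.
have a0 Y : 0 <= \int[kmeas M Y]_y p y by apply: Rintegral_ge0 => y _; case/andP: (pT y).
have b0 Y : 0 <= \int[kmeas M Y]_y q y by apply: Rintegral_ge0 => y _; case/andP: (qT y).
move: h1 h2 (a0 X) (b0 X) (a0 X') (b0 X').
set a := \int[_]_y _; set a' := \int[_]_y _; set b' := \int[_]_y _; set b := \int[_]_y _.
move=> h1 h2 A0 B0 A0' B0'.
(* From exp(-eps/2) >= 1 - eps/2 one gets exp(eps) (1 - eps/2)^2 <= 1, and (1 + 3 eps) (1 - eps/2)^2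
   - 1 = (3/4) eps (1 - eps) (8/3 - eps) >= 0. *)
have E1 : expR eps <= 1 + 3 * eps.
  have := expR_ge1Dx (- eps / 2); have := expR_gt0 (eps / 2).
  have : expR (eps / 2) * expR (- eps / 2) = 1 by rewrite -expRD mulNr subrr expR0.
  have : expR eps = expR (eps / 2) * expR (eps / 2) by rewrite -expRD; congr expR; lra.
  set x := expR (eps / 2); set z := expR (- eps / 2) => -> xz x0 zz.
  have : x * (1 - eps / 2) <= x * z by rewrite ler_pM2l//; lra.
  rewrite xz => hx.
  have u0 : 0 < 1 - eps / 2 by lra.
  have hxx : (x * (1 - eps / 2)) * (x * (1 - eps / 2)) <= 1.
    by rewrite -[leRHS]mulr1 ler_pM// mulr_ge0// ltW.
  rewrite -(ler_pM2r (mulr_gt0 u0 u0)).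
  have -> : x * x * ((1 - eps / 2) * (1 - eps / 2)) = (x * (1 - eps / 2)) * (x * (1 - eps / 2)) by ring.
  apply: le_trans hxx _.
  have : 0 <= eps * ((1 - eps) * (8 / 3 - eps)) by rewrite !mulr_ge0//; lra.
  nra.
have E2 : 1 <= expR eps by rewrite -expR0 ler_expR ltW.
have dT : 0 <= delta * T by rewrite mulr_ge0.
have h3 : b' - b <= 3 * eps * b' + delta * T.
  have [bb|bb] := lerP b' b; first by have := mulr_ge0 (ltW e0) B0'; lra.
  have : (expR eps - 1) * b <= 3 * eps * b by rewrite ler_wpM2r//; lra.
  have : 3 * eps * b <= 3 * eps * b' by rewrite ler_wpM2l//; lra.
  rewrite mulrBl; lra.
have : expR eps * a' <= (1 + 3 * eps) * a' by rewrite ler_wpM2r.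
lra.
Qed.
End dp_signed.

(** * Operator norms via a lattice net *)

Section net.
Context (R : realType) (d : nat).
Implicit Types (u v : 'I_d -> R) (N : 'M[R]_d).

Definition bil N u v : R := \sum_i \sum_j u i * N i j * v j.
Definition sqn u : R := \sum_i u i ^+ 2.

Lemma sqn_ge0 u : 0 <= sqn u.
Proof. by apply: sumr_ge0 => i _; exact: sqr_ge0. Qed.

Lemma bilZ N a b u v : bil N (fun i => a * u i) (fun i => b * v i) = a * b * bil N u v.
Proof.
rewrite /bil mulr_sumr; apply: eq_bigr => i _; rewrite mulr_sumr.
by apply: eq_bigr => j _; ring.
Qed.

Lemma bil_split N y z x x' :
  bil N y z = bil N x x' + bil N (fun i => y i - x i) z + bil N x (fun i => z i - x' i).
Proof.
rewrite /bil -!big_split/=; apply: eq_bigr => i _; rewrite -!big_split/=.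
by apply: eq_bigr => j _; ring.
Qed.

Lemma sqnZ a u : sqn (fun i => a * u i) = a ^+ 2 * sqn u.
Proof. by rewrite /sqn mulr_sumr; apply: eq_bigr => i _; rewrite exprMn. Qed.

(* Coordinates are stored shifted by [4 * d]: [zv] recovers the integer vector. *)
Definition netpt := {ffun 'I_d -> 'I_(4 * d + 4 * d).+1}.
Definition zv (x : netpt) (i : 'I_d) : R := (x i)%:R - (4 * d)%:R.
Definition l1 u : R := \sum_i `|u i|.

(** Integer points of the ball of radius 4 sqrt d. The condition on [l1] follows from the Euclidean
    one by Cauchy-Schwarz; it is recorded because the counting of the net uses it. *)
Definition in_net (x : netpt) : bool := (l1 (zv x) <= 4 * d%:R) && (sqn (zv x) <= 16 * d%:R).

(** Rounding is toward zero, so that it moves a coordinate by at most 1 and never increases its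
    absolute value; the rounded vector then stays in the ball. *)
Lemma trunc_ord (K : nat) (y : R) : `|y| <= K%:R ->
  exists k : 'I_(K + K).+1, `|k%:R - K%:R| <= `|y| /\ `|y - (k%:R - K%:R)| <= 1.
Proof.
move=> yK.
have [y0|y0] := lerP 0 y.
  rewrite ger0_norm// in yK *.
  have := truncn_itv y0 => /andP[t1 t2].
  have tK : (Num.truncn y <= K)%N by rewrite -(ler_nat R) (le_trans t1).
  have kK : (K + Num.truncn y < (K + K).+1)%N by rewrite ltnS leq_add2l.
  exists (Ordinal kK) => /=; rewrite natrD addrAC subrr add0r.
  rewrite ger0_norm// ger0_norm ?subr_ge0//; split => //.
  by rewrite lerBlDl -natr1 in t2 *; lra.
rewrite ltr0_norm// in yK *.
have y0' : 0 <= - y by lra.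
have := truncn_itv y0' => /andP[t1 t2].
have tK : (Num.truncn (- y) <= K)%N by rewrite -(ler_nat R) (le_trans t1).
have kK : (K - Num.truncn (- y) < (K + K).+1)%N by rewrite ltnS (leq_trans (leq_subr _ _))// leq_addr.
exists (Ordinal kK) => /=; rewrite natrB// addrAC subrr add0r normrN ger0_norm//.
rewrite opprK; split => //.
rewrite ler_norml; rewrite -natr1 in t2; lra.
Qed.

Lemma net_approx (y : 'I_d -> R) : sqn y <= 16 * d%:R ->
  exists x : netpt, in_net x /\ sqn (fun i => y i - zv x i) <= d%:R.
Proof.
move=> yd.
have yi i : `|y i| <= (4 * d)%:R.
  have d1 : 1 <= d%:R :> R by rewrite ler1n; case: d i {y yd} => // -[].
  have h : y i ^+ 2 <= 16 * d%:R.
    by apply: le_trans yd; rewrite /sqn (bigD1 i)//= lerDl sumr_ge0// => *; exact: sqr_ge0.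
  rewrite -ler_sqr ?nnegrE// real_normK ?num_real// natrM exprMn.
  by apply: le_trans h _; nra.
have /choice[f fP] : forall i, exists k : 'I_(4 * d + 4 * d).+1,
    `|k%:R - (4 * d)%:R| <= `|y i| /\ `|y i - (k%:R - (4 * d)%:R)| <= 1.
  by move=> i; exact: trunc_ord.
exists [ffun i => f i].
have E i : zv [ffun i => f i] i = (f i)%:R - (4 * d)%:R by rewrite /zv ffunE.
split; last first.
  rewrite -[leRHS](mulr_natl 1) mulr1 /sqn.
  rewrite (_ : d%:R = \sum_(i < d) 1 :> R); last by rewrite sumr_const card_ord.
  apply: ler_sum => i _; rewrite E; have [_ h] := fP i.
  by rewrite -real_normK ?num_real// expr_le1.
have s : sqn (zv [ffun i => f i]) <= 16 * d%:R.
  apply: le_trans yd; apply: ler_sum => i _; rewrite E.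
  have [h _] := fP i.
  by rewrite -[leLHS]real_normK ?num_real// -[leRHS]real_normK ?num_real// ler_sqr ?nnegrE.
apply/andP; split => //.
have : l1 (zv [ffun i => f i]) <= \sum_(i < d) ((zv [ffun i => f i] i) ^+ 2 / 8 + 2).
  apply: ler_sum => i _; have := sqr_ge0 (`|zv [ffun i => f i] i| - 4).
  rewrite sqrrB real_normK ?num_real//; lra.
rewrite big_split/= -mulr_suml sumr_const card_ord -[2 *+ d]mulr_natr => h.
by apply: le_trans h _; rewrite -/(sqn _); lra.
Qed.

(** Any bound K on the bilinear form improves itself to (beta + K) / 2, starting from beta plus the
    sum of the absolute values of the entries; iterating leaves beta. *)
Lemma net_opnorm N (beta : R) : 0 <= beta ->
  (forall x x' : netpt, in_net x -> in_net x' -> bil N (zv x) (zv x') <= 8 * d%:R * beta) ->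
  forall u v, sqn u <= 1 -> sqn v <= 1 -> bil N u v <= beta.
Proof.
move=> b0 hN.
have [d0|d0] := posnP d.
  by move=> u v _ _; rewrite /bil big1// => i _; move: (ltn_ord i); rewrite [X in (_ < X)%N]d0.
have d1 : 0 < d%:R :> R by rewrite ltr0n.
pose C K := forall u v, sqn u <= 1 -> sqn v <= 1 -> bil N u v <= K.
pose D : R := \sum_i \sum_j `|N i j|.
have D0 : 0 <= D by apply: sumr_ge0 => i _; apply: sumr_ge0.
have CD : C (beta + D).
  move=> u v u1 v1; apply: (@le_trans _ _ D); last by rewrite lerDr.
  have coord (w : 'I_d -> R) i : sqn w <= 1 -> `|w i| <= 1.
    move=> w1; have : w i ^+ 2 <= 1.
      by apply: le_trans w1; rewrite /sqn (bigD1 i)//= lerDl sumr_ge0// => *; exact: sqr_ge0.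
    by rewrite -real_normK ?num_real// expr_le1.
  apply: ler_sum => i _; apply: ler_sum => j _.
  apply: le_trans (ler_norm _) _; rewrite !normrM mulrAC.
  rewrite -[leRHS]mul1r ler_wpM2r// -[leRHS]mulr1 ler_pM//; exact: coord.
pose q : R := Num.sqrt d%:R.
have q2 : q ^+ 2 = d%:R by rewrite sqr_sqrtr// ltW.
have q0 : 0 < q by rewrite sqrtr_gt0.
(* Unit vectors are scaled by 4 sqrt d and rounded, with rounding errors of norm at most sqrt d. The
   form then equals 16 d times its value at u, v and is at most 8 d beta from the net points plus 4
   d K from each of the two errors. *)
have step K : 0 <= K -> C K -> C ((beta + K) / 2).
  move=> K0 CK u v u1 v1.
  pose y i := 4 * q * u i; pose z i := 4 * q * v i.
  have y16 : sqn y <= 16 * d%:R.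
    by rewrite sqnZ exprMn q2; have := ler_wpM2l (ltW d1) u1; lra.
  have z16 : sqn z <= 16 * d%:R.
    by rewrite sqnZ exprMn q2; have := ler_wpM2l (ltW d1) v1; lra.
  have [x [xn xd]] := net_approx y16.
  have [x' [xn' xd']] := net_approx z16.
  have E : bil N y z = 16 * d%:R * bil N u v by rewrite bilZ -q2; ring.
  have := bil_split N y z (zv x) (zv x'); rewrite E.
  have h1 := hN x x' xn xn'.
  have CK' (a b : R) (w w' : 'I_d -> R) : 0 < a -> 0 < b -> sqn w <= a ^+ 2 -> sqn w' <= b ^+ 2 ->
      bil N w w' <= a * b * K.
    move=> a0 bb0 wa wb.
    have : bil N (fun i => a^-1 * w i) (fun i => b^-1 * w' i) <= K.
      by apply: CK; rewrite sqnZ exprVn mulrC ler_pdivrMr ?mul1r// exprn_gt0.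
    rewrite bilZ -invfM mulrC ler_pdivrMr ?mulr_gt0//; lra.
  have h2 : bil N (fun i => y i - zv x i) z <= q * (4 * q) * K.
    by apply: CK' => //; rewrite ?exprMn ?q2//; [rewrite mulr_gt0| lra].
  have h3 : bil N (zv x) (fun i => z i - zv x' i) <= 4 * q * q * K.
    case/andP: xn => _ xs.
    by apply: CK' => //; rewrite ?exprMn ?q2//; [rewrite mulr_gt0| lra].
  have e1 : q * (4 * q) * K = 4 * d%:R * K by rewrite -q2; ring.
  have e2 : 4 * q * q * K = 4 * d%:R * K by rewrite -q2; ring.
  rewrite e1 in h2; rewrite e2 in h3 => eq.
  have d16 : 0 < 16 * d%:R :> R by rewrite mulr_gt0.
  rewrite -(ler_pM2l d16); lra.
have Cm (m : nat) : C (beta + D / 2 ^+ m).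
  elim: m => [|m IH]; first by rewrite expr0 divr1.
  have := step _ _ IH; rewrite (_ : (beta + (beta + D / 2 ^+ m)) / 2 = beta + D / 2 ^+ m.+1).
    by apply; rewrite addr_ge0// divr_ge0// exprn_ge0.
  by rewrite exprS invfM; field; rewrite expf_neq0.
move=> u v u1 v1; apply/ler_addgt0Pr => e e0.
have [m me] : exists m : nat, D / e < m%:R.
  by exists (Num.bound (D / e)); apply: archi_boundP; rewrite divr_ge0// ltW.
apply: (le_trans (Cm m _ _ u1 v1)); rewrite lerD2l ler_pdivrMr ?exprn_gt0//.
rewrite ltr_pdivrMr// in me; apply: (le_trans (ltW me)); rewrite mulrC ler_wpM2l// ?ltW//.
by rewrite -natrX ltr_nat ltn_expl.
Qed.

(** With w the image of v under the transpose of N, [bil N v w] is |w|^2, and the bound is applied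
    to v and w normalised; the cases v = 0 and w = 0 are separate because normalisation fails
    there. *)
Lemma opnorm_sq N (beta : R) : 0 <= beta ->
  (forall u v, sqn u <= 1 -> sqn v <= 1 -> bil N u v <= beta) ->
  forall v, sqn (fun j => \sum_i N i j * v i) <= beta ^+ 2 * sqn v.
Proof.
move=> b0 hN v; set w := fun j => _.
have E : bil N v w = sqn w.
  rewrite /bil exchange_big/=; apply: eq_bigr => j _.
  by rewrite -mulr_suml expr2; congr (_ * _); apply: eq_bigr => i _; rewrite mulrC.
have sc (x : 'I_d -> R) (s : R) : 0 < s -> sqn x = s ^+ 2 -> sqn (fun i => s^-1 * x i) <= 1.
  by move=> s0 xs; rewrite sqnZ xs exprVn mulVf// expf_neq0// gt_eqF.
have := sqn_ge0 v; rewrite le_eqVlt => /predU1P[v0|v0].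
  have vi i : v i = 0.
    move/esym/eqP: v0; rewrite /sqn psumr_eq0 => [/allP/(_ i)|*]; last exact: sqr_ge0.
    by rewrite mem_index_enum sqrf_eq0 => /(_ isT)/eqP.
  by rewrite -v0 mulr0 /sqn big1// => j _; rewrite /w big1 ?expr0n// => i _; rewrite vi mulr0.
have := sqn_ge0 w; rewrite le_eqVlt => /predU1P[w0|w0].
  by rewrite -w0 mulr_ge0// ?sqr_ge0// ltW.
pose s := Num.sqrt (sqn v); pose t := Num.sqrt (sqn w).
have s0 : 0 < s by rewrite sqrtr_gt0.
have t0 : 0 < t by rewrite sqrtr_gt0.
have s2 : sqn v = s ^+ 2 by rewrite sqr_sqrtr// ltW.
have t2 : sqn w = t ^+ 2 by rewrite sqr_sqrtr// ltW.
have := hN _ _ (sc _ _ s0 s2) (sc _ _ t0 t2).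
rewrite bilZ E t2 s2 -exprMn => h.
rewrite ler_sqr ?nnegrE; [|exact: ltW|by rewrite mulr_ge0// ltW].
move: h; rewrite (_ : s^-1 * t^-1 * t ^+ 2 = t / s); last by field; rewrite !gt_eqF.
by rewrite ler_pdivrMr.
Qed.

(** The inverse of 1 + N is 1 - N. Both factors enlarge norms at most by 3 when |N| <= 2, so the
    spectrum of the product lies in [1/9, 9], inside [0.09, 10]. The squared form of the triangle
    inequality in [key] is (x + w)^2 <= 3 x^2 + (3/2) w^2. *)
Lemma loewner_one_plus N : N *m N = 0 ->
  (forall v : 'I_d -> R, sqn (fun j => \sum_i N i j * v i) <= 4 * sqn v) ->
  @Wset R d ((1%:M + N) *m (1%:M + N)^T).
Proof.
move=> NN hN; split; first by rewrite trmx_mul trmxK.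
move=> v.
have vv (x : 'cV[R]_d) : (x^T *m x) ord0 ord0 = sqn (fun i => x i ord0).
  by rewrite mxE; apply: eq_bigr => i _; rewrite mxE.
have key (x w : 'I_d -> R) : sqn w <= 4 * sqn x -> sqn (fun i => x i + w i) <= 9 * sqn x.
  move=> h; apply: (@le_trans _ _ (3 * sqn x + 3 / 2 * sqn w)); last by lra.
  rewrite /sqn !mulr_sumr -big_split/=; apply: ler_sum => i _.
  by have := sqr_ge0 (2 * x i - w i); nra.
pose z := (1%:M + N)^T *m v.
have -> : (v^T *m ((1%:M + N) *m (1%:M + N)^T) *m v) ord0 ord0 = sqn (fun i => z i ord0).
  by rewrite -vv /z trmx_mul trmxK !mulmxA.
have zE i : z i ord0 = v i ord0 + \sum_k N k i * v k ord0.
  rewrite /z linearD/= trmx1 mulmxDl mul1mx !mxE; congr (_ + _).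
  by apply: eq_bigr => k _; rewrite mxE.
have vE i : v i ord0 = z i ord0 + - \sum_k N k i * z k ord0.
  have -> : v = z - N^T *m z.
    rewrite /z mulmxA -mulmxBl linearD/= trmx1 mulmxDr mulmx1 -trmx_mul NN trmx0 addr0.
    by rewrite addrK mul1mx.
  rewrite mxE; congr (_ + _); rewrite mxE; congr (- _); rewrite mxE.
  by apply: eq_bigr => k _; rewrite mxE.
rewrite vv; split.
  have := key (fun i => z i ord0) (fun i => - \sum_k N k i * z k ord0).
  rewrite (_ : sqn (fun i => - _) = sqn (fun i => \sum_k N k i * z k ord0)); last first.
    by apply: eq_bigr => i _; rewrite sqrrN.
  move=> /(_ (hN _)).
  rewrite (_ : sqn (fun i => z i ord0 + _) = sqn (fun i => v i ord0)); last first.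
    by apply: eq_bigr => i _; rewrite -vE.
  have := sqn_ge0 (fun i => z i ord0); lra.
have := key (fun i => v i ord0) _ (hN (fun i => v i ord0)).
rewrite (_ : sqn (fun i => v i ord0 + _) = sqn (fun i => z i ord0)); last first.
  by apply: eq_bigr => i _; rewrite -zE.
have := sqn_ge0 (fun i => v i ord0); lra.
Qed.

(** Each net point has weight 16^d 2^(-l1) >= 1, because its l1 norm is at most 4 d. The weight is a
    product over coordinates, so the total factorises, and every coordinate contributes at most 16
    times a two-sided geometric sum bounded by 3. *)
Lemma net_count : \sum_(x : netpt | in_net x) 1 <= 48 ^+ d :> R.
Proof.
have h (K : nat) : \sum_(k < (K + K).+1) 2^-1 ^+ `|k%:Z - K%:Z|%N <= 3 :> R.
  have h1 n : (n <= K)%N -> \sum_(k < n) 2^-1 ^+ `|k%:Z - K%:Z|%N <= 2^-1 ^+ (K - n) :> R.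
    elim: n => [|n IH] nK; first by rewrite big_ord0 exprn_ge0.
    rewrite big_ord_recr/= -abszN opprB subzn; last exact: ltnW.
    have := IH (ltnW nK); rewrite absz_nat (_ : (K - n = (K - n.+1).+1)%N); last by rewrite subnS prednK// subn_gt0.
    by rewrite exprS; lra.
  have h2 m : \sum_(k < K + m) 2^-1 ^+ `|k%:Z - K%:Z|%N <= 3 - 2 * 2^-1 ^+ m :> R.
    elim: m => [|m IH]; first by rewrite addn0; have := h1 K (leqnn K); rewrite subnn expr0; lra.
    rewrite addnS big_ord_recr/= subzn ?leq_addr// absz_nat addKn exprS; lra.
  rewrite -addnS; apply: le_trans (h2 _) _.
  by rewrite lerBlDr lerDl mulr_ge0// exprn_ge0.
apply: (@le_trans _ _ (\sum_(x : netpt) \prod_(i < d) (16 * 2^-1 ^+ `|(x i)%:Z - (4 * d)%:Z|%N))).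
  rewrite [leLHS]big_mkcond/=; apply: ler_sum => x _; case: ifPn => [/andP[xl _]|_]; last first.
    by apply: prodr_ge0 => i _; rewrite mulr_ge0// exprn_ge0.
  rewrite big_split/= prodr_const card_ord -expr_sum.
  have e4 : (\sum_(i < d) `|(x i)%:Z - (4 * d)%:Z|%N <= 4 * d)%N.
    rewrite -(ler_nat R) natrM natr_sum; apply: le_trans xl; apply: ler_sum => i _.
    by rewrite natr_absz intr_norm rmorphB.
  have -> : 16 = 2 ^+ 4 :> R by rewrite -natrX.
  rewrite -exprM exprVn ler_pdivlMr ?exprn_gt0// mul1r ler_eXn2l//.
  by rewrite ltr1n.
rewrite -(bigA_distr_bigA (fun (i : 'I_d) (k : 'I_(4 * d + 4 * d).+1) => 16 * 2^-1 ^+ `|k%:Z - (4 * d)%:Z|%N)).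
rewrite prodr_const card_ord lerXn2r ?nnegrE//.
  by apply: sumr_ge0 => i _; rewrite mulr_ge0// exprn_ge0.
by rewrite -mulr_sumr; have := h (4 * d)%N; lra.
Qed.

End net.

(** * The high-dimensional prior *)

Section prior.
Context (R : realType) (d : nat).
Local Notation gam := (@normal_prob R 0 1).
Local Notation gG := (gmx R d d).

Definition msk (c : 'I_d * 'I_d) : bool := (d./2 <= c.1)%N && (c.2 < d./2)%N.

Definition Nmx (eta : R) (G : 'M[R]_d) : 'M[R]_d :=
  \matrix_(i, j) (if msk (i, j) then eta * G i j else 0).

Lemma Nmx_sq eta G : Nmx eta G *m Nmx eta G = 0.
Proof.
apply/matrixP => i j; rewrite !mxE big1// => k _; rewrite !mxE /msk /=.
case: (leqP d./2 k) => /= hk; last by rewrite mulr0.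
by rewrite andbF mul0r.
Qed.

(** In N + N^T + N N^T, the second term lives in the upper right block and the third in the lower
    right one. *)
Lemma Nmx_cov eta G i j : msk (i, j) ->
  ((1%:M + Nmx eta G) *m (1%:M + Nmx eta G)^T) i j = eta * G i j.
Proof.
move=> /[dup] mij /andP[/= hi hj].
rewrite linearD/= trmx1 mulmxDl mul1mx mulmxDr mulmx1.
have nij : i == j = false by apply/eqP => e; move: hi; rewrite e leqNgt hj.
have nji : msk (j, i) = false by rewrite /msk/= leqNgt hj.
rewrite !mxE nij mij nji mulr0n add0r add0r big1 ?addr0// => k _.
by rewrite !mxE /msk /= [(_ <= j)%N]leqNgt hj /= mulr0.
Qed.

Definition pm : R := \sum_(c : 'I_d * 'I_d | msk c) 1.

Lemma pmE : pm = ((d - d./2) * d./2)%:R.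
Proof.
rewrite /pm sumr_const; congr (_%:R).
rewrite (eq_card (B := [predX [pred i : 'I_d | (d./2 <= i)%N] & [pred j : 'I_d | (j < d./2)%N]])) //.
have h : #|[pred j : 'I_d | (j < d./2)%N]| = d./2.
  rewrite -sum1_card (eq_bigl (fun j : 'I_d => (j < d./2)%N))//.
  rewrite -(big_mkord (fun j => (j < d./2)%N) (fun=> 1%N)).
  rewrite -[RHS]muln1 -[X in _ = (X * _)%N]subn0 -sum_nat_const_nat; apply/esym.
  rewrite (big_nat_widen 0 _ d)//=; last by rewrite leq_half_double -addnn leqW// leq_addr.
rewrite cardX h; congr (_ * _)%N.
have hc := cardC [pred j : 'I_d | (j < d./2)%N]; rewrite h card_ord in hc.
by rewrite -[X in _ = (X - _)%N]hc addKn; apply: eq_card => i; rewrite !inE /= leqNgt.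
Qed.

(** The event is stated through finitely many linear inequalities in G, which makes it measurable
    and open to a union bound. The threshold 16 d is the one of [net_opnorm] for beta = 2. *)
Definition good (eta : R) (G : 'M[R]_d) : bool :=
  [forall x : netpt d, forall x' : netpt d, in_net R x ==> in_net R x' ==>
    (bil (Nmx eta G) (zv R x) (zv R x') <= 16 * d%:R)].

Lemma good_opnorm eta G : good eta G -> @Wset R d ((1%:M + Nmx eta G) *m (1%:M + Nmx eta G)^T).
Proof.
move=> gG; apply: loewner_one_plus; first exact: Nmx_sq.
move=> v; have -> : 4 = 2 ^+ 2 :> R by rewrite -natrX.
apply: opnorm_sq => //; apply: net_opnorm => // x x' hx hx'.
move/forallP: gG => /(_ x)/forallP/(_ x'); rewrite hx hx' /= => h.
by apply: le_trans h _; lra.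
Qed.

Definition acoef (eta : R) (x x' : netpt d) (c : 'I_d * 'I_d) : R :=
  if msk c then eta * (zv R x c.1 * zv R x' c.2) else 0.

Lemma bil_acoef eta G x x' :
  bil (Nmx eta G) (zv R x) (zv R x') = \sum_c acoef eta x x' c * G c.1 c.2.
Proof.
rewrite /bil pair_bigA/=; apply: eq_bigr => -[i j] _ /=; rewrite mxE /acoef.
by case: ifP => _ /=; ring.
Qed.

Lemma measurable_bil eta x x' :
  measurable_fun setT (fun G : MX R d d => bil (Nmx eta G) (zv R x) (zv R x')).
Proof.
under eq_fun do rewrite bil_acoef.
apply: measurable_sum => c; apply: measurable_funM => //; exact: measurable_coord.
Qed.

Lemma measurable_good eta : measurable [set G : MX R d d | good eta G].
Proof.
rewrite [X in measurable X](_ : _ = \bigcap_(p in [set p : netpt d * netpt d | in_net R p.1 && in_net R p.2])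
  ((fun G : MX R d d => bil (Nmx eta G) (zv R p.1) (zv R p.2)) @^-1` `]-oo, 16 * d%:R])).
  apply: fin_bigcap_measurable => [|[x x'] _ /=].
    by apply: (@sub_finite_set _ _ setT) => //; exact: finite_finset.
  by rewrite -[X in measurable X]setTI; exact: measurable_bil.
apply/seteqP; split => G /=.
  move=> /forallP h [x x'] /= /andP[hx hx']; rewrite in_itv/=.
  by move: (h x) => /forallP/(_ x'); rewrite hx hx'.
move=> h; apply/forallP => x; apply/forallP => x'; apply/implyP => hx; apply/implyP => hx'.
by have := h (x, x'); rewrite /= hx hx' in_itv/=; apply.
Qed.

Lemma measurable_bad eta : measurable_fun setT (fun G : MX R d d => (~~ good eta G)%:R : R).
Proof.
rewrite (_ : (fun _ => _) = \1_(~` [set G : MX R d d | good eta G])).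
  by apply: measurable_indic; apply: measurableC; exact: measurable_good.
by apply/funext => G; rewrite indicE in_setC mem_setE.
Qed.

Lemma mgf_bil eta lam x x' :
  (\int[gG]_G (expR (lam * bil (Nmx eta G) (zv R x) (zv R x')))%:E =
   (expR (lam ^+ 2 / 2 * \sum_c acoef eta x x' c ^+ 2))%:E)%E.
Proof.
transitivity (\int[gG]_G (\prod_(c <- index_enum ('I_d * 'I_d)%type) expR (lam * acoef eta x x' c * fun_of_matrix G c.1 c.2))%:E)%E.
  apply: eq_integral => G _; congr EFin; rewrite -expR_sum bil_acoef mulr_sumr.
  by congr expR; apply: eq_bigr => c _; rewrite mulrA.
rewrite (@gmx_prod R d d _ (fun c t => expR (lam * acoef eta x x' c * t))); first last.
- by move=> c t; exact: expR_ge0.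
- by move=> c; apply: measurableT_comp => //; exact: measurable_funM.
- exact: index_enum_uniq.
under eq_bigr do rewrite gauss_mgf.
rewrite prodEFin -expR_sum; congr (expR _)%:E.
by rewrite mulr_sumr; apply: eq_bigr => c _; rewrite exprMn; ring.
Qed.

Lemma acoef_sq eta x x' : in_net R x -> in_net R x' ->
  \sum_c acoef eta x x' c ^+ 2 <= eta ^+ 2 * (16 * d%:R) ^+ 2.
Proof.
move=> /andP[_ hx] /andP[_ hx'].
apply: (@le_trans _ _ (eta ^+ 2 * (sqn (zv R x) * sqn (zv R x')))); last first.
  by rewrite ler_wpM2l ?sqr_ge0// expr2 ler_pM// sqn_ge0.
rewrite /sqn mulr_suml mulr_sumr.
under [leRHS]eq_bigr do rewrite !mulr_sumr.
rewrite pair_bigA/=; apply: ler_sum => -[i j] _; rewrite /acoef /=.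
case: ifP => _; first by rewrite !exprMn.
by rewrite expr0n/=; apply: mulr_ge0; [exact: sqr_ge0|apply: mulr_ge0; exact: sqr_ge0].
Qed.

(** Chernoff bound for each pair of net points, then a union bound over at most 48^(2 d) pairs. *)
Lemma bad_prob eta : 0 <= eta -> eta ^+ 2 * (20 * d%:R) <= 1 ->
  \int[gG]_G (~~ good eta G)%:R <= 2^-1 ^+ d.
Proof.
move=> eta0 etad.
(* The linear form has variance at most 256 d^2 eta^2 <= 12.8 d, so the exponent is at most lam^2 /
   2 times 12.8 d minus 16 lam d, that is 10 d - 20 d; [lam] = 5/4 is near the minimiser of this
   quadratic. *)
pose lam : R := 5 / 4.
pose E x x' (G : MX R d d) := expR (- 20 * d%:R) * expR (lam * bil (Nmx eta G) (zv R x) (zv R x')).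
have iE x x' : rintegrable gG (fun G => expR (lam * bil (Nmx eta G) (zv R x) (zv R x'))).
  apply: (@ge0_rintegrable _ _ _ _ _ (expR (lam ^+ 2 / 2 * \sum_c acoef eta x x' c ^+ 2))).
  - apply: measurableT_comp => //; apply: measurable_funM => //; exact: measurable_bil.
  - by move=> G; exact: expR_ge0.
  - by rewrite mgf_bil.
have iE' x x' : rintegrable gG (E x x') by exact: rintegrableZ.
have Ele x x' : in_net R x -> in_net R x' -> \int[gG]_G E x x' G <= expR (- 10 * d%:R).
  move=> hx hx'; rewrite Rint_Z// /Rintegral mgf_bil/= -expRD ler_expR.
  have := acoef_sq eta hx hx'.
  have := ler_wpM2r (ler0n R d) etad; rewrite /lam; lra.
apply: (@le_trans _ _ (\int[gG]_G (\sum_(x | in_net R x) \sum_(x' | in_net R x') E x x' G))).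
  apply: Rintegral_le.
  - apply: (@rintegrable_bounded _ _ _ _ _ 1); last by move=> G; case: good; rewrite ?normr0 ?normr1.
    exact: measurable_bad.
  - by apply: rintegrable_sum => x _; apply: rintegrable_sum => x' _.
  move=> G; have E0 x x' : 0 <= E x x' G by rewrite mulr_ge0// expR_ge0.
  case gGG: (good eta G) => /=.
    by apply: sumr_ge0 => x _; apply: sumr_ge0.
  move/negbT: gGG => /forallPn[x /forallPn[x']]; rewrite !negb_imply -ltNge => /and3P[hx hx' hb].
  rewrite (bigD1 x)//= (bigD1 x')//= -[leLHS]addr0 -addrA; apply: lerD.
    rewrite /E -expRD -[leLHS]expR0 ler_expR /lam; lra.
  by rewrite addr_ge0//; [apply: sumr_ge0|apply: sumr_ge0 => y _; apply: sumr_ge0].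
rewrite Rintegral_sum; last by move=> x _; apply: rintegrable_sum.
apply: (@le_trans _ _ (\sum_(x | in_net R x) \sum_(x' | in_net R x') expR (- 10 * d%:R))).
  apply: ler_sum => x hx; rewrite Rintegral_sum//; apply: ler_sum => x' hx'; exact: Ele.
have -> : \sum_(x : netpt d | in_net R x) \sum_(x' : netpt d | in_net R x') expR (- 10 * d%:R) =
    (\sum_(x : netpt d | in_net R x) 1) * (\sum_(x : netpt d | in_net R x) 1) * expR (- 10 * d%:R) :> R.
  rewrite -mulrA mulr_suml; apply: eq_bigr => x _; rewrite mul1r mulr_suml.
  by apply: eq_bigr => x' _; rewrite mul1r.
have c0 : 0 <= \sum_(x : netpt d | in_net R x) 1 :> R by apply: sumr_ge0.
apply: (@le_trans _ _ (48 ^+ d * 48 ^+ d * expR (- 10 * d%:R))).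
  by rewrite ler_wpM2r ?expR_ge0// ler_pM// net_count.
rewrite expRM_natr -!exprMn lerXn2r ?nnegrE ?mulr_ge0 ?expR_ge0//.
(* What remains is 48^2 exp(-10) <= 1/2, that is exp(10) >= 4608; this follows from (5/4)^40 >=
   3^8. *)
have : (5 / 4) ^+ 40 <= expR 10 :> R.
  have -> : 10 = 1 / 4 * 40%:R :> R by lra.
  by rewrite expRM_natr lerXn2r ?nnegrE ?expR_ge0//; have := expR_ge1Dx (1 / 4 : R); lra.
have : expR 10 * expR (- 10) = 1 :> R by rewrite -expRD subrr expR0.
have := expR_ge0 (- 10 : R).
have : 4608 <= (5 / 4) ^+ 40 :> R.
  apply: (@le_trans _ _ (3 ^+ 8)); first by rewrite -natrX ler_nat.
  by rewrite (exprM _ 5 8) lerXn2r ?nnegrE//; lra.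
set a := expR 10; set b := expR _; set q := (5 / 4) ^+ 40; nra.
Qed.

Definition Tdev (G : 'M[R]_d) : R := \sum_(c | msk c) (G c.1 c.2 ^+ 2 - 1).

Lemma gauss_dev : rintegrable gam (fun t => t ^+ 2 - 1) /\ \int[gam]_t (t ^+ 2 - 1) = 0.
Proof.
have [i2 e2] := gauss_int2 R.
split; first by apply: rintegrableB => //; exact: rintegrable_cst.
by rewrite (Rint_B i2 (rintegrable_cst _ 1)) e2 Rintegral_cst1 subrr.
Qed.

Lemma gauss_dev2 : rintegrable gam (fun t => (t ^+ 2 - 1) ^+ 2) /\
  \int[gam]_t ((t ^+ 2 - 1) ^+ 2) <= 999.
Proof.
have [i2 e2] := gauss_int2 R; have [i4 e4] := gauss_int4 R.
have E : (fun t : R => (t ^+ 2 - 1) ^+ 2) =1 (fun t => (t ^+ 4 - 2 * t ^+ 2) + 1).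
  by move=> t; ring.
have i3 := rintegrableZ 2 i2.
have i5 := rintegrableB i4 i3.
split; first by apply: rintegrable_ext (rintegrableD i5 (rintegrable_cst _ 1)) => t; rewrite E.
under eq_Rintegral do rewrite E.
rewrite (Rint_D i5 (rintegrable_cst _ 1)) (Rint_B i4 i3) (Rint_Z 2 i2) e2 Rintegral_cst1; lra.
Qed.

(** The summands are centered and independent, so only the diagonal of the double sum survives. *)
Lemma Tdev_sq : rintegrable gG (fun G => Tdev G ^+ 2) /\ \int[gG]_G (Tdev G ^+ 2) <= 999 * pm.
Proof.
have [i1 e1] := gauss_dev; have [i2 e2] := gauss_dev2.
pose D c (G : MX R d d) : R := fun_of_matrix G c.1 c.2 ^+ 2 - 1.
have iD c : rintegrable gG (D c) by case: (gmx_coord c i1).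
have DD c c' : rintegrable gG (fun G => D c G * D c' G) /\
   (\int[gG]_G (D c G * D c' G) <= if c == c' then 999 else 0).
  case: (eqVneq c c') => [<-|cc].
    have [j1 j2] := gmx_coord c i2; split; last by rewrite (le_trans _ e2)// -j2 le_eqVlt; apply/orP; left; apply/eqP; apply: eq_Rintegral => G _; rewrite -expr2.
    by apply: rintegrable_ext j1 => G; rewrite -expr2.
  have hD w t : D c' (updm w c t) = D c' w.
    by rewrite /D updm_neq// -surjective_pairing eq_sym.
  have [j1 j2] := gmx_indep i1 (iD c') hD.
  by split => //; rewrite j2 e1 mul0r.
have E : (fun G : MX R d d => Tdev G ^+ 2) =1 (fun G => \sum_(c | msk c) \sum_(c' | msk c') D c G * D c' G).
  by move=> G; rewrite expr2 /Tdev mulr_suml; apply: eq_bigr => c _; rewrite mulr_sumr.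
have ii c : rintegrable gG (fun G => \sum_(c' | msk c') D c G * D c' G).
  by apply: rintegrable_sum => c' _; case: (DD c c').
split; first by apply: rintegrable_ext (fun G => esym (E G)) _; apply: rintegrable_sum.
under eq_Rintegral do rewrite E.
rewrite Rintegral_sum// /pm mulr_sumr; apply: ler_sum => c mc.
rewrite Rintegral_sum; last by move=> c' _; case: (DD c c').
rewrite mulr1 (bigD1 c)//= -[leRHS]addr0; apply: lerD.
  by case: (DD c c) => _; rewrite eqxx.
by apply: sumr_le0 => c' /andP[_ cc]; case: (DD c c') => _; rewrite eq_sym (negbTE cc).
Qed.

(** From |T| <= T^2 / (2 d) + d / 2. The weight is chosen because the variance is of order d^2,
    which makes both terms of order d, negligible against the block size. *)
Lemma Tdev_abs : (0 < d)%N -> rintegrable gG (fun G => `|Tdev G|) /\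
  \int[gG]_G `|Tdev G| <= 999 * pm / (2 * d%:R) + d%:R / 2.
Proof.
move=> d0; have [i e] := Tdev_sq.
have d1 : 0 < d%:R :> R by rewrite ltr0n.
have mT : measurable_fun setT (fun G : MX R d d => Tdev G).
  have [i1 _] := gauss_dev.
  apply: (@rintegrable_mfun _ _ _ gG); apply: rintegrable_sum => c _.
  by case: (gmx_coord c i1).
have hb (G : MX R d d) : `|Tdev G| <= (2 * d%:R)^-1 * Tdev G ^+ 2 + d%:R / 2.
  rewrite -[Tdev G ^+ 2]real_normK ?num_real//.
  have := sqr_ge0 (`|Tdev G| - d%:R); set t := `|Tdev G| => h.
  rewrite -subr_ge0 (_ : _ - _ = (2 * d%:R)^-1 * (t - d%:R) ^+ 2); last by field; rewrite gt_eqF.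
  by rewrite mulr_ge0// invr_ge0 mulr_ge0// ltW.
have i2 := rintegrableD (rintegrableZ (2 * d%:R)^-1 i) (rintegrable_cst gG (d%:R / 2)).
have ia : rintegrable gG (fun G => `|Tdev G|).
  by apply: le_rintegrable i2; [exact: measurableT_comp|move=> G; rewrite normr_id].
split => //; apply: (le_trans (Rintegral_le ia i2 hb)).
rewrite (Rint_D (rintegrableZ _ i) (rintegrable_cst _ _)) (Rint_Z _ i) Rintegral_cst1 lerD2r.
rewrite mulrC ler_wpM2r// invr_ge0 mulr_ge0// ltW//.
Qed.

End prior.

(** * Integration by parts *)

Section parametric.
Context d1 d2 (T1 : measurableType d1) (T2 : measurableType d2) (R : realType).
Context (P2 : probability T2 R).

Lemma measurable_Rint2 (f : T1 * T2 -> R) : measurable_fun setT f ->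
  (forall x, rintegrable P2 (fun y => f (x, y))) ->
  measurable_fun setT (fun x => \int[P2]_y f (x, y)).
Proof.
move=> mf fi.
have mabs : measurable_fun setT (fun p => `|f p|) by exact: measurableT_comp.
have gen (g : T1 * T2 -> R) : measurable_fun setT g -> (forall p, 0 <= g p) ->
    measurable_fun setT (fun x => \int[P2]_y g (x, y)).
  move=> mg g0; apply: measurableT_comp => //.
  apply: (@measurable_tonelli1 _ _ _ _ _ P2 (fun p => (g p)%:E)).
    exact/measurable_EFinP.
  by move=> p; rewrite lee_fin.
rewrite (_ : (fun _ => _) = (fun x => \int[P2]_y (`|f (x, y)| + f (x, y)) - \int[P2]_y `|f (x, y)|)).
  apply: measurable_funB; last by apply: (gen (fun p => `|f p|)).
  apply: (gen (fun p => `|f p| + f p)) => [|p]; first exact: measurable_funD.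
  by have := ler_norm (- f p); rewrite normrN; lra.
by apply/funext => x; rewrite (Rint_D (rintegrable_abs (fi x)) (fi x)) addrAC subrr add0r.
Qed.

End parametric.

Section stein.
Context (R : realType) (d n : nat) (eta : R).
Local Notation gam := (@normal_prob R 0 1).
Local Notation gG := (gmx R d d).
Local Notation gZ := (gmx R d n).
Local Notation I := ('I_d * 'I_n)%type.

Definition nz (G : 'M[R]_d) (Z : 'M[R]_(d, n)) b i : R := \sum_k Nmx eta G b k * Z k i.

Definition Xof (G : 'M[R]_d) (Z : 'M[R]_(d, n)) : 'M[R]_(d, n) := (1%:M + Nmx eta G) *m Z.

Lemma XofE G Z b i : Xof G Z b i = Z b i + nz G Z b i.
Proof. by rewrite /Xof mulmxDl mul1mx !mxE. Qed.

Lemma measurable_prodG i j :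
  measurable_fun setT (fun p : MX R d d * MX R d n => fun_of_matrix p.1 i j).
Proof. by apply: measurable_mx_comp; exact: measurable_fst. Qed.

Lemma measurable_prodZ i j :
  measurable_fun setT (fun p : MX R d d * MX R d n => fun_of_matrix p.2 i j).
Proof. by apply: measurable_mx_comp; exact: measurable_snd. Qed.

Lemma measurable_nz b i : measurable_fun setT (fun p : MX R d d * MX R d n => nz p.1 p.2 b i).
Proof.
apply: measurable_sum => k; apply: measurable_funM; last exact: measurable_prodZ.
under eq_fun do rewrite mxE; case: (msk _); last exact: measurable_cst.
by apply: measurable_funM => //; exact: measurable_prodG.
Qed.

Lemma measurable_Xof : measurable_fun setT (fun p : MX R d d * MX R d n => (Xof p.1 p.2 : MX R d n)).
Proof.
apply: measurable_mxP => i j; under eq_fun do rewrite XofE.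
by apply: measurable_funD; [exact: measurable_prodZ|exact: measurable_nz].
Qed.

Lemma nz_low G Z (b : 'I_d) i : (b < d./2)%N -> nz G Z b i = 0.
Proof. by move=> h; rewrite /nz big1// => k _; rewrite mxE /msk /= leqNgt h /= mul0r. Qed.

Lemma nz_ext G (Z Z' : 'M[R]_(d, n)) b i : (forall k : 'I_d, (k < d./2)%N -> Z k i = Z' k i) -> nz G Z b i = nz G Z' b i.
Proof.
move=> h; apply: eq_bigr => k _; rewrite !mxE /msk /=.
case: (ltnP k d./2) => hk; first by rewrite h.
by rewrite andbF !mul0r.
Qed.

(* The log-density of the law of [Xof G Z] with respect to that of [Z]. *)
Definition Vexp (G : 'M[R]_d) (Z : 'M[R]_(d, n)) : R :=
  \sum_(c : I) (nz G Z c.1 c.2 * Z c.1 c.2 - nz G Z c.1 c.2 ^+ 2 / 2).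

Lemma measurable_Vexp : measurable_fun setT (fun p : MX R d d * MX R d n => Vexp p.1 p.2).
Proof.
apply: measurable_sum => c; apply: measurable_funB.
  by apply: measurable_funM; [exact: measurable_nz|exact: measurable_prodZ].
by apply: measurable_funM => //; apply: measurable_funX; exact: measurable_nz.
Qed.

(** The shift N Z moves only rows from d/2 on and depends only on the rows before, which is the
    triangular situation of [gmx_shift]. *)
Lemma cameron_martin (G : MX R d d) (F : MX R d n -> \bar R) :
  measurable_fun setT F -> (forall w, 0 <= F w)%E ->
  (\int[gZ]_Z F (Xof G Z) = \int[gZ]_Z (F Z * (expR (Vexp G Z))%:E))%E.
Proof.
move=> mF F0.
pose s (c : I) (Z : MX R d n) : R := nz G Z c.1 c.2.
pose L0 : pred I := [pred c : I | (d./2 <= c.1)%N].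
pose L := [seq c <- index_enum I | L0 c].
have ms c : measurable_fun setT (s c).
  exact: (measurableT_comp (measurable_nz c.1 c.2) (pair1_measurable G)).
have sext c (w w' : MX R d n) :
    (forall i j, (i, j) \notin L0 -> fun_of_matrix w i j = fun_of_matrix w' i j) -> s c w = s c w'.
  by move=> h; apply: nz_ext => k hk; apply: h; rewrite inE/= -ltnNge.
have LL : {subset L <= L0} by move=> c; rewrite mem_filter => /andP[].
have E := gmx_shift ms sext (filter_uniq _ (index_enum_uniq _)) LL mF F0.
transitivity (\int[gZ]_Z F (shiftm s L Z))%E.
  apply: eq_integral => Z _; congr F; apply/matrixP => b i; rewrite XofE mxE; congr (_ + _).
  rewrite mem_filter mem_index_enum andbT /=.
  by case: ifPn => //; rewrite -ltnNge => h; rewrite nz_low.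
rewrite E; apply: eq_integral => Z _; congr (_ * _%:E)%E.
rewrite -expR_sum; congr expR; rewrite big_filter big_mkcond/=.
apply: eq_bigr => c _; case: ifPn => //; rewrite -ltnNge => h.
by rewrite nz_low// mul0r expr0n/= mul0r subrr.
Qed.

Section coordinate.
Variables (a j : 'I_d).
Hypothesis aj : msk (a, j).

Lemma nz_updm (G : MX R d d) (Z : MX R d n) t b i :
  nz (updm G (a, j) t) Z b i = nz (updm G (a, j) 0) Z b i + (if b == a then eta * t * fun_of_matrix Z j i else 0).
Proof.
rewrite /nz (bigD1 j)//= [in RHS](bigD1 j)//= !mxE.
have E : \sum_(k < d | k != j) Nmx eta (updm G (a, j) t) b k * fun_of_matrix Z k i =
  \sum_(k < d | k != j) Nmx eta (updm G (a, j) 0) b k * fun_of_matrix Z k i.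
  apply: eq_bigr => k kj; rewrite !mxE !xpair_eqE (negbTE kj) andbF //.
rewrite E !xpair_eqE eqxx andbT; case: (eqVneq b a) => [->|ba].
  by rewrite aj; ring.
by case: ifP => _; ring.
Qed.

(* [score G X] is minus the logarithmic derivative in [G a j] of the joint density of [(G, X)]. *)
Definition score (G : 'M[R]_d) (Z : 'M[R]_(d, n)) : R :=
  G a j - eta * \sum_i Z j i * (Z a i - nz G Z a i).

(** The rows entering N X are not shifted, so N X = N Z and the residual X - N X is Z again. *)
Lemma score_Xof G Z : score G (Xof G Z) = G a j - eta * \sum_i Z j i * Z a i.
Proof.
have hj : (j < d./2)%N by case/andP: aj.
rewrite /score; congr (_ - eta * _); apply: eq_bigr => i _.
rewrite !XofE nz_low// addr0 (@nz_ext G (Xof G Z) Z).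
  by rewrite addrK.
by move=> k hk; rewrite XofE nz_low// addr0.
Qed.

(** As a function of t, the entry (a, j) of G, the shift is affine and affects row a alone. Hence
    [Vexp] is quadratic in t with coefficients B and Q, the score is (1 + Q) t - B, and
    [gauss_tilt_centered] applies. *)
Lemma tilt_coord (G : MX R d d) (Z : MX R d n) (K : R) :
  rintegrable gam (fun t => score (updm G (a, j) t) Z * K * expR (Vexp (updm G (a, j) t) Z)) /\
  \int[gam]_t (score (updm G (a, j) t) Z * K * expR (Vexp (updm G (a, j) t) Z)) = 0.
Proof.
pose G0 := updm G (a, j) 0.
pose B := \sum_i eta * fun_of_matrix Z j i * (fun_of_matrix Z a i - nz G0 Z a i).
pose Q := \sum_i (eta * fun_of_matrix Z j i) ^+ 2.
have Q0 : 0 <= Q by apply: sumr_ge0 => i _; exact: sqr_ge0.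
have E t : score (updm G (a, j) t) Z * K * expR (Vexp (updm G (a, j) t) Z) =
    (K * expR (Vexp G0 Z)) * (((1 + Q) * t - B) * expR (B * t - Q * t ^+ 2 / 2)).
  have -> : score (updm G (a, j) t) Z = (1 + Q) * t - B.
    rewrite /score (updm_id _ (a, j)).
    under eq_bigr => i _ do rewrite nz_updm eqxx.
    rewrite /Q /B mulr_sumr mulrDl mul1r -addrA; congr (_ + _).
    rewrite mulr_suml -sumrN -sumrB; apply: eq_bigr => i _; ring.
  have -> : Vexp (updm G (a, j) t) Z = Vexp G0 Z + (B * t - Q * t ^+ 2 / 2).
    have -> : B * t - Q * t ^+ 2 / 2 = \sum_(c : I) (if c.1 == a then
       eta * fun_of_matrix Z j c.2 * (fun_of_matrix Z a c.2 - nz G0 Z a c.2) * t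
        - (eta * fun_of_matrix Z j c.2) ^+ 2 * t ^+ 2 / 2 else 0).
      rewrite -(pair_bigA _ (fun (b : 'I_d) (i : 'I_n) => if b == a then
       eta * fun_of_matrix Z j i * (fun_of_matrix Z a i - nz G0 Z a i) * t
        - (eta * fun_of_matrix Z j i) ^+ 2 * t ^+ 2 / 2 else 0)) /=.
      rewrite (bigD1 a)//= eqxx [X in _ = _ + X]big1 ?addr0; last first.
        by move=> b ba; rewrite big1// => i _; rewrite (negbTE ba).
      by rewrite /B /Q !mulr_suml -sumrB.
    rewrite /Vexp -big_split/=; apply: eq_bigr => -[b i] _ /=.
    rewrite nz_updm; case: eqP => [->|_]; last by rewrite !addr0.
    by rewrite -/G0; field.
  by rewrite expRD; ring.
have [i1 e1] := gauss_tilt_centered B Q0.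
split.
  by apply: rintegrable_ext (rintegrableZ (K * expR (Vexp G0 Z)) i1) => t; rewrite E.
transitivity (\int[gam]_t ((K * expR (Vexp G0 Z)) * (((1 + Q) * t - B) * expR (B * t - Q * t ^+ 2 / 2)))).
  by apply: eq_Rintegral => t _; rewrite E.
by rewrite (Rint_Z _ i1) e1 mulr0.
Qed.

Definition ppos (x : R) : R := `|x| + x.
Definition pneg (x : R) : R := `|x| - x.

Lemma ppos_ge0 x : 0 <= ppos x.
Proof. by have := ler_norm (- x); rewrite normrN /ppos; lra. Qed.

Lemma pneg_ge0 x : 0 <= pneg x.
Proof. by rewrite subr_ge0 ler_norm. Qed.

Lemma ppos_mul x y : 0 <= y -> ppos (x * y) = ppos x * y.
Proof. by move=> y0; rewrite /ppos normrM (ger0_norm y0) mulrDl. Qed.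

Lemma pneg_mul x y : 0 <= y -> pneg (x * y) = pneg x * y.
Proof. by move=> y0; rewrite /pneg normrM (ger0_norm y0) mulrBl. Qed.

Lemma measurable_ppos : measurable_fun setT ppos.
Proof. by apply: measurable_funD => //; exact: normr_measurable. Qed.

Lemma measurable_pneg : measurable_fun setT pneg.
Proof. by apply: measurable_funB => //; exact: normr_measurable. Qed.

Variables (H : MX R d n -> R) (K : R).
Hypothesis mH : measurable_fun setT H.
Hypothesis HK : forall X, `|H X| <= K.

Lemma measurable_score : measurable_fun setT (fun p : MX R d d * MX R d n => score p.1 p.2).
Proof.
apply: measurable_funB; first exact: measurable_prodG.
apply: measurable_funM => //; apply: measurable_sum => i; apply: measurable_funM; first exact: measurable_prodZ.
by apply: measurable_funB; [exact: measurable_prodZ|exact: measurable_nz].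
Qed.

Definition sH (G : MX R d d) (Z : MX R d n) : R := score G (Xof G Z) * H (Xof G Z).

Lemma measurable_scoreH : measurable_fun setT (fun p : MX R d d * MX R d n => score p.1 p.2 * H p.2).
Proof.
apply: measurable_funM; first exact: measurable_score.
exact: (measurableT_comp mH (@measurable_snd _ _ _ _)).
Qed.

(** After the change of variables from Z to X, the data no longer depends on G, so H(X) is a
    constant when one entry of G is resampled and [tilt_coord] applies to an arbitrary bounded
    measurable H. The vanishing of the expectation is expressed as equality of the positive and
    negative sides, so that Tonelli's theorem is enough. *)
Lemma stein_pn :
  (\int[gG]_G \int[gZ]_Z (ppos (sH G Z))%:E = \int[gG]_G \int[gZ]_Z (pneg (sH G Z))%:E)%E.
Proof.
have gen (phi : R -> R) : measurable_fun setT phi -> (forall x, 0 <= phi x) ->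
    (forall x y, 0 <= y -> phi (x * y) = phi x * y) ->
    (\int[gG]_G \int[gZ]_Z (phi (sH G Z))%:E =
     \int[gZ]_Z \int[gG]_G \int[gam]_t (phi (score (updm G (a, j) t) Z * H Z * expR (Vexp (updm G (a, j) t) Z)))%:E)%E.
  move=> mphi phi0 phiM.
  pose f (p : MX R d d * MX R d n) := (phi (score p.1 p.2 * H p.2 * expR (Vexp p.1 p.2)))%:E.
  have mf : measurable_fun setT f.
    apply/measurable_EFinP; apply: (measurableT_comp mphi); apply: measurable_funM.
      exact: measurable_scoreH.
    by apply: measurableT_comp => //; exact: measurable_Vexp.
  have f0 p : (0 <= f p)%E by rewrite lee_fin.
  transitivity (\int[gG]_G \int[gZ]_Z f (G, Z))%E.
    apply: eq_integral => G _.
    rewrite [LHS](@cameron_martin G (fun X => (phi (score G X * H X))%:E)).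
    - by apply: eq_integral => Z _; rewrite -EFinM -phiM ?expR_ge0.
    - apply/measurable_EFinP; apply: (measurableT_comp mphi).
      exact: (measurableT_comp measurable_scoreH (pair1_measurable G)).
    - by move=> X; rewrite lee_fin.
  rewrite (tonelli gG gZ mf f0); apply: eq_integral => Z _.
  rewrite (gmx_resample (a, j) (f := fun G => f (G, Z)))//.
  exact: (measurableT_comp mf (pair2_measurable Z)).
rewrite (gen ppos measurable_ppos ppos_ge0 ppos_mul) (gen pneg measurable_pneg pneg_ge0 pneg_mul).
apply: eq_integral => Z _; apply: eq_integral => G _.
have [iw ew] := tilt_coord G Z (H Z).
have ia := rintegrable_abs iw.
rewrite (Rintegral_EFin (rintegrableD ia iw)) (Rintegral_EFin (rintegrableB ia iw)).
by rewrite (Rint_D ia iw) (Rint_B ia iw) ew subr0 addr0.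
Qed.


Definition Phi (G : MX R d d) : R := \int[gZ]_Z H (Xof G Z).
Definition Psi (G : MX R d d) : R :=
  \sum_(i < n) \int[gZ]_Z (fun_of_matrix Z j i * fun_of_matrix Z a i * H (Xof G Z)).

Lemma measurable_HX : measurable_fun setT (fun p : MX R d d * MX R d n => H (Xof p.1 p.2)).
Proof. exact: (measurableT_comp mH measurable_Xof). Qed.

Lemma a_neq_j : a != j.
Proof.
by apply/eqP => e; case/andP: aj => /=; rewrite e leqNgt => /negbTE ->.
Qed.

Lemma rintegrable_ZZ i : rintegrable gZ (fun Z => fun_of_matrix Z j i * fun_of_matrix Z a i).
Proof.
have [i1 _] := gauss_mean R.
have [j1 _] := gmx_coord (m := d) (n := n) (a, i) i1.
have hu (w : MX R d n) t : fun_of_matrix (updm w (j, i) t) a i = fun_of_matrix w a i.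
  by rewrite updm_neq// xpair_eqE (negbTE a_neq_j).
by have [] := @gmx_indep R d n (j, i) _ (fun Z => fun_of_matrix Z a i) i1 j1 hu.
Qed.

Lemma rintegrable_H (G : MX R d d) : rintegrable gZ (fun Z => H (Xof G Z)).
Proof.
apply: (@rintegrable_bounded _ _ _ _ _ K) => //.
exact: (measurableT_comp measurable_HX (pair1_measurable G)).
Qed.

Lemma rintegrable_ZZH (G : MX R d d) i : rintegrable gZ (fun Z => fun_of_matrix Z j i * fun_of_matrix Z a i * H (Xof G Z)).
Proof.
apply: le_rintegrable (rintegrableZ K (rintegrable_abs (rintegrable_ZZ i))).
  by apply: measurable_funM; [exact: rintegrable_mfun (rintegrable_ZZ i)|exact: rintegrable_mfun (rintegrable_H G)].
by move=> Z; rewrite normrM mulrC ler_wpM2r.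
Qed.

Lemma Phi_bound G : `|Phi G| <= K.
Proof.
apply: (le_trans (le_normr_Rintegral measurableT (rintegrable_H G))).
rewrite -[leRHS](Rintegral_cst1 gZ).
by apply: Rintegral_le => //; [exact: rintegrable_abs (rintegrable_H G)|exact: rintegrable_cst].
Qed.

Lemma measurable_Phi : measurable_fun setT Phi.
Proof. exact: (measurable_Rint2 measurable_HX rintegrable_H). Qed.

Lemma rintegrable_GPhi : rintegrable gG (fun G => fun_of_matrix G a j * Phi G).
Proof.
have [i1 _] := gauss_mean R.
have [j1 _] := gmx_coord (m := d) (n := d) (a, j) i1.
apply: le_rintegrable (rintegrableZ K (rintegrable_abs j1)).
  by apply: measurable_funM; [exact: measurable_coord|exact: measurable_Phi].
by move=> G; rewrite normrM mulrC ler_wpM2r// Phi_bound.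
Qed.

Lemma rintegrable_Psi : rintegrable gG Psi.
Proof.
apply: rintegrable_sum => i _.
apply: (@rintegrable_bounded _ _ _ _ _ (K * \int[gZ]_Z `|fun_of_matrix Z j i * fun_of_matrix Z a i|)).
  apply: (@measurable_Rint2 _ _ _ _ _ gZ (fun p : MX R d d * MX R d n => fun_of_matrix p.2 j i * fun_of_matrix p.2 a i * H (Xof p.1 p.2))).
    apply: measurable_funM; last exact: measurable_HX.
    by apply: measurable_funM; exact: measurable_prodZ.
  by move=> G; exact: rintegrable_ZZH.
move=> G; apply: (le_trans (le_normr_Rintegral measurableT (rintegrable_ZZH G i))).
rewrite -(Rint_Z K (rintegrable_abs (rintegrable_ZZ i))); apply: Rintegral_le.
- exact: rintegrable_abs (rintegrable_ZZH G i).
- exact: rintegrableZ (rintegrable_abs (rintegrable_ZZ i)).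
by move=> Z; rewrite normrM mulrC ler_wpM2r.
Qed.

Lemma rintegrable_sH G : rintegrable gZ (sH G) /\
  \int[gZ]_Z sH G Z = fun_of_matrix G a j * Phi G - eta * Psi G.
Proof.
have E : sH G =1 (fun Z => fun_of_matrix G a j * H (Xof G Z) -
   eta * \sum_i fun_of_matrix Z j i * fun_of_matrix Z a i * H (Xof G Z)).
  by move=> Z; rewrite /sH score_Xof mulrBl -mulrA mulr_suml.
have i1 := rintegrableZ (fun_of_matrix G a j) (rintegrable_H G).
have i2 : rintegrable gZ (fun Z => \sum_(i < n) fun_of_matrix Z j i * fun_of_matrix Z a i * H (Xof G Z)).
  by apply: rintegrable_sum => i _; exact: rintegrable_ZZH.
have i3 := rintegrableZ eta i2.
split; first by apply: rintegrable_ext (rintegrableB i1 i3) => Z; rewrite E.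
under eq_Rintegral do rewrite E.
rewrite (Rint_B i1 i3) (Rint_Z _ (rintegrable_H G)) (Rint_Z _ i2) Rintegral_sum// => i _.
exact: rintegrable_ZZH.
Qed.

(** The form of [stein_pn] for signed integrals: E(score H) = 0 with the score written in terms of Z
    by [score_Xof]. The domination of [A] by an affine function of |G a j| supplies the
    integrability that allows subtraction. *)
Lemma stein_id : \int[gG]_G (fun_of_matrix G a j * Phi G) = eta * \int[gG]_G Psi G.
Proof.
pose A G := \int[gZ]_Z `|sH G Z|.
have msH : measurable_fun setT (fun p : MX R d d * MX R d n => `|sH p.1 p.2|).
  apply: measurableT_comp => //; apply: measurable_funM; last exact: measurable_HX.
  under eq_fun do rewrite score_Xof.
  apply: measurable_funB; first exact: measurable_prodG.
  apply: measurable_funM => //; apply: measurable_sum => i.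
  by apply: measurable_funM; exact: measurable_prodZ.
have [i1 _] := gauss_mean R.
have [j1 _] := gmx_coord (m := d) (n := d) (a, j) i1.
pose C := \sum_(i < n) \int[gZ]_Z `|fun_of_matrix Z j i * fun_of_matrix Z a i|.
have iA : rintegrable gG A.
  have ib := rintegrableD (rintegrableZ K (rintegrable_abs j1)) (rintegrable_cst gG (K * (`|eta| * C))).
  apply: le_rintegrable ib.
    apply: (@measurable_Rint2 _ _ _ _ _ gZ (fun p : MX R d d * MX R d n => `|sH p.1 p.2|)) => //.
    by move=> G; have [/rintegrable_abs] := rintegrable_sH G.
  move=> G; have [isg _] := rintegrable_sH G; rewrite ger0_norm; last by apply: Rintegral_ge0.
  have is1 : rintegrable gZ (fun Z => \sum_(i < n) `|fun_of_matrix Z j i * fun_of_matrix Z a i|).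
    by apply: rintegrable_sum => i _; exact: rintegrable_abs (rintegrable_ZZ i).
  have is2 := rintegrableD (rintegrable_cst gZ (K * `|fun_of_matrix G a j|)) (rintegrableZ (K * `|eta|) is1).
  have -> : K * `|fun_of_matrix G a j| + K * (`|eta| * C) =
    \int[gZ]_Z (K * `|fun_of_matrix G a j| + K * `|eta| * \sum_(i < n) `|fun_of_matrix Z j i * fun_of_matrix Z a i|).
    rewrite (Rint_D (rintegrable_cst _ _) (rintegrableZ _ is1)) (Rint_Z _ is1) Rintegral_cst1 Rintegral_sum ?mulrA//.
    by move=> i _; exact: rintegrable_abs (rintegrable_ZZ i).
  apply: Rintegral_le => //; first exact: rintegrable_abs.
  move=> Z; rewrite /sH score_Xof normrM mulrC -mulrA -mulrDr.
  apply: ler_pM => //.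
  apply: (le_trans (ler_normB _ _)); rewrite lerD2l normrM ler_wpM2l//.
  exact: ler_norm_sum.
pose B G := \int[gZ]_Z sH G Z.
have iB : rintegrable gG B.
  apply: rintegrable_ext (rintegrableB rintegrable_GPhi (rintegrableZ eta rintegrable_Psi)) => G.
  by rewrite /B; have [_ ->] := rintegrable_sH G.
have := stein_pn.
have e1 : (\int[gG]_G \int[gZ]_Z (ppos (sH G Z))%:E = \int[gG]_G (A G + B G)%:E)%E.
  apply: eq_integral => G _; have [isg _] := rintegrable_sH G; have ia := rintegrable_abs isg.
  by rewrite (Rintegral_EFin (rintegrableD ia isg)) (Rint_D ia isg).
have e2 : (\int[gG]_G \int[gZ]_Z (pneg (sH G Z))%:E = \int[gG]_G (A G - B G)%:E)%E.
  apply: eq_integral => G _; have [isg _] := rintegrable_sH G; have ia := rintegrable_abs isg.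
  by rewrite (Rintegral_EFin (rintegrableB ia isg)) (Rint_B ia isg).
rewrite e1 e2 (Rintegral_EFin (rintegrableD iA iB)) (Rintegral_EFin (rintegrableB iA iB)).
rewrite (Rint_D iA iB) (Rint_B iA iB) => -[] hAB.
have B0 : \int[gG]_G B G = 0 by lra.
have : \int[gG]_G B G = \int[gG]_G (fun_of_matrix G a j * Phi G - eta * Psi G).
  by apply: eq_Rintegral => G _; rewrite /B; have [_ ->] := rintegrable_sH G.
rewrite B0 (Rint_B rintegrable_GPhi (rintegrableZ eta rintegrable_Psi)) (Rint_Z _ rintegrable_Psi); lra.
Qed.

End coordinate.
End stein.

(** * Privacy bound on the score *)

Section dp_column.
Context (R : realType) (d n : nat) (eps delta : R).
Variable M : R.-pker (MX R d n) ~> (MX R d d).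
Hypothesis dpM : dp eps delta M.
Hypothesis eps0 : 0 <= eps.
Hypothesis delta0 : 0 <= delta.

(** [neighbors] demands that the column really changes; when it does not, the two data sets coincide
    and the inequality holds because exp(eps) >= 1 and delta >= 0. *)
Lemma dp_col (i : 'I_n) (X X' : 'M[R]_(d, n)) :
  (forall k, k != i -> col k X = col k X') ->
  forall S : set (MX R d d), measurable S -> (M X S <= (expR eps)%:E * M X' S + delta%:E)%E.
Proof.
move=> h S mS; have [e|ne] := eqVneq (col i X) (col i X'); last first.
  by apply: dpM => //; exists i.
have -> : X' = X.
  apply/matrixP => k l; have [->|li] := eqVneq l i.
    by have /matrixP/(_ k ord0) := e; rewrite !mxE.
  by have /matrixP/(_ k ord0) := h l li; rewrite !mxE.
have : (M X S <= (expR eps)%:E * M X S)%E.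
  rewrite -{1}[M X S]mul1e lee_wpmul2r// lee_fin -expR0 ler_expR//.
by move=> /le_trans; apply; rewrite leeDl// lee_fin.
Qed.
End dp_column.

Section column_moments.
Context (R : realType) (d n : nat) (i : 'I_n).
Local Notation gZ := (gmx R d n).

(** Entries of a column are orthonormal, also in the presence of a factor that does not involve
    them. *)
Lemma pair_moment (b b' : 'I_d) (F : MX R d n -> R) : rintegrable gZ F ->
  (forall w t, F (updm w (b, i) t) = F w) -> (forall w t, F (updm w (b', i) t) = F w) ->
  rintegrable gZ (fun Z => fun_of_matrix Z b i * fun_of_matrix Z b' i * F Z) /\
  \int[gZ]_Z (fun_of_matrix Z b i * fun_of_matrix Z b' i * F Z) = (b == b')%:R * \int[gZ]_Z F Z.
Proof.
move=> iF Fb Fb'; have [i1 e1] := gauss_mean R; have [i2 e2] := gauss_int2 R.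
have [bb|bb] := eqVneq b b'.
  subst b'; have [j1 j2] := @gmx_indep R d n (b, i) _ F i2 iF Fb.
  split; first by apply: rintegrable_ext j1 => Z; rewrite expr2.
  rewrite e2 in j2; rewrite -j2; apply: eq_Rintegral => Z _; by rewrite expr2.
have [j1 j2] := @gmx_indep R d n (b', i) _ F i1 iF Fb'.
have hu (w : MX R d n) t : fun_of_matrix (updm w (b, i) t) b' i * F (updm w (b, i) t) = fun_of_matrix w b' i * F w.
  by rewrite Fb updm_neq// xpair_eqE eq_sym (negbTE bb).
have [k1 k2] := @gmx_indep R d n (b, i) _ (fun Z => fun_of_matrix Z b' i * F Z) i1 j1 hu.
split; first by apply: rintegrable_ext k1 => Z; rewrite mulrA.
rewrite mul0r -[RHS](mul0r (\int[gZ]_w (fun_of_matrix w b' i * F w))) -e1 -k2.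
by apply: eq_Rintegral => Z _; rewrite mulrA.
Qed.

Lemma col_sq : rintegrable gZ (fun Z => \sum_(k < d) fun_of_matrix Z k i ^+ 2) /\
  \int[gZ]_Z (\sum_(k < d) fun_of_matrix Z k i ^+ 2) = d%:R.
Proof.
have [i2 e2] := gauss_int2 R.
have h k := gmx_coord (m := d) (n := n) (k, i) i2.
split; first by apply: rintegrable_sum => k _; case: (h k).
rewrite Rintegral_sum; last by move=> k _; case: (h k).
under eq_bigr => k _.
  have [_ ->] := h k; rewrite e2; over.
by rewrite sumr_const card_ord.
Qed.
End column_moments.

Section score_bound.
Context (R : realType) (d n : nat) (eps delta eta : R).
Variable M : R.-pker (MX R d n) ~> (MX R d d).
Hypothesis dpM : dp eps delta M.
Hypothesis eps01 : 0 < eps < 1.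
Hypothesis delta0 : 0 <= delta.
Variables (h : 'I_d * 'I_d -> MX R d d -> R) (tau : R).
Hypothesis mh : forall e, measurable_fun setT (h e).
Hypothesis tau0 : 0 < tau.
Hypothesis h_tau : forall y, \sum_(e | msk e) h e y ^+ 2 <= tau ^+ 2.
Local Notation gZ := (gmx R d n).
Local Notation E2 := ('I_d * 'I_d)%type.

Lemma h_bound e y : msk e -> `|h e y| <= tau.
Proof.
move=> me; rewrite -ler_sqr ?nnegrE; [|by []|exact: ltW].
rewrite real_normK ?num_real//; apply: le_trans (h_tau y).
by rewrite (bigD1 e)//= lerDl sumr_ge0// => *; exact: sqr_ge0.
Qed.

Variables (G : MX R d d) (i : 'I_n).

Definition zcol (Z : MX R d n) : MX R d n := \matrix_(k, l) (if l == i then 0 else fun_of_matrix Z k l).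

Lemma measurable_zcol : measurable_fun setT zcol.
Proof.
apply: measurable_mxP => k l; under eq_fun do rewrite mxE.
by case: (l == i); [exact: measurable_cst|exact: measurable_coord].
Qed.

Lemma zcol_updm Z b t : zcol (updm Z (b, i) t) = zcol Z.
Proof.
apply/matrixP => k l; rewrite !mxE; case: (eqVneq l i) => //= li.
by rewrite xpair_eqE (negbTE li) andbF.
Qed.

Lemma Xof_zcol Z l : l != i -> col l (Xof eta G Z) = col l (Xof eta G (zcol Z)).
Proof.
move=> li; apply/matrixP => k m; rewrite !mxE; apply: eq_bigr => c _.
by rewrite [zcol _ _ _]mxE (negbTE li).
Qed.

Definition ke (Z : MX R d n) (e : E2) : R := fun_of_matrix Z e.2 i * fun_of_matrix Z e.1 i.

(** The sum over the block is the product of the squared norms of the lower and upper halves of the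
    column, bounded by the square of their mean. *)
Lemma ke_sq Z : \sum_(e | msk e) ke Z e ^+ 2 <= ((\sum_k fun_of_matrix Z k i ^+ 2) / 2) ^+ 2.
Proof.
pose U := \sum_(k < d | (d./2 <= k)%N) fun_of_matrix Z k i ^+ 2.
pose V := \sum_(k < d | (k < d./2)%N) fun_of_matrix Z k i ^+ 2.
have -> : \sum_(k < d) fun_of_matrix Z k i ^+ 2 = U + V.
  rewrite (bigID (fun k : 'I_d => (d./2 <= k)%N))/=; congr (_ + _).
  by apply: eq_bigl => k; rewrite ltnNge.
have -> : \sum_(e | msk e) ke Z e ^+ 2 = U * V.
  rewrite /U mulr_suml; under [RHS]eq_bigr do rewrite mulr_sumr.
  rewrite pair_big/=; apply: eq_big => [[a b]//|[a b] _ /=].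
  by rewrite /ke exprMn mulrC.
have := sqr_ge0 (U - V); rewrite expr_div_n; lra.
Qed.

(** Cauchy-Schwarz, as a weighted arithmetic-geometric mean with weights balanced between the bounds
    q and tau of the two vectors; q = 0 is treated apart because it is a denominator. *)
Lemma ke_h_bound Z y : `|\sum_(e | msk e) ke Z e * h e y| <= tau * ((\sum_k fun_of_matrix Z k i ^+ 2) / 2).
Proof.
set q := (\sum_k _) / 2; have q0 : 0 <= q by rewrite divr_ge0// sumr_ge0// => k _; exact: sqr_ge0.
have := ke_sq Z; rewrite -/q => hq; clearbody q.
move: q0; rewrite le_eqVlt => /predU1P[q0|q0].
  rewrite -q0 mulr0 big1 ?normr0// => e me.
  have : ke Z e ^+ 2 <= 0.
    move: hq; rewrite -q0 expr0n/=; apply: le_trans.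
    by rewrite (bigD1 e)//= lerDl sumr_ge0// => *; exact: sqr_ge0.
  by rewrite le_eqVlt ltNge sqr_ge0 orbF sqrf_eq0 => /eqP ->; rewrite mul0r.
apply: (le_trans (ler_norm_sum _ _ _)).
apply: (@le_trans _ _ (\sum_(e | msk e) (tau / (2 * q) * ke Z e ^+ 2 + q / (2 * tau) * h e y ^+ 2))).
  apply: ler_sum => e _; rewrite normrM -[ke Z e ^+ 2]real_normK ?num_real// -[h e y ^+ 2]real_normK ?num_real//.
  set x := `|ke Z e|; set z := `|h e y|.
  rewrite -subr_ge0 (_ : _ - _ = (tau * x - q * z) ^+ 2 / (2 * q * tau)).
    by apply: divr_ge0; [exact: sqr_ge0|apply: ltW; apply: mulr_gt0 => //; exact: mulr_gt0].
  by field; rewrite !gt_eqF.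
rewrite big_split/= -!mulr_sumr.
have a1 : tau / (2 * q) * \sum_(e | msk e) ke Z e ^+ 2 <= tau / (2 * q) * q ^+ 2.
  by rewrite ler_wpM2l// divr_ge0 ?mulr_ge0// ltW.
have a2 : q / (2 * tau) * \sum_(e | msk e) h e y ^+ 2 <= q / (2 * tau) * tau ^+ 2.
  by rewrite ler_wpM2l// divr_ge0 ?mulr_ge0// ltW.
apply: (le_trans (lerD a1 a2)); rewrite le_eqVlt; apply/orP; left; apply/eqP.
by field; rewrite !gt_eqF.
Qed.

Local Notation H e := (Kint M (h e)).
Local Notation HH e e' := (Kint M (fun y => h e y * h e' y)).

Lemma measurable_ke_h Z : measurable_fun setT (fun y => \sum_(e | msk e) ke Z e * h e y).
Proof.
under eq_fun do rewrite big_mkcond/=.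
apply: measurable_sum => e; case: (msk e); last exact: measurable_cst.
by apply: measurable_funM.
Qed.

Lemma rintegrable_h e X : msk e -> rintegrable (kmeas M X) (h e).
Proof. by move=> me; apply: (@rintegrable_bounded _ _ _ _ _ tau) => // y; exact: h_bound. Qed.

Lemma hh_bound e e' y : msk e -> msk e' -> `|h e y * h e' y| <= tau * tau.
Proof. by move=> me me'; rewrite normrM ler_pM// h_bound. Qed.

Lemma rintegrable_hh e e' X : msk e -> msk e' -> rintegrable (kmeas M X) (fun y => h e y * h e' y).
Proof.
move=> me me'; apply: (@rintegrable_bounded _ _ _ _ _ (tau * tau)).
  exact: measurable_funM.
by move=> y; exact: hh_bound.
Qed.

(** [dp_signed] for f = sum of [ke Z e * h e], between the data and the data with column i erased.
    The mean of |f| is replaced by that of f^2 / (2 tau) + tau / 2, since f^2 is quadratic in the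
    [ke Z e] and can be integrated exactly. The last term is 2 delta times the bound tau |z|^2 / 2
    on |f|, where z is column i of Z. *)
Lemma score_pointwise (Z : MX R d n) :
  \sum_(e | msk e) ke Z e * H e (Xof eta G Z) <=
  \sum_(e | msk e) ke Z e * H e (Xof eta G (zcol Z)) +
  3 * eps * ((2 * tau)^-1 * (\sum_(e | msk e) \sum_(e' | msk e') ke Z e * ke Z e' * HH e e' (Xof eta G (zcol Z))) + tau / 2) +
  delta * tau * \sum_k fun_of_matrix Z k i ^+ 2.
Proof.
have [e0 e1] := andP eps01.
pose f y := \sum_(e | msk e) ke Z e * h e y.
have fE X : \int[kmeas M X]_y f y = \sum_(e | msk e) ke Z e * H e X.
  rewrite Rintegral_sum; last by move=> e me; exact: rintegrableZ (rintegrable_h X me).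
  by apply: eq_bigr => e me; rewrite (Rint_Z _ (rintegrable_h X me)).
have mf := measurable_ke_h Z.
have fT := ke_h_bound Z.
have if_ X : rintegrable (kmeas M X) f := rintegrable_bounded _ mf fT.
have dpc X X' : (forall l, l != i -> col l X = col l X') -> _ := dp_col dpM (ltW e0) delta0 (i := i) (X := X) (X' := X').
have h1 := dpc _ _ (fun l => @Xof_zcol Z l).
have h2 := dpc _ _ (fun l li => esym (@Xof_zcol Z l li)).
have := dp_signed h1 h2 eps01 delta0 mf fT.
rewrite -/f !fE.
set X' := Xof eta G (zcol Z).
have f2E : (fun y => f y ^+ 2) =1 (fun y => \sum_(e | msk e) \sum_(e' | msk e') ke Z e * ke Z e' * (h e y * h e' y)).
  move=> y; rewrite expr2 /f mulr_suml; apply: eq_bigr => e _; rewrite mulr_sumr.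
  by apply: eq_bigr => e' _; ring.
have if2 : rintegrable (kmeas M X') (fun y => f y ^+ 2).
  apply: rintegrable_ext (fun y => esym (f2E y)) _.
  by apply: rintegrable_sum => e me; apply: rintegrable_sum => e' me'; exact: rintegrableZ (rintegrable_hh X' me me').
have E2' : \int[kmeas M X']_y (f y ^+ 2) = \sum_(e | msk e) \sum_(e' | msk e') ke Z e * ke Z e' * HH e e' X'.
  under eq_Rintegral do rewrite f2E.
  rewrite Rintegral_sum; last first.
    by move=> e me; apply: rintegrable_sum => e' me'; exact: rintegrableZ (rintegrable_hh X' me me').
  apply: eq_bigr => e me; rewrite Rintegral_sum; last by move=> e' me'; exact: rintegrableZ (rintegrable_hh X' me me').
  by apply: eq_bigr => e' me'; rewrite (Rint_Z _ (rintegrable_hh X' me me')).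
have habs : \int[kmeas M X']_y `|f y| <= (2 * tau)^-1 * \int[kmeas M X']_y (f y ^+ 2) + tau / 2.
  have ib := rintegrableD (rintegrableZ (2 * tau)^-1 if2) (rintegrable_cst (kmeas M X') (tau / 2)).
  rewrite -(Rint_Z _ if2) -(Rintegral_cst1 (kmeas M X') (tau / 2)) -(Rint_D (rintegrableZ _ if2) (rintegrable_cst _ _)).
  apply: Rintegral_le => //; first exact: rintegrable_abs.
  move=> y; rewrite -[f y ^+ 2]real_normK ?num_real//; set x := `|f y|.
  rewrite -subr_ge0 (_ : _ - _ = (x - tau) ^+ 2 / (2 * tau)).
    by rewrite divr_ge0 ?sqr_ge0// mulr_ge0// ltW.
  by field; rewrite gt_eqF.
rewrite E2' in habs.
have e3 : 0 <= 3 * eps by lra.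
have := ler_wpM2l e3 habs.
set A := \sum_(e | msk e) _; set B := \sum_(e | msk e) _; set C := \int[_]_y _; set D := _ + tau / 2.
set q := \sum_k _ => u v.
have -> : delta * tau * q = 2 * delta * (tau * (q / 2)) by field.
by apply: (le_trans v); rewrite lerD2r lerD2l.
Qed.

Lemma rintegrable_H_zcol e : msk e -> rintegrable gZ (fun Z => H e (Xof eta G (zcol Z))).
Proof.
move=> me; have hb y := h_bound y me.
apply: (@rintegrable_bounded _ _ _ _ _ tau) => [|Z]; last exact: Kint_bound.
apply: (measurableT_comp (measurable_Kint M (mh e) hb)).
apply: (measurableT_comp (measurableT_comp (@measurable_Xof R d n eta) (pair1_measurable G))).
exact: measurable_zcol.
Qed.

Lemma rintegrable_HH_zcol e e' : msk e -> msk e' -> rintegrable gZ (fun Z => HH e e' (Xof eta G (zcol Z))).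
Proof.
move=> me me'; have hb y := hh_bound y me me'.
have mhh : measurable_fun setT (fun y => h e y * h e' y) by exact: measurable_funM.
apply: (@rintegrable_bounded _ _ _ _ _ (tau * tau)) => [|Z]; last exact: Kint_bound.
apply: (measurableT_comp (measurable_Kint M mhh hb)).
apply: (measurableT_comp (measurableT_comp (@measurable_Xof R d n eta) (pair1_measurable G))).
exact: measurable_zcol.
Qed.

Lemma msk_neq (e e' : E2) : msk e -> msk e' -> e.1 != e'.2.
Proof.
move=> /andP[h1 _] /andP[_ h2]; apply/eqP => E.
by move: h1; rewrite E leqNgt h2.
Qed.

Lemma keH_mean e : msk e ->
  rintegrable gZ (fun Z => ke Z e * H e (Xof eta G (zcol Z))) /\
  \int[gZ]_Z (ke Z e * H e (Xof eta G (zcol Z))) = 0.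
Proof.
move=> me; have ne := msk_neq me me.
have inv b (w : MX R d n) t : H e (Xof eta G (zcol (updm w (b, i) t))) = H e (Xof eta G (zcol w)).
  by rewrite zcol_updm.
have [j1 j2] := pair_moment (rintegrable_H_zcol me) (inv e.2) (inv e.1).
by split => //; rewrite j2 eq_sym (negbTE ne) mul0r.
Qed.

(** Row indices of the block and column indices of the block are disjoint, so a product of two [ke]
    splits into a pair of entries from the upper half of column i and a pair from the lower half;
    [pair_moment] is used once for each. *)
Lemma keke_mean e e' : msk e -> msk e' ->
  rintegrable gZ (fun Z => ke Z e * ke Z e' * HH e e' (Xof eta G (zcol Z))) /\
  \int[gZ]_Z (ke Z e * ke Z e' * HH e e' (Xof eta G (zcol Z))) =
  (e == e')%:R * \int[gZ]_Z HH e e' (Xof eta G (zcol Z)).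
Proof.
move=> me me'.
have inv b (w : MX R d n) t : HH e e' (Xof eta G (zcol (updm w (b, i) t))) = HH e e' (Xof eta G (zcol w)).
  by rewrite zcol_updm.
have [j1 j2] := pair_moment (rintegrable_HH_zcol me me') (inv e.1) (inv e'.1).
have inv2 (f2 : E2) : msk f2 -> forall (w : MX R d n) t,
   fun_of_matrix (updm w (f2.2, i) t) e.1 i * fun_of_matrix (updm w (f2.2, i) t) e'.1 i * HH e e' (Xof eta G (zcol (updm w (f2.2, i) t)))
   = fun_of_matrix w e.1 i * fun_of_matrix w e'.1 i * HH e e' (Xof eta G (zcol w)).
  move=> mf w t; rewrite inv !updm_neq// xpair_eqE negb_and; [by rewrite msk_neq|by rewrite msk_neq].
have [k1 k2] := pair_moment j1 (inv2 e me) (inv2 e' me').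
have E Z : ke Z e * ke Z e' * HH e e' (Xof eta G (zcol Z)) =
  fun_of_matrix Z e.2 i * fun_of_matrix Z e'.2 i *
  (fun_of_matrix Z e.1 i * fun_of_matrix Z e'.1 i * HH e e' (Xof eta G (zcol Z))).
  by rewrite /ke; ring.
split; first by apply: rintegrable_ext k1 => Z; rewrite E.
under eq_Rintegral do rewrite E.
rewrite k2 j2 mulrA; congr (_ * _).
case: e e' {me me' j1 j2 k1 k2 E inv inv2} => a b [a' b'] /=; rewrite xpair_eqE.
by case: (a == a'); case: (b == b'); rewrite ?mulr1 ?mulr0.
Qed.

Lemma rintegrable_keH e : msk e -> rintegrable gZ (fun Z => ke Z e * H e (Xof eta G Z)).
Proof.
case: e => a j me; have hb y := h_bound y me.
exact: (@rintegrable_ZZH R d n eta a j me (H (a, j)) tau (measurable_Kint M (mh _) hb) (fun X => Kint_bound M X (mh _) hb) G i).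
Qed.

(** With column i erased, the output is independent of that column, so the [ke] are centered and
    orthonormal against it: the first sum integrates to 0 and the mean of f^2 is the mean of |h|^2,
    at most tau^2. The two halves tau / 2 then add up to the factor 3 eps tau. *)
Lemma score_expect :
  \sum_(e | msk e) \int[gZ]_Z (ke Z e * H e (Xof eta G Z)) <= 3 * eps * tau + delta * tau * d%:R.
Proof.
have [e0 e1] := andP eps01.
have [iq eq] := @col_sq R d n i.
rewrite -Rintegral_sum; last by move=> e me; exact: rintegrable_keH.
have i1 : rintegrable gZ (fun Z => \sum_(e | msk e) ke Z e * H e (Xof eta G Z)).
  by apply: rintegrable_sum => e me; exact: rintegrable_keH.
have i2 : rintegrable gZ (fun Z => \sum_(e | msk e) ke Z e * H e (Xof eta G (zcol Z))).
  by apply: rintegrable_sum => e me; case: (keH_mean me).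
have i3 : rintegrable gZ (fun Z => \sum_(e | msk e) \sum_(e' | msk e') ke Z e * ke Z e' * HH e e' (Xof eta G (zcol Z))).
  by apply: rintegrable_sum => e me; apply: rintegrable_sum => e' me'; case: (keke_mean me me').
have i4 := rintegrableD (rintegrableZ (2 * tau)^-1 i3) (rintegrable_cst gZ (tau / 2)).
have i5 := rintegrableZ (3 * eps) i4.
have i6 := rintegrableD i2 i5.
have i7 := rintegrableZ (delta * tau) iq.
apply: (le_trans (Rintegral_le i1 (rintegrableD i6 i7) score_pointwise)).
rewrite (Rint_D i6 i7) (Rint_D i2 i5) (Rint_Z _ iq) eq (Rint_Z _ i4) (Rint_D (rintegrableZ _ i3) (rintegrable_cst _ _)).
rewrite (Rint_Z _ i3) Rintegral_cst1 lerD2r.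
rewrite Rintegral_sum; last by move=> e me; case: (keH_mean me).
rewrite big1 ?add0r; last by move=> e me; case: (keH_mean me).
have hs : \int[gZ]_Z (\sum_(e | msk e) \sum_(e' | msk e') ke Z e * ke Z e' * HH e e' (Xof eta G (zcol Z))) <= tau ^+ 2.
  rewrite Rintegral_sum; last first.
    by move=> e me; apply: rintegrable_sum => e' me'; case: (keke_mean me me').
  have -> : \sum_(e | msk e) \int[gZ]_Z (\sum_(e' | msk e') ke Z e * ke Z e' * HH e e' (Xof eta G (zcol Z))) =
     \sum_(e | msk e) \int[gZ]_Z HH e e (Xof eta G (zcol Z)).
    apply: eq_bigr => e me; rewrite Rintegral_sum; last by move=> e' me'; case: (keke_mean me me').
    rewrite (bigD1 e)//= [X in _ + X]big1 ?addr0; last first.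
      by move=> e' /andP[me' ne]; have [_ ->] := keke_mean me me'; rewrite eq_sym (negbTE ne) mul0r.
    by have [_ ->] := keke_mean me me; rewrite eqxx mul1r.
  rewrite -Rintegral_sum; last by move=> e me; exact: rintegrable_HH_zcol.
  rewrite -[leRHS](Rintegral_cst1 gZ); apply: Rintegral_le.
  - by apply: rintegrable_sum => e me; exact: rintegrable_HH_zcol.
  - exact: rintegrable_cst.
  move=> Z; rewrite -Rintegral_sum; last by move=> e me; exact: rintegrable_hh.
  rewrite -[leRHS](Rintegral_cst1 (kmeas M (Xof eta G (zcol Z)))); apply: Rintegral_le.
  - by apply: rintegrable_sum => e me; exact: rintegrable_hh.
  - exact: rintegrable_cst.
  by move=> y; apply: le_trans (h_tau y); apply: ler_sum => e _; rewrite expr2.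
have ti : 0 <= (2 * tau)^-1 by rewrite invr_ge0 mulr_ge0// ltW.
have := ler_wpM2l ti hs.
have -> : (2 * tau)^-1 * tau ^+ 2 = tau / 2 by field; rewrite gt_eqF.
set S := _ * \int[_]__ _ => hs2; apply: ler_wpM2l; first by lra.
by lra.
Qed.

End score_bound.

(** * Reduction of the conditional error to the model *)

Section lower_integral.
Context d (T : measurableType d) (R : realType) (P : {measure set T -> \bar R}).

(** The integral of a nonnegative function is a supremum over the simple functions below it, hence
    monotone on arbitrary functions. This lets the nested integrals of [alpha2] be bounded below
    directly. *)
Lemma ge0_le_integral_any (f g : T -> \bar R) : (forall x, 0 <= f x)%E ->
  (forall x, f x <= g x)%E -> (\int[P]_x f x <= \int[P]_x g x)%E.
Proof.
move=> f0 fg; have g0 x : (0 <= g x)%E by exact: le_trans (fg x).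
rewrite !ge0_integralTE//; apply: le_ereal_sup => _ [h hf <-].
by exists h => // x; exact: le_trans (fg x).
Qed.

(** The integrable minorant may be negative; it is first replaced by its maximum with 0. *)
Lemma Rintegral_le_integral (f : T -> R) (g : T -> \bar R) : rintegrable P f ->
  (forall x, 0 <= g x)%E -> (forall x, (f x)%:E <= g x)%E ->
  ((\int[P]_x f x)%:E <= \int[P]_x g x)%E.
Proof.
move=> fi g0 fg.
have mi : rintegrable P (fun x => Num.max (f x) 0).
  apply: le_rintegrable (rintegrable_abs fi).
    by apply: measurable_maxr => //; exact: rintegrable_mfun fi.
  move=> x; rewrite ger0_norm ?le_max ?lexx ?orbT// ge_max normr_ge0 andbT.
  exact: ler_norm.
apply: (@le_trans _ _ (\int[P]_x Num.max (f x) 0)%:E).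
  by rewrite lee_fin; apply: Rintegral_le => // x; rewrite le_max lexx.
rewrite -Rintegral_EFin//; apply: ge0_le_integral_any => x.
  by rewrite lee_fin le_max lexx orbT.
by rewrite EFin_max ge_max fg g0.
Qed.
End lower_integral.

Section marginals.
Context d1 d2 (T1 : measurableType d1) (T2 : measurableType d2) (R : realType).
Context (P1 : probability T1 R) (P2 : probability T2 R).

Lemma rintegrable_snd (f : T2 -> R) : rintegrable P2 f ->
  rintegrable (P1 \x P2)%E (fun p => f p.2) /\ \int[(P1 \x P2)%E]_p f p.2 = \int[P2]_y f y.
Proof.
move=> fi.
have gen (g : T2 -> R) : rintegrable P2 g -> (forall y, 0 <= g y) ->
    (\int[(P1 \x P2)%E]_p (g p.2)%:E = (\int[P2]_y g y)%:E)%E.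
  move=> gi g0; rewrite (tonelli12 P1 P2).
  - by rewrite -(Rintegral_EFin gi) /=; exact: (integral_prob_cst P1).
  - by apply/measurable_EFinP; exact: (measurableT_comp (rintegrable_mfun gi) measurable_snd).
  - by move=> p; rewrite lee_fin.
have genI (g : T2 -> R) : rintegrable P2 g -> (forall y, 0 <= g y) ->
    rintegrable (P1 \x P2)%E (fun p => g p.2).
  move=> gi g0; apply: (@ge0_rintegrable _ _ _ _ _ (\int[P2]_y g y)).
  - exact: (measurableT_comp (rintegrable_mfun gi) measurable_snd).
  - by move=> p.
  - by rewrite gen.
have fa := rintegrable_abs fi.
have a1 := genI _ fa (fun=> normr_ge0 _).
have p0 y : 0 <= `|f y| + f y by have := ler_norm (- f y); rewrite normrN; lra.
have a2 := genI _ (rintegrableD fa fi) p0.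
have e1 := gen _ fa (fun=> normr_ge0 _).
have e2 := gen _ (rintegrableD fa fi) p0.
have E : (fun p : T1 * T2 => f p.2) =1 (fun p => (`|f p.2| + f p.2) - `|f p.2|).
  by move=> p; rewrite addrAC subrr add0r.
split; first by apply: rintegrable_ext (rintegrableB a2 a1) => p; rewrite -E.
transitivity (\int[(P1 \x P2)%E]_p ((`|f p.2| + f p.2) - `|f p.2|)).
  by apply: eq_Rintegral => p _; rewrite -E.
rewrite (Rint_B a2 a1) [X in X - _]/Rintegral e2 [X in _ - X]/Rintegral e1 /= (Rint_D fa fi).
by rewrite addrAC subrr add0r.
Qed.

Lemma rintegrable_fst (f : T1 -> R) : rintegrable P1 f ->
  rintegrable (P1 \x P2)%E (fun p => f p.1) /\ \int[(P1 \x P2)%E]_p f p.1 = \int[P1]_x f x.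
Proof.
move=> fi.
have gen (g : T1 -> R) : rintegrable P1 g -> (forall y, 0 <= g y) ->
    (\int[(P1 \x P2)%E]_p (g p.1)%:E = (\int[P1]_y g y)%:E)%E.
  move=> gi g0; rewrite (tonelli12 P1 P2).
  - by rewrite -(Rintegral_EFin gi); apply: eq_integral => x _ /=; exact: (integral_prob_cst P2).
  - by apply/measurable_EFinP; exact: (measurableT_comp (rintegrable_mfun gi) measurable_fst).
  - by move=> p; rewrite lee_fin.
have genI (g : T1 -> R) : rintegrable P1 g -> (forall y, 0 <= g y) ->
    rintegrable (P1 \x P2)%E (fun p => g p.1).
  move=> gi g0; apply: (@ge0_rintegrable _ _ _ _ _ (\int[P1]_y g y)).
  - exact: (measurableT_comp (rintegrable_mfun gi) measurable_fst).
  - by move=> p.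
  - by rewrite gen.
have fa := rintegrable_abs fi.
have a1 := genI _ fa (fun=> normr_ge0 _).
have p0 y : 0 <= `|f y| + f y by have := ler_norm (- f y); rewrite normrN; lra.
have a2 := genI _ (rintegrableD fa fi) p0.
have e1 := gen _ fa (fun=> normr_ge0 _).
have e2 := gen _ (rintegrableD fa fi) p0.
have E : (fun p : T1 * T2 => f p.1) =1 (fun p => (`|f p.1| + f p.1) - `|f p.1|).
  by move=> p; rewrite addrAC subrr add0r.
split; first by apply: rintegrable_ext (rintegrableB a2 a1) => p; rewrite -E.
transitivity (\int[(P1 \x P2)%E]_p ((`|f p.1| + f p.1) - `|f p.1|)).
  by apply: eq_Rintegral => p _; rewrite -E.
rewrite (Rint_B a2 a1) [X in X - _]/Rintegral e2 [X in _ - X]/Rintegral e1 /= (Rint_D fa fi).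
by rewrite addrAC subrr add0r.
Qed.
End marginals.

(** * The product model and its conditional error *)

Section model.
Context (R : realType) (d n : nat) (dT : measure_display) (T : measurableType dT).
Variables (P1 : probability T R) (A1 : T -> 'M[R]_d).
Hypothesis mA1 : measurable_fun setT (A1 : T -> MX R d d).
Local Notation gZ := (gmx R d n).

Definition Pr : probability (T * MX R d n)%type R := [the probability _ _ of (P1 \x gZ)%E].
Definition Aw (w : T * MX R d n) : 'M[R]_d := A1 w.1.
Definition Zw (i : 'I_d) (j : 'I_n) (w : T * MX R d n) : R := fun_of_matrix w.2 i j.

Lemma measurable_Aw : measurable_fun setT (Aw : _ -> MX R d d).
Proof. exact: (measurableT_comp mA1 measurable_fst). Qed.

Lemma measurable_Zw i j : measurable_fun setT (Zw i j).
Proof. by apply: measurable_mx_comp; exact: measurable_snd. Qed.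

Lemma gmx_rect (C : 'I_d -> 'I_n -> set R) : (forall i j, measurable (C i j)) ->
  gZ [set Z | forall i j, C i j (fun_of_matrix Z i j)] =
  (\prod_(i < d) \prod_(j < n) normal_prob 0 1 (C i j))%E.
Proof.
move=> mC.
have mS : measurable [set Z : MX R d n | forall i j, C i j (fun_of_matrix Z i j)].
  rewrite [X in measurable X](_ : _ = \bigcap_(c in [set: 'I_d * 'I_n])
    ((fun Z : MX R d n => fun_of_matrix Z c.1 c.2) @^-1` C c.1 c.2)); last first.
    apply/seteqP; split => Z /=; first by move=> h [i j] _; exact: h.
    by move=> h i j; exact: (h (i, j) Logic.I).
  apply: fin_bigcap_measurable => // -[i j] _ /=.
  by rewrite -[X in measurable X]setTI; exact: (measurable_coord i j).
rewrite pair_bigA/=.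
transitivity (\prod_(c : 'I_d * 'I_n) \int[normal_prob 0 1]_t (\1_(C c.1 c.2) t)%:E)%E; last first.
  apply: eq_bigr => c _; transitivity (@normal_prob R 0 1 (C c.1 c.2 `&` setT)); last by rewrite setIT.
  by apply: integral_indic => //; exact: mC.
rewrite -(@gmx_prod R d n _ (fun c => \1_(C c.1 c.2)) (index_enum_uniq _)).
- transitivity (\int[gZ]_Z (\1_[set Z : MX R d n | forall i j, C i j (fun_of_matrix Z i j)] Z)%:E)%E.
    by rewrite integral_indic// setIT.
  apply: eq_integral => Z _; congr EFin.
  rewrite indicE; case: (boolP (_ \in _)) => [|/negP hZ].
    rewrite inE/= => hZ; rewrite big1// => c _; rewrite indicE mem_set//; exact: hZ.
  have [c hc] : exists c : 'I_d * 'I_n, ~ C c.1 c.2 (fun_of_matrix Z c.1 c.2).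
    apply/not_existsP => h; apply: hZ; rewrite inE /= => i j.
    by have := h (i, j); move/contrapT.
  by rewrite (bigD1 c)//= indicE memNset// mul0r.
- by move=> c; apply: measurable_indic; exact: mC.
- by move=> c t; rewrite indicE.
Qed.

Lemma model_indep (B : set (MX R d d)) (C : 'I_d -> 'I_n -> set R) :
  measurable B -> (forall i j, measurable (C i j)) ->
  Pr [set w | B (Aw w) /\ forall i j, C i j (Zw i j w)] =
  (Pr [set w | B (Aw w)] * \prod_(i < d) \prod_(j < n) normal_prob 0 1 (C i j))%E.
Proof.
move=> mB mC.
pose B1 := [set x : T | B (A1 x)].
pose C1 := [set Z : MX R d n | forall i j, C i j (fun_of_matrix Z i j)].
have mB1 : measurable B1 by rewrite -[B1]setTI; exact: mA1.
have mC1 : measurable C1.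
  rewrite [X in measurable X](_ : _ = \bigcap_(c in [set: 'I_d * 'I_n])
    ((fun Z : MX R d n => fun_of_matrix Z c.1 c.2) @^-1` C c.1 c.2)); last first.
    apply/seteqP; split => Z /=; first by move=> h [i j] _; exact: h.
    by move=> h i j; exact: (h (i, j) Logic.I).
  apply: fin_bigcap_measurable => // -[i j] _ /=.
  by rewrite -[X in measurable X]setTI; exact: (measurable_coord i j).
have -> : [set w | B (Aw w) /\ forall i j, C i j (Zw i j w)] = B1 `*` C1 by [].
have -> : [set w | B (Aw w)] = B1 `*` setT by apply/seteqP; split => w //= [].
have -> : Pr (B1 `*` C1) = (P1 B1 * gZ C1)%E by exact: product_measure1E.
have -> : Pr (B1 `*` setT) = (P1 B1 * gZ setT)%E by exact: product_measure1E.
by rewrite gmx_rect// [gZ setT]probability_setT mule1.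
Qed.

Lemma Pr_fst_event (D : set T) : measurable D -> Pr [set w | D w.1] = P1 D.
Proof.
move=> mD.
have -> : [set w : T * MX R d n | D w.1] = D `*` setT by apply/seteqP; split => w //= [].
have -> : Pr (D `*` setT) = (P1 D * gZ setT)%E by exact: product_measure1E.
by rewrite [gZ setT]probability_setT mule1.
Qed.

Lemma datamx_Zw w : datamx Zw w = w.2.
Proof. by apply/matrixP => i j; rewrite mxE. Qed.

Variable M : R.-pker (MX R d n) ~> (MX R d d).

Lemma frob2_ge0 m k (Y S : 'M[R]_(m, k)) : 0 <= frob2 Y S.
Proof. by apply: sumr_ge0 => i _; apply: sumr_ge0 => j _; exact: sqr_ge0. Qed.

Lemma alpha2_at_ge0 A0 : (0 <= alpha2_at Pr Zw M A0)%E.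
Proof.
apply: integral_ge0 => w _; apply: integral_ge0 => y _.
by rewrite lee_fin frob2_ge0.
Qed.

Lemma alpha2_at_lower (A0 : 'M[R]_d) (g : MX R d n -> R) : rintegrable gZ g ->
  (forall Z : MX R d n, ((g Z)%:E <= \int[M (A0 *m Z : 'M[R]_(d, n))]_y (frob2 (y : 'M[R]_d) (A0 *m A0^T))%:E)%E) ->
  ((\int[gZ]_Z g Z)%:E <= alpha2_at Pr Zw M A0)%E.
Proof.
move=> gi hg; have [i1 <-] := rintegrable_snd P1 gi.
apply: Rintegral_le_integral => //.
- by move=> w; apply: integral_ge0 => y _; rewrite lee_fin frob2_ge0.
- by move=> w; rewrite datamx_Zw.
Qed.

(** Clears the normalising probability in [alpha2] and replaces the integral over the event by one
    over the whole space, the minorant being 0 outside the event. *)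
Lemma alpha2_lower (D : set T) (L : T -> R) (a : R) : measurable D ->
  [set w | @Wset R d (Aw w *m (Aw w)^T)] = [set w | D w.1] ->
  (0 < P1 D)%E -> rintegrable P1 L ->
  (forall x, D x -> ((L x)%:E <= alpha2_at Pr Zw M (A1 x))%E) ->
  (forall x, ~ D x -> L x = 0) ->
  alpha2 Pr Aw Zw M = (a ^+ 2)%:E ->
  \int[P1]_x L x <= fine (P1 D) * a ^+ 2.
Proof.
move=> mD WD PD0 Li hL hL0; rewrite /alpha2 WD.
rewrite Pr_fst_event//.
have Pfin : P1 D \is a fin_num by exact: fin_num_measure.
have p0 : 0 < fine (P1 D) by rewrite -lte_fin fineK.
set J := (\int[_]_(w in _) _)%E => hJ.
have JE : J = (fine (P1 D) * a ^+ 2)%:E.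
  by rewrite EFinM -hJ muleA -EFinM divff ?gt_eqF// mul1e.
rewrite -lee_fin -JE; have [i1 <-] := rintegrable_fst gZ Li.
rewrite /J integral_mkcond; apply: Rintegral_le_integral => //.
- by move=> w; apply: erestrict_ge0 => v _; exact: alpha2_at_ge0.
move=> w; rewrite patchE; case: ifPn => [|/negP h].
  by rewrite inE/=; exact: hL.
by rewrite hL0// => Dw; apply: h; rewrite inE.
Qed.

End model.

(** * Correlation inequality in high dimension *)

Section shrink.
Context (R : realType) (d : nat) (s2 : R).
Hypothesis s20 : 0 < s2.
Local Notation E2 := ('I_d * 'I_d)%type.

Definition msq (y : 'M[R]_d) : R := \sum_(c | msk c) y c.1 c.2 ^+ 2.

Lemma msq_ge0 y : 0 <= msq y.
Proof. by apply: sumr_ge0 => c _; exact: sqr_ge0. Qed.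

(* The factor keeps [hfun c y] bounded by [sqrt s2 / 2] while leaving it a fixed proportion
   of [y] at the expected size [msq y = s2]. *)
Definition hfun (c : E2) (y : MX R d d) : R := s2 / (s2 + msq y) * fun_of_matrix y c.1 c.2.

Lemma measurable_msq : measurable_fun setT (fun y : MX R d d => msq y).
Proof.
rewrite /msq; under eq_fun do rewrite big_mkcond/=.
apply: measurable_sum => c; case: (msk c); last exact: measurable_cst.
by apply: measurable_funX; exact: measurable_coord.
Qed.

Lemma measurable_hfun c : measurable_fun setT (hfun c).
Proof.
apply: measurable_funM; last exact: measurable_coord.
apply: measurable_funM => //.
apply: (measurable_comp (F := ~` [set 0 : R])).
- by apply: measurableC; exact: measurable_set1.
- move=> _ [y _ <-] /= e0; have := msq_ge0 y.
  by have := ltr_wpDr (msq_ge0 y) s20; rewrite e0 ltxx.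
- apply: open_continuous_measurable_fun.
    by apply: closed_openC; exact: closed_eq.
  by move=> x; rewrite inE => /= /eqP x0; exact: inv_continuous.
- by apply: measurable_funD => //; exact: measurable_msq.
Qed.

(** With S = |y|^2 on the block this is s2^2 S / (s2 + S)^2 <= s2 / 4, with equality at S = s2. *)
Lemma hfun_sq y : \sum_(c | msk c) hfun c y ^+ 2 <= (Num.sqrt s2 / 2) ^+ 2.
Proof.
rewrite expr_div_n sqr_sqrtr; last exact: ltW.
under eq_bigr do rewrite exprMn.
rewrite -mulr_sumr -/(msq y).
have S0 := msq_ge0 y; have p0 := ltr_wpDr S0 s20; set S := msq y in S0 p0 *.
rewrite expr_div_n -mulrA [_^-1 * _]mulrC mulrA ler_pdivrMr ?exprn_gt0//.
rewrite -subr_ge0 (_ : _ - _ = s2 * (s2 - S) ^+ 2 / 4); last by field.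
by rewrite divr_ge0// mulr_ge0 ?sqr_ge0// ltW.
Qed.

(** Polarisation gives twice the inner product of th and y as |th|^2 + S - err. If |th|^2 were s2,
    the shrink factor s2 / (s2 + S) would cancel s2 + S and leave at least (s2 - err) / 2; the
    absolute value accounts for the deviation of |th|^2 from s2. *)
Lemma hfun_corr (th : E2 -> R) (y : MX R d d) :
  (s2 - `|\sum_(c | msk c) th c ^+ 2 - s2| - \sum_(c | msk c) (fun_of_matrix y c.1 c.2 - th c) ^+ 2) / 2
  <= \sum_(c | msk c) th c * hfun c y.
Proof.
set Th := \sum_(c | msk c) th c ^+ 2; set err := \sum_(c | msk c) (_ - _) ^+ 2.
have S0 := msq_ge0 y; have p0 := ltr_wpDr S0 s20; set S := msq y in S0 p0 *.
have err0 : 0 <= err by apply: sumr_ge0 => c _; exact: sqr_ge0.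
have -> : \sum_(c | msk c) th c * hfun c y = s2 / (s2 + S) * ((Th + S - err) / 2).
  have -> : Th + S - err = \sum_(c | msk c) 2 * (th c * fun_of_matrix y c.1 c.2).
    rewrite /Th /S /msq /err -big_split -sumrB; apply: eq_bigr => c _ /=; ring.
  rewrite -mulr_sumr [2 * _]mulrC mulfK// mulr_sumr; apply: eq_bigr => c _.
  by rewrite /hfun -/S; ring.
have a1 := ler_norm (Th - s2); have a2 := ler_norm (- (Th - s2)); rewrite normrN in a2.
set D := `|Th - s2| in a1 a2 *.
rewrite mulrAC ler_pdivlMr//.
have SD : 0 <= S * D by rewrite mulr_ge0//; lra.
have Se := mulr_ge0 S0 err0.
have sD : 0 <= s2 * (D + (Th - s2)) by apply: mulr_ge0; [exact: ltW|rewrite -lerBlDr sub0r].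
rewrite -subr_ge0 (_ : _ - _ = (s2 * (D + (Th - s2)) + S * D + S * err) / 2); last by field.
by rewrite divr_ge0// addr_ge0// addr_ge0.
Qed.

(** Expanding |th / 2 + h|^2 >= 0. This bound does not involve the error and therefore serves on the
    event where the error is not controlled. *)
Lemma hfun_corr_ge (th : E2 -> R) (y : MX R d d) :
  - (\sum_(c | msk c) th c ^+ 2 + s2) / 4 <= \sum_(c | msk c) th c * hfun c y.
Proof.
have := hfun_sq y; rewrite expr_div_n sqr_sqrtr => [h|]; last exact: ltW.
have : 0 <= \sum_(c | msk c) (th c / 2 + hfun c y) ^+ 2 by apply: sumr_ge0 => c _; exact: sqr_ge0.
have -> : \sum_(c | msk c) (th c / 2 + hfun c y) ^+ 2 =
  (\sum_(c | msk c) th c ^+ 2) / 4 + \sum_(c | msk c) hfun c y ^+ 2 + \sum_(c | msk c) th c * hfun c y.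
  by rewrite mulr_suml -!big_split; apply: eq_bigr => c _ /=; field.
lra.
Qed.
End shrink.

Section large.
Context (R : realType) (d n : nat) (eps delta eta : R).
Hypothesis eta0 : 0 < eta.
Hypothesis pm0 : 0 < pm R d.
Hypothesis d0 : (0 < d)%N.
Hypothesis eps01 : 0 < eps < 1.
Local Notation gG := (gmx R d d).
Local Notation gZ := (gmx R d n).
Local Notation E2 := ('I_d * 'I_d)%type.
Local Notation s2 := (pm R d * eta ^+ 2).
Local Notation tau := (Num.sqrt s2 / 2).
Local Notation h := (@hfun R d s2).

Lemma s2_gt0 : 0 < s2. Proof. by rewrite mulr_gt0// exprn_gt0. Qed.

Lemma tau_gt0 : 0 < tau. Proof. by rewrite divr_gt0// sqrtr_gt0 s2_gt0. Qed.

(* [10%:M] has covariance 100 I, outside [Wset]. *)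
Definition A1 (G : MX R d d) : 'M[R]_d := if good eta G then 1%:M + Nmx eta G else 10%:M.

Lemma measurable_A1 : measurable_fun setT (A1 : MX R d d -> MX R d d).
Proof.
apply: measurable_mxP => i j.
rewrite (_ : (fun _ => _) = (fun G : MX R d d => (1 - (~~ good eta G)%:R) * ((i == j)%:R + (if msk (i, j) then eta * fun_of_matrix G i j else 0))
   + (~~ good eta G)%:R * (10 *+ (i == j)))); last first.
  apply/funext => G; rewrite /A1; case: good => /=; rewrite !mxE.
    by rewrite subr0 mul1r mul0r addr0.
  by rewrite subrr mul0r mul1r add0r.
apply: measurable_funD; apply: measurable_funM => //.
- by apply: measurable_funB => //; exact: measurable_bad.
- apply: measurable_funD => //; case: (msk _); last exact: measurable_cst.
  by apply: measurable_funM => //; exact: measurable_coord.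
- exact: measurable_bad.
Qed.

Lemma scal_quad (k : R) (v : 'cV[R]_d) :
  (v^T *m ((k%:M : 'M[R]_d) *m (k%:M)^T) *m v) ord0 ord0 = k ^+ 2 * (v^T *m v) ord0 ord0.
Proof.
rewrite tr_scalar_mx -scalar_mxM -mulmxA mul_scalar_mx -scalemxAr mxE.
by rewrite expr2.
Qed.

Lemma vv_ge0 (v : 'cV[R]_d) : 0 <= (v^T *m v) ord0 ord0.
Proof. by rewrite mxE; apply: sumr_ge0 => i _; rewrite mxE -expr2 sqr_ge0. Qed.

Lemma vv_gt0 (v : 'cV[R]_d) : v != 0 -> 0 < (v^T *m v) ord0 ord0.
Proof.
move=> v0; rewrite lt_neqAle vv_ge0 andbT eq_sym; apply: contra v0.
rewrite mxE psumr_eq0 => [/allP h1|i _]; last by rewrite mxE -expr2 sqr_ge0.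
apply/eqP/matrixP => i j; rewrite ord1 mxE.
have := h1 i (mem_index_enum _); rewrite mxE -expr2 sqrf_eq0 => /eqP //.
Qed.

Lemma A1_W_event : [set w : MX R d d * MX R d n | @Wset R d (Aw A1 w *m (Aw A1 w)^T)] = [set w | good eta w.1].
Proof.
apply/seteqP; split => w /=; rewrite /Aw /A1; case: ifPn => // gg.
  move=> [_ hW].
  pose v : 'cV[R]_d := const_mx 1.
  have v0 : v != 0.
    apply/eqP => /matrixP/(_ (Ordinal d0) ord0); rewrite !mxE => /eqP.
    by rewrite oner_eq0.
  have [_] := hW v; rewrite scal_quad; have := vv_gt0 v0; lra.
by move=> _; exact: good_opnorm.
Qed.

Lemma A1_posdef w : posdef (Aw (n := n) A1 w *m (Aw A1 w)^T).
Proof.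
rewrite /Aw /A1; case: ifPn => gg.
  have [sy hW] := good_opnorm gg; split => // v v0.
  have [h1 _] := hW v; apply: lt_le_trans h1; rewrite mulr_gt0 ?vv_gt0//.
split; first by rewrite trmx_mul trmxK.
by move=> v v0; rewrite scal_quad mulr_gt0 ?vv_gt0// exprn_gt0.
Qed.

Definition bad (G : MX R d d) : R := (~~ good eta G)%:R.

Lemma rintegrable_bad : rintegrable gG bad.
Proof.
apply: (@rintegrable_bounded _ _ _ _ _ 1); first exact: measurable_bad.
by move=> G; rewrite /bad; case: good; rewrite ?normr0 ?normr1.
Qed.

Lemma prob_good : fine (gG [set G | good eta G]) = 1 - \int[gG]_G bad G.
Proof.
have mg := measurable_good (R := R) (d := d) eta.
have ig : rintegrable gG (\1_[set G : MX R d d | good eta G]).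
  apply: (@rintegrable_bounded _ _ _ _ _ 1); first exact: measurable_indic.
  by move=> G; rewrite indicE; case: (_ \in _); rewrite ?normr0 ?normr1.
have -> : fine (gG [set G | good eta G]) = \int[gG]_G \1_[set G : MX R d d | good eta G] G.
  by rewrite /Rintegral integral_indic// setIT.
rewrite -(Rintegral_cst1 gG 1) -(Rint_B (rintegrable_cst gG 1) rintegrable_bad).
apply: eq_Rintegral => G _; rewrite indicE /bad; case: (boolP (good eta G)) => gg.
  by rewrite mem_set// subr0.
by rewrite memNset ?subrr//= => /(negP gg).
Qed.

Lemma good_gt0 : \int[gG]_G bad G <= 1 / 100 -> (0 < gG [set G | good eta G])%E.
Proof.
move=> hbad; rewrite -[X in (0 < X)%E]fineK; last first.
  exact: (fin_num_measure gG _ (measurable_good (R := R) (d := d) eta)).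
by rewrite prob_good lte_fin; lra.
Qed.

Variable M : R.-pker (MX R d n) ~> (MX R d d).
Local Notation H c := (Kint M (h c)).

(** The conditional expectation, given G, of the inner product of N with the shrunk output. *)
Definition Scorr (G : MX R d d) : R := \sum_(c | msk c) eta * (fun_of_matrix G c.1 c.2 * Phi eta (H c) G).

Lemma measurable_h c : measurable_fun setT (h c).
Proof. exact: (measurable_hfun s2_gt0). Qed.

Lemma h_tau y : \sum_(c | msk c) h c y ^+ 2 <= tau ^+ 2.
Proof. exact: (hfun_sq s2_gt0). Qed.

Lemma h_le_tau c y : msk c -> `|h c y| <= tau.
Proof. exact: (h_bound tau_gt0 h_tau). Qed.

Lemma measurable_H c : msk c -> measurable_fun setT (H c).
Proof. by move=> mc; apply: (measurable_Kint M (measurable_h c)) => y; exact: h_le_tau. Qed.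

Lemma H_le_tau c X : msk c -> `|H c X| <= tau.
Proof. by move=> mc; apply: Kint_bound; [exact: measurable_h|move=> y; exact: h_le_tau]. Qed.

Lemma rintegrable_Scorr : rintegrable gG Scorr.
Proof.
apply: rintegrable_sum => -[a j] mc /=; apply: rintegrableZ.
exact: (@rintegrable_GPhi R d n eta a j (H (a, j)) tau (measurable_H mc) (fun X => H_le_tau X mc)).
Qed.

(** [stein_id] for every entry of the block; exchanging the sums over entries and over columns then
    leaves one instance of [score_expect] for each of the n columns, valid for each fixed G. *)
Lemma Scorr_upper : dp eps delta M -> 0 <= delta ->
  \int[gG]_G Scorr G <= eta ^+ 2 * (n%:R * (3 * eps * tau + delta * tau * d%:R)).
Proof.
move=> dpM delta0.
have iP a j (mc : msk (a, j)) := @rintegrable_Psi R d n eta a j mc (H (a, j)) tau (measurable_H mc) (fun X => H_le_tau X mc).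
have -> : \int[gG]_G Scorr G = eta ^+ 2 * \int[gG]_G (\sum_(c | msk c) Psi eta c.1 c.2 (H c) G).
  rewrite [LHS]Rintegral_sum; last first.
    move=> -[a j] mc /=; apply: rintegrableZ.
    exact: (@rintegrable_GPhi R d n eta a j (H (a, j)) tau (measurable_H mc) (fun X => H_le_tau X mc)).
  rewrite Rintegral_sum; last by move=> -[a j] mc; exact: iP.
  rewrite mulr_sumr; apply: eq_bigr => -[a j] mc /=.
  rewrite (Rint_Z _ (@rintegrable_GPhi R d n eta a j (H (a, j)) tau (measurable_H mc) (fun X => H_le_tau X mc))).
  rewrite (@stein_id R d n eta a j mc (H (a, j)) tau (measurable_H mc) (fun X => H_le_tau X mc)).
  by rewrite expr2 mulrA.
rewrite ler_wpM2l ?sqr_ge0// -[leRHS](Rintegral_cst1 gG); apply: Rintegral_le.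
- by apply: rintegrable_sum => -[a j] mc; exact: iP.
- exact: rintegrable_cst.
move=> G; rewrite /Psi exchange_big/=.
rewrite [leRHS](_ : _ = \sum_(i < n) (3 * eps * tau + delta * tau * d%:R)); last first.
  by rewrite sumr_const card_ord mulr_natl.
apply: ler_sum => i _.
exact: (score_expect eta dpM eps01 delta0 measurable_h tau_gt0 h_tau G i).
Qed.

Definition thG (G : MX R d d) (c : E2) : R := eta * fun_of_matrix G c.1 c.2.

Lemma thG_sq (G : MX R d d) : \sum_(c | msk c) thG G c ^+ 2 - s2 = eta ^+ 2 * Tdev G.
Proof.
rewrite /pm mulr_suml -sumrB mulr_sumr; apply: eq_bigr => c _.
by rewrite /thG; ring.
Qed.

Definition fG (G y : MX R d d) : R := \sum_(c | msk c) thG G c * h c y.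

Lemma rintegrable_hfun c X : msk c -> rintegrable (kmeas M X) (h c).
Proof. by move=> mc; apply: (@rintegrable_bounded _ _ _ _ _ tau) => [|y]; [exact: measurable_h|exact: h_le_tau]. Qed.

Lemma rintegrable_fG (G : MX R d d) X : rintegrable (kmeas M X) (fG G).
Proof. by apply: rintegrable_sum => c mc; apply: rintegrableZ; exact: rintegrable_hfun. Qed.

Lemma fG_int (G : MX R d d) X : \int[kmeas M X]_y fG G y = \sum_(c | msk c) thG G c * H c X.
Proof.
rewrite Rintegral_sum; last by move=> c mc; apply: rintegrableZ; exact: rintegrable_hfun.
by apply: eq_bigr => c mc; rewrite (Rint_Z _ (rintegrable_hfun X mc)).
Qed.

Lemma rintegrable_HX (G : MX R d d) c : msk c -> rintegrable gZ (fun Z : MX R d n => H c (Xof eta G Z)).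
Proof. by move=> mc; exact: (@rintegrable_H R d n eta (H c) tau (measurable_H mc) (fun X => H_le_tau X mc) G). Qed.

Lemma Scorr_Z (G : MX R d d) : rintegrable gZ (fun Z => \int[kmeas M (Xof eta G Z)]_y fG G y) /\
  \int[gZ]_Z (\int[kmeas M (Xof eta G Z)]_y fG G y) = Scorr G.
Proof.
have E : (fun Z : MX R d n => \int[kmeas M (Xof eta G Z)]_y fG G y) =1 (fun Z => \sum_(c | msk c) thG G c * H c (Xof eta G Z)).
  by move=> Z; exact: fG_int.
split.
  apply: rintegrable_ext (fun Z => esym (E Z)) _.
  by apply: rintegrable_sum => c mc; apply: rintegrableZ; exact: rintegrable_HX.
under eq_Rintegral do rewrite E.
rewrite Rintegral_sum; last by move=> c mc; apply: rintegrableZ; exact: rintegrable_HX.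
by apply: eq_bigr => c mc; rewrite (Rint_Z _ (rintegrable_HX G mc)) /thG mulrA.
Qed.

Lemma Scorr_lower (G : MX R d d) : - (2 * s2 + eta ^+ 2 * `|Tdev G|) / 4 <= Scorr G.
Proof.
have [iZ <-] := Scorr_Z G.
rewrite -[leLHS](Rintegral_cst1 gZ); apply: Rintegral_le => //; first exact: rintegrable_cst.
move=> Z; rewrite -[leLHS](Rintegral_cst1 (kmeas M (Xof eta G Z))).
apply: Rintegral_le => //; [exact: rintegrable_cst|exact: rintegrable_fG|].
move=> y; apply: le_trans (hfun_corr_ge s2_gt0 _ _).
have := thG_sq G; have := ler_norm (Tdev G).
move=> /(ler_wpM2l (sqr_ge0 eta)).
by set A := \sum_(c | _) _; set B := eta ^+ 2 * Tdev G; set C := eta ^+ 2 * _; lra.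
Qed.

(** Only the entries of the block are kept in the Frobenius error. There the covariance is eta G, so
    [hfun_corr] bounds the error below by the correlation. *)
Lemma alpha_good (G : MX R d d) : good eta G ->
  ((s2 - eta ^+ 2 * `|Tdev G| - 2 * Scorr G)%:E <= alpha2_at (@Pr R d n _ _ gG) (@Zw R d n _ (MX R d d)) M (A1 G))%E.
Proof.
move=> gg; have [iZ ES] := Scorr_Z G.
have i1 := rintegrableZ 2 iZ.
have i2 := rintegrableB (rintegrable_cst gZ (s2 - eta ^+ 2 * `|Tdev G|)) i1.
have -> : s2 - eta ^+ 2 * `|Tdev G| - 2 * Scorr G =
   \int[gZ]_Z (s2 - eta ^+ 2 * `|Tdev G| - 2 * \int[kmeas M (Xof eta G Z)]_y fG G y).
  by rewrite (Rint_B (rintegrable_cst _ _) i1) (Rint_Z _ iZ) Rintegral_cst1 ES.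
apply: alpha2_at_lower => // Z; rewrite /A1 gg -/(Xof eta G Z).
have j1 := rintegrableZ 2 (rintegrable_fG G (Xof eta G Z)).
have j2 := rintegrableB (rintegrable_cst (kmeas M (Xof eta G Z)) (s2 - eta ^+ 2 * `|Tdev G|)) j1.
have -> : s2 - eta ^+ 2 * `|Tdev G| - 2 * \int[kmeas M (Xof eta G Z)]_y fG G y =
  \int[kmeas M (Xof eta G Z)]_y (s2 - eta ^+ 2 * `|Tdev G| - 2 * fG G y).
  by rewrite (Rint_B (rintegrable_cst _ _) j1) (Rint_Z _ (rintegrable_fG G (Xof eta G Z))) Rintegral_cst1.
apply: (@Rintegral_le_integral _ _ _ (kmeas M (Xof eta G Z))) => //.
  by move=> y; rewrite lee_fin frob2_ge0.
move=> y; rewrite lee_fin.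
have := hfun_corr s2_gt0 (thG G) y.
rewrite thG_sq normrM ger0_norm ?sqr_ge0// -/(fG G y).
set err := \sum_(c | msk c) _ => hc.
suff : err <= frob2 (y : 'M[R]_d) ((1%:M + Nmx eta G) *m (1%:M + Nmx eta G)^T) by lra.
rewrite /err /frob2 pair_bigA/= big_mkcond/=; apply: ler_sum => -[a j] _.
case: ifPn => [mc|_]; last exact: sqr_ge0.
by rewrite /= Nmx_cov.
Qed.

(** The mean correlation is bounded below by combining two pointwise bounds, one on each side of the
    event [good]. The coefficient 6/25 is 1/2 - 1/4 - 1/100: the main term, the loss from a^2 <= s2
    / 2, and the loss on the exceptional event. *)
Lemma large_ineq (a : R) : dp eps delta M -> 0 <= delta -> \int[gG]_G bad G <= 1 / 100 ->
  alpha2 (@Pr R d n _ _ gG) (Aw A1) (@Zw R d n _ (MX R d d)) M = (a ^+ 2)%:E ->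
  a ^+ 2 <= s2 / 2 ->
  6 / 25 * s2 - 3 / 4 * eta ^+ 2 * \int[gG]_G `|Tdev G| <=
  eta ^+ 2 * (n%:R * (3 * eps * tau + delta * tau * d%:R)).
Proof.
move=> dpM delta0 hbad ha a2.
apply: le_trans (Scorr_upper dpM delta0).
have [iT _] := Tdev_abs R d0.
pose L (G : MX R d d) := (1 - bad G) * (s2 - eta ^+ 2 * `|Tdev G| - 2 * Scorr G).
have iSc := rintegrable_Scorr.
have ii := rintegrableB (rintegrableB (rintegrable_cst gG s2) (rintegrableZ (eta ^+ 2) iT)) (rintegrableZ 2 iSc).
have iL : rintegrable gG L.
  apply: le_rintegrable (rintegrable_abs ii).
    apply: measurable_funM; last exact: rintegrable_mfun ii.
    by apply: measurable_funB => //; exact: measurable_bad.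
  move=> G; rewrite normrM /bad; case: good => /=.
    by rewrite subr0 normr1 mul1r.
  by rewrite subrr normr0 mul0r.
have pg := good_gt0 hbad.
have LE (G : MX R d d) : good eta G -> ((L G)%:E <= alpha2_at (@Pr R d n _ _ gG) (@Zw R d n _ (MX R d d)) M (A1 G))%E.
  by move=> gg; rewrite /L /bad gg subr0 mul1r; exact: alpha_good.
have L0 (G : MX R d d) : ~ good eta G -> L G = 0.
  by move=> /negP gg; rewrite /L /bad gg subrr mul0r.
have hL := alpha2_lower (measurable_good (R := R) (d := d) eta) A1_W_event pg iL LE L0 ha.
rewrite prob_good in hL.
set pb := \int[gG]_G bad G in hbad hL *.
have pb0 : 0 <= pb by apply: Rintegral_ge0 => G _; rewrite /bad; case: good.
have i3 := rintegrableZ (1 / 2) iL.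
have i4 := rintegrableZ s2 rintegrable_bad.
have i5 := rintegrableZ (3 / 4 * eta ^+ 2) iT.
have i6 := rintegrableB (rintegrableB (rintegrableB (rintegrable_cst gG (s2 / 2)) i3) i4) i5.
(* On [good], L determines [Scorr]; elsewhere L = 0 and [Scorr_lower] applies, the term s2 times
   [bad] turning s2 / 2 into - s2 / 2. *)
have pt (G : MX R d d) : s2 / 2 - 1 / 2 * L G - s2 * bad G - 3 / 4 * eta ^+ 2 * `|Tdev G| <= Scorr G.
  have := Scorr_lower G; have : 0 <= eta ^+ 2 * `|Tdev G| by rewrite mulr_ge0// sqr_ge0.
  rewrite /L /bad; case: good => /=; lra.
have := Rintegral_le i6 iSc pt.
rewrite (Rint_B (rintegrableB (rintegrableB (rintegrable_cst gG (s2 / 2)) i3) i4) i5).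
rewrite (Rint_B (rintegrableB (rintegrable_cst gG (s2 / 2)) i3) i4) (Rint_B (rintegrable_cst gG (s2 / 2)) i3).
rewrite (Rint_Z _ iL) (Rint_Z _ rintegrable_bad) (Rint_Z _ iT) Rintegral_cst1 -/pb.
have s20 := s2_gt0.
set IL := \int[gG]_G L G in hL *; set IT := \int[gG]_G _; set IS := \int[gG]_G _.
set s := pm R d * eta ^+ 2 in a2 s20 *.
apply: le_trans; rewrite lerD2r.
have : (1 - pb) * a ^+ 2 <= s / 2.
  have : (1 - pb) * a ^+ 2 <= a ^+ 2 by rewrite ler_piMl ?sqr_ge0//; lra.
  lra.
have : s * pb <= s * (1 / 100) by rewrite ler_pM2l.
lra.
Qed.

End large.

(** * Group privacy and low dimension *)

Section privacy.
Context (R : realType) (d n : nat) (eps delta : R).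
Variable M : R.-pker (MX R d n) ~> (MX R d d).
Hypothesis dpM : dp eps delta M.

(** Privacy is tested on the empty set, for two neighbouring data sets that exist because there is
    at least one column with at least one entry. *)
Lemma dp_delta_ge0 : (0 < d)%N -> (0 < n)%N -> 0 <= delta.
Proof.
move=> d0 n0; pose j0 := Ordinal n0; pose i0 := Ordinal d0.
pose X' : 'M[R]_(d, n) := \matrix_(i, j) (j == j0)%:R.
have nb : neighbors (0 : 'M[R]_(d, n)) X'.
  exists j0; split.
    apply/eqP => /matrixP/(_ i0 ord0); rewrite !mxE eqxx => /eqP.
    by rewrite eq_sym oner_eq0.
  by move=> k kj; apply/matrixP => i j; rewrite !mxE (negbTE kj).
by have := dpM nb measurable0; rewrite !measure0 mule0 add0e lee_fin.
Qed.

Hypothesis eps0 : 0 <= eps.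
Hypothesis delta0 : 0 <= delta.

(** The columns are set to 0 one at a time. The final data set carries no information on the
    covariance, so output laws under different covariances are all compared with the same law. *)
Lemma dp_group (X : MX R d n) (S : set (MX R d d)) : measurable S ->
  fine (kmeas M X S) <= expR (n%:R * eps) * (fine (kmeas M (0 : MX R d n) S) + n%:R * delta).
Proof.
move=> mS.
pose Xk k : MX R d n := \matrix_(i, j) (if (j < k)%N then 0 else fun_of_matrix X i j).
have fin Y : kmeas M Y S \is a fin_num by exact: fin_num_measure.
have p0 Y : 0 <= fine (kmeas M Y S) by rewrite fine_ge0.
have step k : (k < n)%N ->
    fine (kmeas M (Xk k) S) <= expR eps * fine (kmeas M (Xk k.+1) S) + delta.
  move=> kn; rewrite -lee_fin EFinD EFinM !fineK//.
  apply: (@dp_col R d n eps delta M dpM eps0 delta0 (Ordinal kn)) => // l lk.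
  apply/matrixP => i j; rewrite !mxE ltnS [(l <= k)%N]leq_eqVlt.
  by rewrite (_ : (nat_of_ord l == k) = false)//; apply/negbTE; apply: contra lk.
have main k : (k <= n)%N ->
    fine (kmeas M X S) <= expR (k%:R * eps) * (fine (kmeas M (Xk k) S) + k%:R * delta).
  elim: k => [_|k IH kn].
    rewrite mul0r expR0 mul1r mul0r addr0 (_ : Xk 0%N = X)//.
    by apply/matrixP => i j; rewrite mxE.
  apply: (le_trans (IH (ltnW kn))).
  have E : expR (k.+1%:R * eps) = expR (k%:R * eps) * expR eps.
    by rewrite -expRD -natr1 mulrDl mul1r.
  rewrite E -mulrA ler_pM2l ?expR_gt0//.
  have h2 : k.+1%:R * delta <= expR eps * (k.+1%:R * delta).
    by rewrite ler_peMl ?mulr_ge0// -expR0 ler_expR.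
  rewrite mulrDr; apply: (le_trans (lerD (step k kn) (lexx _))).
  by rewrite -addrA lerD2l; apply: le_trans h2; rewrite -natr1 mulrDl mul1r addrC.
rewrite (_ : (0 : MX R d n) = Xk n); first exact: main.
by apply/matrixP => i j; rewrite !mxE ltn_ord.
Qed.
End privacy.

Lemma ndelta_le (R : realType) (n : nat) (delta : R) : (0 < n)%N ->
  delta <= (3 * n%:R * ln (expR 1 * n%:R))^-1 -> n%:R * delta <= 1 / 3.
Proof.
move=> n0 h; have n0' : 0 < n%:R :> R by rewrite ltr0n.
have l1 : 1 <= ln (expR 1 * n%:R) :> R.
  by rewrite lnM ?posrE ?expR_gt0// expRK lerDl ln_ge0// ler1n.
apply: (@le_trans _ _ (n%:R * (3 * n%:R * ln (expR 1 * n%:R))^-1)).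
  by rewrite ler_pM2l.
have l0 : 0 < ln (expR 1 * n%:R) :> R by apply: lt_le_trans l1.
set l := ln _ in l1 l0 *; clearbody l.
rewrite (_ : n%:R * _ = l^-1 / 3); last by field; rewrite !gt_eqF.
by rewrite ler_pM2r// invf_le1.
Qed.

(** * The two-point prior *)

Section two_point.
Context (R : realType) (d n : nat).

Definition A2 (b : bool) : 'M[R]_d := (if b then 3 else 2^-1)%:M.

Lemma A2_W b : @Wset R d (A2 b *m (A2 b)^T).
Proof.
split; first by rewrite trmx_mul trmxK.
move=> v; rewrite /A2 scal_quad; have := vv_ge0 v.
by case: b; nra.
Qed.

Lemma A2_posdef b : posdef (A2 b *m (A2 b)^T).
Proof.
split; first by rewrite trmx_mul trmxK.
move=> v v0; rewrite /A2 scal_quad mulr_gt0 ?vv_gt0// exprn_gt0//.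
by case: b; rewrite ?invr_gt0.
Qed.

Definition cov2 (b : bool) : R := if b then 9 else 4^-1.

Lemma A2_cov b : A2 b *m (A2 b)^T = (cov2 b)%:M.
Proof.
rewrite /A2 tr_scalar_mx -scalar_mxM; congr (_%:M); rewrite /cov2.
by case: b; lra.
Qed.

Local Notation r2 := ((35 / 8) ^+ 2 * d%:R : R).
Local Notation bern := (bernoulli_prob (2^-1 : R)).

(* The two covariances are at squared distance [4 * r2], so [y] outside [near false] is at
   squared distance at least [r2] from [cov2 false]. *)
Definition near (b : bool) : set (MX R d d) :=
  [set y | (frob2 (y : 'M[R]_d) (cov2 true)%:M < r2) = b].

Lemma measurable_frob2 (s : R) : measurable_fun setT (fun y : MX R d d => frob2 (y : 'M[R]_d) s%:M).
Proof.
apply: measurable_sum => i; apply: measurable_sum => j.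
by apply: measurable_funX; apply: measurable_funB => //; exact: measurable_coord.
Qed.

Lemma measurable_near b : measurable (near b).
Proof.
have mt : measurable (near true).
  rewrite [X in measurable X](_ : _ = (fun y : MX R d d => frob2 (y : 'M[R]_d) (cov2 true)%:M) @^-1` `]-oo, r2[%classic).
    by rewrite -[X in measurable X]setTI; exact: (measurable_frob2 _).
  by apply/seteqP; split => y /=; rewrite in_itv/=.
case: b => //.
rewrite (_ : near false = ~` near true); first exact: measurableC.
by apply/seteqP; split => y /=; rewrite /near /=; case: (_ < _).
Qed.

Lemma frob2_far b y : ~ near b y -> r2 <= frob2 (y : 'M[R]_d) (cov2 b)%:M.
Proof.
rewrite /near /=; case: b => h.
  by rewrite leNgt; apply/negP.
have {h} h : frob2 (y : 'M[R]_d) (cov2 true)%:M < r2.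
  by move: h; case: (_ < _).
have : 4 * r2 <= 2 * frob2 (y : 'M[R]_d) (cov2 true)%:M + 2 * frob2 (y : 'M[R]_d) (cov2 false)%:M.
  rewrite /frob2 !mulr_sumr -big_split/=.
  have -> : 4 * r2 = \sum_(i < d) 4 * (35 / 8) ^+ 2.
    by rewrite sumr_const card_ord -[RHS]mulr_natr; ring.
  apply: ler_sum => i _; rewrite !mulr_sumr -big_split/= (bigD1 i)//=.
  apply: ler_wpDr.
    by apply: sumr_ge0 => j _; rewrite addr_ge0// mulr_ge0// sqr_ge0.
  rewrite !mxE eqxx !mulr1n; set u := (y i i : R).
  have := sqr_ge0 (2 * u - (9 + 4^-1)); nra.
lra.
Qed.

Lemma A2_W_event : [set w : bool * MX R d n | @Wset R d (Aw A2 w *m (Aw A2 w)^T)] = [set w | [set: bool] w.1].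
Proof. by apply/seteqP; split => w // _; exact: A2_W. Qed.

(** Le Cam's two-point argument. An output outside [near b] costs at least r2, and group privacy
    compares the probability of [near b] with its value for the zero data set; there the
    probabilities for the two values of b sum to 1, so their average is 1/2. *)
Lemma two_point_bound (eps delta a : R) (M : R.-pker (MX R d n) ~> (MX R d d)) :
  0 <= eps -> 0 <= delta -> dp eps delta M ->
  alpha2 (@Pr R d n _ _ bern) (Aw A2) (@Zw R d n _ bool) M = (a ^+ 2)%:E ->
  r2 * (1 - expR (n%:R * eps) * (1 / 2 + n%:R * delta)) <= a ^+ 2.
Proof.
move=> eps0 delta0 dpM ha.
pose m b := fine (kmeas M (0 : MX R d n) (near b)).
have m1 : m true + m false = 1.
  rewrite /m (_ : near false = ~` near true); last first.
    by apply/seteqP; split => y /=; rewrite /near /=; case: (_ < _).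
  rewrite -fineD; [|exact: fin_num_measure (measurable_near _)|]; last first.
    by apply: fin_num_measure; apply: measurableC; exact: measurable_near.
  rewrite probability_setC; last exact: measurable_near.
  by rewrite addeC subeK// fin_num_measure//; exact: measurable_near.
pose L0 b := r2 * (1 - expR (n%:R * eps) * (m b + n%:R * delta)).
(* Truncation at 0 keeps the minorant nonnegative, as required by the evaluation of Bernoulli
   integrals. *)
pose L b := Num.max (L0 b) 0.
have L_ge0 b : 0 <= L b by rewrite le_max lexx orbT.
have iL : rintegrable bern L.
  apply: (@rintegrable_bounded _ _ _ _ _ (L true + L false)) => //.
  by move=> b; rewrite ger0_norm//; case: b; rewrite ?lerDl ?lerDr.
have r20 : 0 <= r2 by rewrite mulr_ge0// sqr_ge0.
have LE b : [set: bool] b -> ((L b)%:E <= alpha2_at (@Pr R d n _ _ bern) (@Zw R d n _ bool) M (A2 b))%E.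
  move=> _; rewrite /L EFin_max ge_max alpha2_at_ge0 andbT.
  rewrite -(Rintegral_cst1 (gmx R d n) (L0 b)); apply: alpha2_at_lower; first exact: rintegrable_cst.
  move=> Z; rewrite A2_cov; set X := (A2 b *m Z : MX R d n).
  have iI : rintegrable (kmeas M X) (\1_(near b)).
    apply: (@rintegrable_bounded _ _ _ _ _ 1); first exact: (measurable_indic (measurable_near b)).
    by move=> y; rewrite indicE; case: (_ \in _); rewrite ?normr0 ?normr1.
  have iB := rintegrableB (rintegrable_cst (kmeas M X) r2) (rintegrableZ r2 iI).
  apply: (@le_trans _ _ (\int[kmeas M X]_y (r2 - r2 * \1_(near b) y))%:E); last first.
    apply: Rintegral_le_integral => // y; first by rewrite lee_fin frob2_ge0.
    rewrite lee_fin indicE; case: (boolP (y \in near b)) => [_|/negP h].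
      by rewrite mulr1 subrr frob2_ge0.
    by rewrite mulr0 subr0; apply: frob2_far => hn; apply: h; rewrite inE.
  rewrite lee_fin (Rint_B (rintegrable_cst (kmeas M X) r2) (rintegrableZ r2 iI)) (Rint_Z _ iI) Rintegral_cst1.
  have -> : \int[kmeas M X]_y (\1_(near b) y) = fine (kmeas M X (near b)).
    by rewrite /Rintegral integral_indic// ?setIT//; exact: measurable_near.
  rewrite /L0 mulrBr mulr1 lerD2l lerN2 ler_wpM2l//.
  by apply: dp_group => //; exact: measurable_near.
have hL := alpha2_lower measurableT A2_W_event _ iL LE _ ha.
rewrite probability_setT in hL.
have hL2 : \int[bern]_b L b <= a ^+ 2.
  by have := hL lte01 (fun x h => False_ind _ (h Logic.I)); rewrite /= mul1r.
suff : r2 * (1 - expR (n%:R * eps) * (1 / 2 + n%:R * delta)) <= \int[bern]_b L b.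
  by move=> /le_trans; exact.
have -> : \int[bern]_b L b = (L true + L false) / 2.
  rewrite /Rintegral integral_bernoulli_prob.
  - by rewrite -!EFinM -EFinD /= /unstable.onem; field.
  - by rewrite invr_ge0 ler0n/= invf_le1// ler1n.
  - by move=> b; rewrite lee_fin.
have t1 : L0 true <= L true by rewrite le_max lexx.
have t2 : L0 false <= L false by rewrite le_max lexx.
rewrite ler_pdivlMr//; apply: le_trans (lerD t1 t2).
rewrite /L0 -mulrDr -mulrA; apply: ler_wpM2l => //.
move: m1; set e := expR _; set u := m true; set v := m false; move=> uv.
by rewrite (_ : v = 1 - u); [rewrite le_eqVlt; apply/orP; left; apply/eqP; field|lra].
Qed.

(** If n eps < 1/10, then exp(n eps) <= 10/9 and the factor in [two_point_bound] is at least 1 -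
    (10/9)(1/2 + 1/3) = 2/27, which makes the squared error exceed d / 225. *)
Lemma small_case (eps delta a : R) (M : R.-pker (MX R d n) ~> (MX R d d)) :
  (0 < d)%N -> 0 <= eps -> 0 <= delta -> n%:R * delta <= 1 / 3 -> dp eps delta M ->
  alpha2 (@Pr R d n _ _ bern) (Aw A2) (@Zw R d n _ bool) M = (a ^+ 2)%:E ->
  a ^+ 2 <= d%:R / 225 -> 1 / 10 <= n%:R * eps.
Proof.
move=> d0 eps0 delta0 nd dpM ha a2; rewrite leNgt; apply/negP => ne.
have := two_point_bound eps0 delta0 dpM ha.
have d0' : 0 < d%:R :> R by rewrite ltr0n.
have e1 : expR (n%:R * eps) <= 10 / 9.
  apply: (@le_trans _ _ (expR (1 / 10))); first by rewrite ler_expR ltW.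
  have := expR_ge1Dx (- (1 / 10) : R); rewrite expRN.
  have := expR_gt0 (1 / 10 : R); set e := expR _ => ep; clearbody e => h.
  have : (1 - 1 / 10) * e <= 1 by move: h; rewrite -(ler_pM2r ep) mulVf ?gt_eqF.
  lra.
have : expR (n%:R * eps) * (1 / 2 + n%:R * delta) <= 10 / 9 * (5 / 6).
  apply: ler_pM => //; [|lra].
  by rewrite addr_ge0// mulr_ge0.
set q := expR _ * _ => hq.
have : r2 * (1 - 10 / 9 * (5 / 6)) <= r2 * (1 - q).
  by rewrite ler_wpM2l ?mulr_ge0 ?sqr_ge0//; lra.
move=> h1 h2; have := le_trans h1 (le_trans h2 a2); lra.
Qed.
End two_point.

(** * Choice of the scale *)

Section large_dim.
Context (R : realType) (d n : nat).
Hypothesis d_large : 30 * 100 <= d%:R :> R.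
Local Notation x := (d%:R : R).

Lemma pm_bounds : x ^+ 2 / 5 <= pm R d /\ pm R d <= x ^+ 2 / 4.
Proof.
have hd : x = (odd d)%:R + 2 * (d./2)%:R by rewrite -{1}(odd_double_half d) natrD -mul2n natrM.
have hp : pm R d = ((odd d)%:R + (d./2)%:R) * (d./2)%:R.
  rewrite pmE natrM -natrD; congr (_%:R * _).
  by rewrite -{1}(odd_double_half d) -addnn addnA addnK.
have := d_large; rewrite hp hd; set k := (d./2)%:R; clearbody k.
move=> dl; have k1 : 1 <= k by move: dl; case: (odd d) => /=; lra.
have kk : k <= k ^+ 2 by rewrite expr2 ler_peMl//; apply: le_trans k1.
by clear dl; case: (odd d) => /=; split; nra.
Qed.

Definition eta_of (eps : R) : R := Num.min (Num.sqrt (20 * x)^-1) (x / (50 * (eps * n%:R))).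

Lemma eta_sq eps : 0 < eps -> (0 < n)%N -> 0 < eta_of eps /\ eta_of eps ^+ 2 * (20 * x) <= 1.
Proof.
move=> e0 n0; have n0' : 0 < n%:R :> R by rewrite ltr0n.
have x0 : 0 < x by apply: lt_le_trans d_large.
have s0 : 0 < Num.sqrt (20 * x)^-1 :> R by rewrite sqrtr_gt0 invr_gt0 mulr_gt0.
have p : 0 < eta_of eps by rewrite lt_min s0 divr_gt0// !mulr_gt0.
split => //; rewrite -ler_pdivlMr ?mulr_gt0// div1r.
rewrite -[leRHS]sqr_sqrtr ?invr_ge0 ?mulr_ge0 ?(ltW x0)//.
by rewrite ler_sqr ?nnegrE ?(ltW p) ?(ltW s0)// ge_min lexx.
Qed.

Lemma bad_small eps : 0 < eps -> (0 < n)%N -> \int[gmx R d d]_G bad (eta_of eps) G <= 1 / 100.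
Proof.
move=> e0 n0; have [p q] := eta_sq e0 n0.
apply: (le_trans (bad_prob (ltW p) q)).
have d7 : (7 <= d)%N by rewrite -(ler_nat R); apply: le_trans d_large; lra.
rewrite -(subnKC d7) exprD.
apply: (@le_trans _ _ (2^-1 ^+ 7 * 1)); last by lra.
rewrite ler_pM2l ?exprn_gt0 ?invr_gt0// exprn_ile1// ?invr_ge0//.
by rewrite invf_le1// ler1n.
Qed.

(** The choice of eta makes the two bounds on the correlation incompatible with a^2 <= s2 / 2. Hence
    a^2 exceeds s2 / 2, which is at least d^2 eta^2 / 10, and the conclusion is read off from the
    value of eta. *)
Lemma large_case (eps delta a : R) (M : R.-pker (MX R d n) ~> (MX R d d)) :
  (0 < n)%N -> 0 < eps < 1 -> 0 <= delta -> n%:R * delta <= 1 / 3 -> dp eps delta M ->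
  alpha2 (@Pr R d n _ _ (gmx R d d)) (Aw (A1 (eta_of eps))) (@Zw R d n _ (MX R d d)) M = (a ^+ 2)%:E ->
  0 <= a -> a ^+ 2 <= x / 225 -> x ^+ 2 <= 160 * (n%:R * (eps * a)).
Proof.
move=> n0 eps01 delta0 nd dpM ha a0 a2.
have /andP[e0 _] := eps01.
have n0' : 0 < n%:R :> R by rewrite ltr0n.
have x0 : 0 < x by apply: lt_le_trans d_large.
have d0 : (0 < d)%N by rewrite -(ltr0n R).
have [p q] := eta_sq e0 n0.
have [pl pu] := pm_bounds.
have pm0 : 0 < pm R d by apply: lt_le_trans pl; rewrite divr_gt0// exprn_gt0.
have key : pm R d * eta_of eps ^+ 2 / 2 < a ^+ 2.
  rewrite ltNge; apply/negP => hs.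
  have := large_ineq p pm0 d0 eps01 dpM delta0 (bad_small e0 n0) ha hs.
  have [_ hT] := Tdev_abs R d0.
  rewrite sqrtrM; last exact: ltW.
  rewrite sqrtr_sqr (gtr0_norm p).
  have tt : Num.sqrt (pm R d) ^+ 2 = pm R d by rewrite sqr_sqrtr// ltW.
  have t0 : 0 <= Num.sqrt (pm R d) by exact: sqrtr_ge0.
  set t := Num.sqrt _ in tt t0 *.
  have tx : t <= x / 2.
    by rewrite -ler_sqr ?nnegrE ?divr_ge0 ?(ltW x0)// tt; apply: le_trans pu _; rewrite le_eqVlt; apply/orP; left; apply/eqP; field.
  have en : eta_of eps * (eps * n%:R) <= x / 50.
    have h : eta_of eps <= x / (50 * (eps * n%:R)) by rewrite ge_min lexx orbT.
    have en0 : 0 < eps * n%:R by rewrite mulr_gt0.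
    move: h; rewrite -(ler_pM2r en0) => /le_trans; apply.
    by rewrite le_eqVlt; apply/orP; left; apply/eqP; field; rewrite !gt_eqF.
  have e200 : eta_of eps <= 1 / 200.
    rewrite -ler_sqr ?nnegrE ?(ltW p)//.
    have : eta_of eps ^+ 2 * (20 * (30 * 100)) <= 1.
      by apply: le_trans q; rewrite ler_wpM2l ?sqr_ge0// ler_pM2l.
    lra.
  set IT := \int[_]_G _ in hT *; set et := eta_of eps in p en e200 *.
  (* Since the block has at most d^2 / 4 entries, [Tdev_abs] gives (999/8 + 1/2) d. *)
  have {hT} hT : IT <= 126 * x.
    apply: (le_trans hT).
    have : pm R d / (2 * x) <= x ^+ 2 / 4 / (2 * x).
      by rewrite ler_pM2r ?invr_gt0 ?mulr_gt0.
    rewrite (_ : x ^+ 2 / 4 / (2 * x) = x / 8); last by field; rewrite gt_eqF.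
    rewrite -[999 * _ / _]mulrA; set u := pm R d / _; lra.
  rewrite (_ : 6 / 25 * _ - _ = et ^+ 2 * (6 / 25 * pm R d - 3 / 4 * IT)); last by ring.
  rewrite ler_pM2l ?exprn_gt0//.
  rewrite (_ : n%:R * _ = t / 2 * (3 * (et * (eps * n%:R)) + et * ((n%:R * delta) * x))); last by ring.
  apply/negP; rewrite -ltNge.
  have b1 : et * (n%:R * delta * x) <= 1 / 200 * (1 / 3 * x).
    apply: ler_pM => //; [exact: ltW|by rewrite !mulr_ge0// ltW|].
    by rewrite ler_pM2r.
  have b2 : t / 2 * (3 * (et * (eps * n%:R)) + et * ((n%:R * delta) * x)) <= x / 4 * (3 * (x / 50) + 1 / 200 * (1 / 3 * x)).
    apply: ler_pM; first by rewrite divr_ge0.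
    - by rewrite addr_ge0// !mulr_ge0// ltW.
    - lra.
    - lra.
  apply: (le_lt_trans b2).
  (* The comparison that fixes the threshold: the left side is at least 0.048 d^2 - 94.5 d, hence at
     least 0.0165 d^2 once d >= 3000, against 3/200 + 1/2400 < 0.0155 times d^2 on the right. *)
  have : 30 * 100 * x <= x ^+ 2 by rewrite expr2 ler_pM2r.
  move: hT pl; set y := x ^+ 2; rewrite (_ : x / 4 * _ = y * (3 / 200 + 1 / (24 * 100))); last by rewrite /y; field.
  lra.
have k2 : x ^+ 2 * eta_of eps ^+ 2 / 10 <= a ^+ 2.
  apply: ltW; apply: le_lt_trans key.
  have : x ^+ 2 / 5 * eta_of eps ^+ 2 <= pm R d * eta_of eps ^+ 2 by rewrite ler_wpM2r// sqr_ge0.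
  lra.
(* If the first term is the minimum, then a^2 >= d / 200, against the upper bound d / 225 on a^2.
   Otherwise a >= d^2 / (50 sqrt 10 eps n), and 160 is a rounding of 50 sqrt 10, as 160^2 >=
   25000. *)
have [h|h] := leP (Num.sqrt (20 * x)^-1) (x / (50 * (eps * n%:R))).
  exfalso; move: k2; rewrite /eta_of (min_idPl h) sqr_sqrtr ?invr_ge0 ?mulr_ge0 ?(ltW x0)//.
  rewrite (_ : x ^+ 2 / _ / 10 = x / 200); last by field; rewrite gt_eqF.
  lra.
move: k2; rewrite /eta_of (min_idPr (ltW h)) => k2.
have en0 : 0 < eps * n%:R by rewrite mulr_gt0.
have k3 : (x ^+ 2) ^+ 2 <= (160 * (n%:R * (eps * a))) ^+ 2.
  rewrite (_ : (160 * (n%:R * (eps * a))) ^+ 2 = (160 * 160) * (a ^+ 2 * (eps * n%:R) ^+ 2)); last by ring.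
  have : x ^+ 2 * (x / (50 * (eps * n%:R))) ^+ 2 / 10 * (eps * n%:R) ^+ 2 <= a ^+ 2 * (eps * n%:R) ^+ 2.
    by rewrite ler_wpM2r// sqr_ge0.
  rewrite (_ : _ / 10 * _ = (x ^+ 2) ^+ 2 / (250 * 100)); last by field; rewrite !gt_eqF.
  have := sqr_ge0 (x ^+ 2); set z := (_ ^+ 2 ^+ 2); set w := a ^+ 2 * _; lra.
move: k3; rewrite ler_sqr// nnegrE ?sqr_ge0//.
by rewrite !mulr_ge0// ltW.
Qed.
End large_dim.

Theorem theorem1 (R : realType) :
  exists c : R, 0 < c /\
  forall (d n : nat) (eps delta : R),
    (1 <= d)%N -> (1 <= n)%N -> 0 < eps < 1 ->
    delta <= (3 * n%:R * ln (expR 1 * n%:R))^-1 ->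
    exists (dO : measure_display) (O : measurableType dO)
           (P : probability O R)
           (A : O -> 'M[R]_d) (Z : 'I_d -> 'I_n -> O -> R),
      measurable_fun setT (A : O -> MX R d d) /\
      (forall i j, measurable_fun setT (Z i j)) /\
      (forall w, posdef (A w *m (A w)^T)) /\
      (forall (B : set (MX R d d)) (C : 'I_d -> 'I_n -> set R),
          measurable B -> (forall i j, measurable (C i j)) ->
          P [set w | B (A w) /\ forall i j, C i j (Z i j w)] =
          (P [set w | B (A w)] *
           \prod_(i < d) \prod_(j < n) normal_prob 0 1 (C i j))%E) /\
      (0 < P [set w | @Wset R d (A w *m (A w)^T)])%E /\
      forall M : R.-pker (MX R d n) ~> (MX R d d),
        dp eps delta M ->
        forall a : R, 0 <= a -> alpha2 P A Z M = (a ^+ 2)%:E ->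
          2 ^- d <= a <= Num.sqrt d%:R / 15 ->
          c * (d%:R ^+ 2 / (eps * a)) <= n%:R.
Proof.
(* Both [D0] and [K] are introduced through existentials, which keeps the large numbers opaque. *)
have [D0 E0] : exists D0 : nat, D0%:R = 30 * 100 :> R.
  by exists (30 * 100)%N; rewrite natrM.
have D1 : 1 <= D0%:R :> R by rewrite E0; lra.
(* [K] pays for dimensions up to [D0]: it absorbs d^2 <= D0^2, and also 1 / a <= 2^D0, which comes
   from the lower bound on a. *)
have [K KE] : exists K : R, K = D0%:R ^+ 2 * 2 ^+ D0 by eexists.
have K1 : 1 <= K.
  rewrite KE.
  apply: mulr_ege1; last by rewrite exprn_ege1// ler1n.
  by rewrite exprn_ege1.
have K0 : 0 < K by apply: lt_le_trans K1.
exists (160 * K)^-1; split; first by rewrite invr_gt0 mulr_gt0.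
move=> d n eps delta d1 n1 eps01 hdelta.
have /andP[e0 _] := eps01.
have nd := ndelta_le n1 hdelta.
have a_facts (a : R) : 0 <= a -> 2 ^- d <= a <= Num.sqrt d%:R / 15 ->
    0 < a /\ a ^+ 2 <= d%:R / 225.
  move=> a0 /andP[a1 a2]; split.
    by apply: lt_le_trans a1; rewrite invr_gt0 exprn_gt0.
  have : a ^+ 2 <= (Num.sqrt d%:R / 15) ^+ 2.
    by rewrite ler_sqr ?nnegrE ?divr_ge0 ?sqrtr_ge0.
  by rewrite expr_div_n sqr_sqrtr// => /le_trans; apply; rewrite -natrX.
have concl (a : R) : 0 < a -> d%:R ^+ 2 <= 160 * K * (n%:R * (eps * a)) ->
    (160 * K)^-1 * (d%:R ^+ 2 / (eps * a)) <= n%:R.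
  move=> a0 h; rewrite mulrCA -invfM ler_pdivrMr ?mulr_gt0//.
  by rewrite mulrCA.
have [dD|dD] := leqP d D0.
- have W := @A2_W_event R d n.
  have mA : measurable_fun setT (@A2 R d : bool -> MX R d d) by [].
  exists _, (bool * MX R d n)%type, (@Pr R d n _ _ (bernoulli_prob (2^-1 : R))), (Aw (@A2 R d)), (@Zw R d n _ bool).
  split; first exact: measurable_Aw.
  split; first exact: measurable_Zw.
  split; first by move=> w; exact: A2_posdef.
  split; first exact: model_indep.
  split; first by rewrite W Pr_fst_event// probability_setT.
  move=> M dpM a a0 ha a12; have [a0' a2] := a_facts a a0 a12.
  have delta0 := dp_delta_ge0 dpM d1 n1.
  have ne := small_case d1 (ltW e0) delta0 nd dpM ha a2.
  apply: concl => //.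
  have /andP[a1 _] := a12.
  have h1 : 1 <= 2 ^+ D0 * a.
    apply: (@le_trans _ _ (2 ^+ d * a)).
      by move: a1; rewrite -(ler_pM2l (x := 2 ^+ d)) ?exprn_gt0// divff// expf_neq0.
    by rewrite ler_pM2r// ler_weXn2l// ler1n.
  have h2 : d%:R ^+ 2 <= D0%:R ^+ 2 :> R by rewrite ler_sqr ?nnegrE// ler_nat.
  have h3 : 1 <= 160 * (n%:R * eps) by lra.
  apply: (le_trans h2).
  (* Each of the two factors that multiply D0^2 is at least 1, by [h1] and [h3]. *)
  rewrite (_ : 160 * K * _ = D0%:R ^+ 2 * ((2 ^+ D0 * a) * (160 * (n%:R * eps)))); last by rewrite KE; ring.
  by rewrite ler_peMr ?sqr_ge0// mulr_ege1.
- have dl : 30 * 100 <= d%:R :> R by rewrite -E0 ler_nat ltnW.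
  have [p q] := eta_sq dl e0 n1.
  have hb := bad_small dl e0 n1.
  pose eta : R := eta_of d n eps.
  have W := @A1_W_event R d n eta d1.
  have mA := @measurable_A1 R d eta.
  exists _, (MX R d d * MX R d n)%type, (@Pr R d n _ _ (gmx R d d)), (Aw (A1 eta)), (@Zw R d n _ (MX R d d)).
  split; first exact: measurable_Aw.
  split; first exact: measurable_Zw.
  split; first by move=> w; exact: A1_posdef.
  split; first exact: model_indep.
  split.
    rewrite W; have -> : @Pr R d n _ _ (gmx R d d) [set w | good eta w.1] = gmx R d d [set G : MX R d d | good eta G].
      by apply: (@Pr_fst_event R d n _ _ (gmx R d d) [set G : MX R d d | good eta G]); exact: measurable_good.
    exact: good_gt0.
  move=> M dpM a a0 ha a12; have [a0' a2] := a_facts a a0 a12.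
  have delta0 := dp_delta_ge0 dpM d1 n1.
  have h := large_case dl n1 eps01 delta0 nd dpM ha a0 a2.
  apply: concl => //; apply: (le_trans h).
  by rewrite -mulrA ler_pM2l// ler_peMl// !mulr_ge0// ltW.
Qed.
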